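(* Let $S$ be a commutative unital ring such that $\operatorname{Spec} S$ is a noetherian topological space, and let $R = S^{\mathrm{abs}}$ be the absolutely flat approximation of $S$. Then the telescope conjecture holds for $\mathsf{D}(R)$, i.e. every smashing subcategory of $\mathsf{D}(R)$ is generated, as a localising subcategory, by compact objects of $\mathsf{D}(R)$.
   Context: All rings are commutative and unital. A ring $R$ is absolutely flat (von Neumann regular) if for every $r\in R$ there is $x\in R$ with $r=r^2x$. The absolutely flat approximation of a ring $S$ is the absolutely flat ring $S^{\mathrm{abs}}$ together with the ring map $S\to S^{\mathrm{abs}}$ which is universal among ring maps from $S$ to absolutely flat rings; explicitly $S^{\mathrm{abs}} = S[x_s \mid s\in S]/(s^2x_s - s,\ x_s^2 s - x_s \mid s\in S)$. $\mathsf{D}(R)$ is the unbounded derived category of $R$-modules; its compact objects are the perfect complexes. A localising subcategory is a full triangulated subcategory closed under arbitrary coproducts. A smashing subcategory is a localising subcategory $\mathcal{S}$ whose inclusion into $\mathsf{D}(R)$ admits a right adjoint that preserves coproducts. A localising subcategory is generated by compact objects if it is the smallest localising subcategory containing some collection of compact objects of $\mathsf{D}(R)$. *)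

(* Defs.v *)
From HB Require Import structures.
From Stdlib Require List.
From mathcomp Require Import all_boot all_order all_algebra.
From mathcomp Require Import boolp classical_sets topology.

Set Implicit Arguments.
Unset Strict Implicit.
Unset Printing Implicit Defensive.

Import GRing.Theory.

Local Open Scope ring_scope.

(* Commutative rings are comPzRingType: the zero ring is allowed. *)
Definition absolutely_flat (R : comPzRingType) : Prop :=
  forall r : R, exists x : R, r = r ^+ 2 * x.

Definition is_abs_flat_approx (S R : comPzRingType) (phi : {rmorphism S -> R})
    : Prop :=
  absolutely_flat R /\
  forall (T : comPzRingType) (f : {rmorphism S -> T}), absolutely_flat T ->
    exists g : {rmorphism R -> T},
      (forall s, g (phi s) = f s) /\
      (forall g' : {rmorphism R -> T}, (forall s, g' (phi s) = f s) ->
         forall r, g' r = g r).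

Record Spec (S : comPzRingType) : Type := PrimeIdeal {
  prime_set : set S;
  prime_add : forall a b, prime_set a -> prime_set b -> prime_set (a + b);
  prime_mull : forall a b, prime_set b -> prime_set (a * b);
  prime_zero : prime_set 0;
  prime_proper : ~ prime_set 1;
  prime_mul : forall a b, prime_set (a * b) -> prime_set a \/ prime_set b }.

Section Zariski.
Local Open Scope classical_set_scope.
Variable S : comPzRingType.

HB.instance Definition _ := gen_eqMixin (Spec S).
HB.instance Definition _ := gen_choiceMixin (Spec S).

Definition zariski_closed_locus (E : set S) : set (Spec S) :=
  [set p | E `<=` prime_set p].

Definition zariski_open (U : set (Spec S)) : Prop :=
  exists E : set S, U = ~` zariski_closed_locus E.

Lemma zariski_openT : zariski_open setT.
Proof.
exists [set 1]; apply/esym/seteqP; split => // p _ /= h.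
exact: (prime_proper (h 1 erefl)).
Qed.

Lemma zariski_openI : setI_closed zariski_open.
Proof.
move=> _ _ [E ->] [F ->].
exists [set x | exists a b, [/\ E a, F b & x = a * b]].
rewrite -setCU; congr (~` _); apply/seteqP; split => p /=.
  case=> h _ [a [b [Ea Fb ->]]]; last exact/prime_mull/h.
  by rewrite mulrC; exact/prime_mull/h.
move=> h; have [hE|/existsNP[a /not_implyP[Ea na]]] := pselect (E `<=` prime_set p).
  by left.
right=> b Fb; have [//|//] : prime_set p a \/ prime_set p b.
by apply/prime_mul/h; exists a, b.
Qed.

Lemma zariski_open_bigU (I : Type) (f : I -> set (Spec S)) :
  (forall i, zariski_open (f i)) -> zariski_open (\bigcup_i f i).
Proof.
move=> /choice[E hE]; exists (\bigcup_i E i).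
apply/seteqP; split => p.
  by case=> i _; rewrite hE => h hp; apply: h => a Ea; apply: hp; exists i.
move=> h; apply: contrapT => hn; apply: h => a [i _ Ea].
apply: contrapT => na; apply: hn; exists i => //.
by rewrite hE => /(_ _ Ea).
Qed.

HB.instance Definition _ := isOpenTopological.Build (Spec S)
  zariski_openT zariski_openI zariski_open_bigU.

End Zariski.

Definition noetherian_space (T : topologicalType) : Prop :=
  forall F : nat -> set T,
    (forall n, closed (F n)) ->
    (forall n, (F n.+1 `<=` F n)%classic) ->
    exists N : nat, forall n : nat, (N <= n)%N -> F n = F N.

(* Hom-sets are setoids: [eqh] is equality of morphisms. *)
Record category := Category {
  ob : Type;
  hom : ob -> ob -> Type;
  eqh : forall X Y, hom X Y -> hom X Y -> Prop;
  idm : forall X, hom X X;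
  cmp : forall X Y Z, hom Y Z -> hom X Y -> hom X Z;
  eqh_refl : forall X Y (f : hom X Y), eqh f f;
  eqh_sym : forall X Y (f g : hom X Y), eqh f g -> eqh g f;
  eqh_trans : forall X Y (f g h : hom X Y), eqh f g -> eqh g h -> eqh f h;
  eqh_cmp : forall X Y Z (g g' : hom Y Z) (f f' : hom X Y),
    eqh g g' -> eqh f f' -> eqh (cmp g f) (cmp g' f');
  cmp1m : forall X Y (f : hom X Y), eqh (cmp (idm Y) f) f;
  cmpm1 : forall X Y (f : hom X Y), eqh (cmp f (idm X)) f;
  cmpA : forall X Y Z W (h : hom Z W) (g : hom Y Z) (f : hom X Y),
    eqh (cmp h (cmp g f)) (cmp (cmp h g) f) }.

Notation "f =~ g" := (eqh f g) (at level 70).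
Notation "g \circ f" := (cmp g f) (at level 40, left associativity).

Record functor (C D : category) := Functor {
  fob :> ob C -> ob D;
  fmap : forall X Y, hom X Y -> hom (fob X) (fob Y);
  fmap_eqh : forall X Y (f g : hom X Y), f =~ g -> fmap f =~ fmap g;
  fmap1 : forall X, fmap (idm X) =~ idm (fob X);
  fmapM : forall X Y Z (g : hom Y Z) (f : hom X Y),
    fmap (g \circ f) =~ fmap g \circ fmap f }.

(* adjunction F G: F is left adjoint to G. *)
Record adjunction (C D : category) (F : functor C D) (G : functor D C) :=
  Adjunction {
  adj : forall X Y, hom (F X) Y -> hom X (G Y);
  adj_inv : forall X Y, hom X (G Y) -> hom (F X) Y;
  adj_eqh : forall X Y (f g : hom (F X) Y), f =~ g -> adj f =~ adj g;
  adj_inv_eqh : forall X Y (f g : hom X (G Y)),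
    f =~ g -> adj_inv f =~ adj_inv g;
  adjK : forall X Y (f : hom (F X) Y), adj_inv (adj f) =~ f;
  adj_invK : forall X Y (f : hom X (G Y)), adj (adj_inv f) =~ f;
  adj_natl : forall X' X Y (f : hom (F X) Y) (a : hom X' X),
    adj (f \circ fmap F a) =~ adj f \circ a;
  adj_natr : forall X Y Y' (f : hom (F X) Y) (b : hom Y Y'),
    adj (b \circ f) =~ fmap G b \circ adj f }.

Section FullSubcategory.
Variables (C : category) (P : ob C -> Prop).

Definition full_subcategory : category :=
  @Category {X : ob C | P X}
    (fun X Y => hom (proj1_sig X) (proj1_sig Y))
    (fun X Y => @eqh C (proj1_sig X) (proj1_sig Y))
    (fun X => idm (proj1_sig X))
    (fun X Y Z => @cmp C (proj1_sig X) (proj1_sig Y) (proj1_sig Z))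
    (fun X Y => @eqh_refl C (proj1_sig X) (proj1_sig Y))
    (fun X Y => @eqh_sym C (proj1_sig X) (proj1_sig Y))
    (fun X Y => @eqh_trans C (proj1_sig X) (proj1_sig Y))
    (fun X Y Z => @eqh_cmp C (proj1_sig X) (proj1_sig Y) (proj1_sig Z))
    (fun X Y => @cmp1m C (proj1_sig X) (proj1_sig Y))
    (fun X Y => @cmpm1 C (proj1_sig X) (proj1_sig Y))
    (fun X Y Z W =>
       @cmpA C (proj1_sig X) (proj1_sig Y) (proj1_sig Z) (proj1_sig W)).

Definition inclusion : functor full_subcategory C :=
  @Functor full_subcategory C (fun X => proj1_sig X)
    (fun X Y f => f)
    (fun X Y f g e => e)
    (fun X => eqh_refl (idm (proj1_sig X)))
    (fun X Y Z g f => eqh_refl (@cmp C _ _ _ g f)).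

End FullSubcategory.

Definition is_iso (C : category) (X Y : ob C) (f : hom X Y) : Prop :=
  exists g : hom Y X, g \circ f =~ idm X /\ f \circ g =~ idm Y.

(* Coproducts are small: they are indexed by types in the universe of the
   carriers of modules. *)
Notation small_index := Type@{GRing.Lmodule.axioms_.u0}.

Definition is_coproduct (C : category) (I : small_index) (X : I -> ob C) (Y : ob C)
    (inj : forall i, hom (X i) Y) : Prop :=
  forall (Z : ob C) (f : forall i, hom (X i) Z),
    exists h : hom Y Z, (forall i, h \circ inj i =~ f i) /\
      (forall h' : hom Y Z, (forall i, h' \circ inj i =~ f i) -> h' =~ h).

Definition preserves_coproducts (C D : category) (F : functor C D) : Prop :=
  forall (I : small_index) (X : I -> ob C) (Y : ob C) (inj : forall i, hom (X i) Y),
    is_coproduct inj -> is_coproduct (fun i => fmap F (inj i)).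

Record complex (R : comPzRingType) := Complex {
  term :> int -> lmodType R;
  diff : forall n : int, {linear term n -> term (n + 1)};
  diffK : forall (n : int) (x : term n), diff (n + 1) (diff n x) = 0 }.

Record chain_map (R : comPzRingType) (X Y : complex R) := ChainMap {
  cmap :> forall n : int, {linear X n -> Y n};
  cmap_diff : forall (n : int) (x : X n),
    cmap (n + 1) (diff X n x) = diff Y n (cmap n x) }.

(* Bijectivity on the cohomology groups H^(n+1), for all n in Z (so in all
   degrees); the shifted small_index makes [diff n] land in the right degree. *)
Definition quasi_iso (R : comPzRingType) (X Y : complex R) (f : chain_map X Y)
    : Prop :=
  forall n : int,
    (forall x : X (n + 1), diff X (n + 1) x = 0 ->
       (exists y : Y n, diff Y n y = f (n + 1) x) ->
       exists x' : X n, diff X n x' = x) /\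
    (forall y : Y (n + 1), diff Y (n + 1) y = 0 ->
       exists (x : X (n + 1)) (y' : Y n),
         diff X (n + 1) x = 0 /\ y = f (n + 1) x + diff Y n y').

Section Complexes.
Variable R : comPzRingType.
Implicit Types X Y Z : complex R.

Definition chain_id X : chain_map X X :=
  @ChainMap R X X (fun n => idfun) (fun n x => erefl).

Lemma chain_comp_diff X Y Z (g : chain_map Y Z) (f : chain_map X Y)
    (n : int) (x : X n) :
  (g (n + 1) \o f (n + 1)) (diff X n x) = diff Z n ((g n \o f n) x).
Proof. by rewrite /= !cmap_diff. Qed.

Definition chain_comp X Y Z (g : chain_map Y Z) (f : chain_map X Y) :
  chain_map X Z := ChainMap (chain_comp_diff g f).

Definition zero_linear (U V : lmodType R) : {linear U -> V} := \0.

Lemma zero_diffK (n : int) (x : 'rV[R]_0) :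
  zero_linear 'rV[R]_0 'rV[R]_0 (zero_linear 'rV[R]_0 'rV[R]_0 x) = 0.
Proof. by []. Qed.

Definition zero_complex : complex R :=
  @Complex R (fun n => 'rV[R]_0) (fun n => zero_linear _ _) zero_diffK.

Lemma zero_chain_diff X Y (n : int) (x : X n) :
  zero_linear (X (n + 1)) (Y (n + 1)) (diff X n x)
  = diff Y n (zero_linear (X n) (Y n) x).
Proof. by rewrite /= linear0. Qed.

Definition zero_chain X Y : chain_map X Y :=
  @ChainMap R X Y (fun n => zero_linear _ _) (@zero_chain_diff X Y).

(** Shift: X[1]^n = X^(n+1), with differential -d *)

Lemma shift_diffK X (n : int) (x : X (n + 1)) :
  (\- diff X (n + 1 + 1)) ((\- diff X (n + 1)) x) = 0.
Proof. by rewrite /= linearN diffK !oppr0. Qed.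

Definition shift X : complex R :=
  @Complex R (fun n => X (n + 1)) (fun n => \- diff X (n + 1))
    (@shift_diffK X).

Lemma shift_chain_diff X Y (f : chain_map X Y) (n : int) (x : X (n + 1)) :
  f (n + 1 + 1) (diff (shift X) n x) = diff (shift Y) n (f (n + 1) x).
Proof. by rewrite /= linearN cmap_diff. Qed.

Definition shift_chain X Y (f : chain_map X Y) :
  chain_map (shift X) (shift Y) :=
  @ChainMap R (shift X) (shift Y) (fun n => f (n + 1)) (shift_chain_diff f).

(** Mapping cone: Cone(f)^n = X^(n+1) + Y^n, with
    d (x, y) = (- d x, f x + d y) *)

Section Cone.
Variables (X Y : complex R) (f : chain_map X Y).

Definition cone_term (n : int) : lmodType R := (X (n + 1)%R * Y n)%type.

Definition cone_fun (n : int) (u : cone_term n) : cone_term (n + 1) :=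
  (- diff X (n + 1) u.1, f (n + 1) u.1 + diff Y n u.2).

Lemma cone_fun_linear (n : int) : linear (@cone_fun n).
Proof.
move=> a u v; rewrite /cone_fun; congr pair => /=.
  by rewrite linearP opprD scalerN.
by rewrite !linearP scalerDr addrACA.
Qed.

HB.instance Definition _ (n : int) :=
  GRing.isLinear.Build R (cone_term n) (cone_term (n + 1)) *:%R
    (@cone_fun n) (@cone_fun_linear n).

Lemma cone_diffK (n : int) (u : cone_term n) :
  cone_fun (cone_fun u) = 0 :> cone_term (n + 1 + 1).
Proof.
rewrite /cone_fun /= linearN diffK !oppr0 linearN linearD diffK.
by rewrite cmap_diff addr0 addNr.
Qed.

Definition cone : complex R :=
  @Complex R cone_term (fun n => @cone_fun n : {linear _ -> _}) cone_diffK.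

Definition cone_in_fun (n : int) (y : Y n) : cone_term n := (0, y).

Lemma cone_in_linear (n : int) : linear (@cone_in_fun n).
Proof.
move=> a u v; rewrite /cone_in_fun.
by congr pair; rewrite /= scaler0 addr0.
Qed.

HB.instance Definition _ (n : int) :=
  GRing.isLinear.Build R (Y n) (cone_term n) *:%R
    (@cone_in_fun n) (@cone_in_linear n).

Lemma cone_in_diff (n : int) (y : Y n) :
  cone_in_fun (diff Y n y) = diff cone n (cone_in_fun y).
Proof.
rewrite /= /cone_in_fun /cone_fun; congr pair => /=.
  by rewrite linear0 oppr0.
by rewrite linear0 add0r.
Qed.

Definition cone_in : chain_map Y cone :=
  @ChainMap R Y cone (fun n => @cone_in_fun n : {linear _ -> _}) cone_in_diff.

Definition cone_out_fun (n : int) (u : cone_term n) : shift X n := u.1.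

Lemma cone_out_linear (n : int) : linear (@cone_out_fun n).
Proof. by []. Qed.

HB.instance Definition _ (n : int) :=
  GRing.isLinear.Build R (cone_term n) (shift X n) *:%R
    (@cone_out_fun n) (@cone_out_linear n).

Lemma cone_out_diff (n : int) (u : cone n) :
  cone_out_fun (diff cone n u) = diff (shift X) n (cone_out_fun u).
Proof. by []. Qed.

Definition cone_out : chain_map cone (shift X) :=
  @ChainMap R cone (shift X) (fun n => @cone_out_fun n : {linear _ -> _})
    cone_out_diff.

End Cone.

Section DirectSum.
Variables X Y : complex R.

Definition dsum_term (n : int) : lmodType R := (X n * Y n)%type.

Definition dsum_fun (n : int) (u : dsum_term n) : dsum_term (n + 1) :=
  (diff X n u.1, diff Y n u.2).

Lemma dsum_fun_linear (n : int) : linear (@dsum_fun n).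
Proof. by move=> a u v; rewrite /dsum_fun /= !linearP. Qed.

HB.instance Definition _ (n : int) :=
  GRing.isLinear.Build R (dsum_term n) (dsum_term (n + 1)) *:%R
    (@dsum_fun n) (@dsum_fun_linear n).

Lemma dsum_diffK (n : int) (u : dsum_term n) :
  dsum_fun (dsum_fun u) = 0 :> dsum_term (n + 1 + 1).
Proof. by rewrite /dsum_fun /= !diffK. Qed.

Definition dsum : complex R :=
  @Complex R dsum_term (fun n => @dsum_fun n : {linear _ -> _}) dsum_diffK.

End DirectSum.

Section DirectSumMap.
Variables (X X' Y Y' : complex R) (f : chain_map X X') (g : chain_map Y Y').

Definition dsum_map_fun (n : int) (u : dsum X Y n) : dsum X' Y' n :=
  (f n u.1, g n u.2).

Lemma dsum_map_linear (n : int) : linear (@dsum_map_fun n).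
Proof. by move=> a u v; rewrite /dsum_map_fun /= !linearP. Qed.

HB.instance Definition _ (n : int) :=
  GRing.isLinear.Build R (dsum X Y n) (dsum X' Y' n) *:%R
    (@dsum_map_fun n) (@dsum_map_linear n).

Lemma dsum_map_diff (n : int) (u : dsum X Y n) :
  dsum_map_fun (diff (dsum X Y) n u) = diff (dsum X' Y') n (dsum_map_fun u).
Proof. by rewrite /dsum_map_fun /= /dsum_fun /= !cmap_diff. Qed.

Definition dsum_map : chain_map (dsum X Y) (dsum X' Y') :=
  @ChainMap R (dsum X Y) (dsum X' Y')
    (fun n => @dsum_map_fun n : {linear _ -> _}) dsum_map_diff.

Lemma quasi_iso_dsum : quasi_iso f -> quasi_iso g -> quasi_iso dsum_map.
Proof.
move=> qf qg n; have [fi fs] := qf n; have [gi gs] := qg n; split.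
  move=> [x y] [/= dx dy] [[x' y'] [/= ex ey]].
  have [x0 hx] := fi x dx (ex_intro _ x' ex).
  have [y0 hy] := gi y dy (ex_intro _ y' ey).
  by exists (x0, y0); rewrite /= /dsum_fun /= hx hy.
move=> [x y] [/= dx dy].
have [x0 [x1 [hx ->]]] := fs x dx; have [y0 [y1 [hy ->]]] := gs y dy.
by exists (x0, y0), (x1, y1); rewrite /= /dsum_fun /= hx hy.
Qed.

End DirectSumMap.

Section Diagonal.
Variable X : complex R.

Definition diag_fun (n : int) (x : X n) : dsum X X n := (x, x).
Definition codiag_fun (n : int) (u : dsum X X n) : X n := u.1 + u.2.

Lemma diag_linear (n : int) : linear (@diag_fun n).
Proof. by []. Qed.

Lemma codiag_linear (n : int) : linear (@codiag_fun n).
Proof. by move=> a u v; rewrite /codiag_fun /= scalerDr addrACA. Qed.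

HB.instance Definition _ (n : int) :=
  GRing.isLinear.Build R (X n) (dsum X X n) *:%R
    (@diag_fun n) (@diag_linear n).

HB.instance Definition _ (n : int) :=
  GRing.isLinear.Build R (dsum X X n) (X n) *:%R
    (@codiag_fun n) (@codiag_linear n).

Lemma diag_diff (n : int) (x : X n) :
  diag_fun (diff X n x) = diff (dsum X X) n (diag_fun x).
Proof. by []. Qed.

Lemma codiag_diff (n : int) (u : dsum X X n) :
  codiag_fun (diff (dsum X X) n u) = diff X n (codiag_fun u).
Proof. by rewrite /codiag_fun /= linearD. Qed.

Definition diag_chain : chain_map X (dsum X X) :=
  @ChainMap R X (dsum X X) (fun n => @diag_fun n : {linear _ -> _}) diag_diff.

Definition codiag_chain : chain_map (dsum X X) X :=
  @ChainMap R (dsum X X) X (fun n => @codiag_fun n : {linear _ -> _})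
    codiag_diff.

End Diagonal.

Lemma quasi_iso_id X : quasi_iso (chain_id X).
Proof.
move=> n; split=> [x _ [y] /= <-|y dy]; first by exists y.
by exists y, 0; rewrite /= linear0 addr0.
Qed.

Lemma quasi_iso_shift X Y (f : chain_map X Y) :
  quasi_iso f -> quasi_iso (shift_chain f).
Proof.
move=> qf n; have [fi fs] := qf (n + 1); split=> [x /= dx [y /= ey]|y /= dy].
  have [||x' hx'] := fi x; first by apply: oppr_inj; rewrite oppr0.
    by exists (- y); rewrite linearN.
  by exists (- x'); rewrite linearN opprK.
have [|x [y' [hx hy]]] := fs y; first by apply: oppr_inj; rewrite oppr0.
by exists x, (- y'); rewrite /= hx oppr0 linearN opprK.
Qed.

(* D(R) is the localisation of the category of complexes at the
   quasi-isomorphisms: morphisms are words in chain maps and formal inverses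
   of quasi-isomorphisms, modulo the congruence generated by the category
   axioms, functoriality of the localisation, and the inverse laws. *)

Inductive dhom : complex R -> complex R -> Type :=
| dloc X Y (f : chain_map X Y) : dhom X Y
| dinv X Y (s : chain_map X Y) (qs : quasi_iso s) : dhom Y X
| dcomp X Y Z (g : dhom Y Z) (f : dhom X Y) : dhom X Z.

Inductive deq : forall X Y, dhom X Y -> dhom X Y -> Prop :=
| deq_refl X Y (f : dhom X Y) : deq f f
| deq_sym X Y (f g : dhom X Y) : deq f g -> deq g f
| deq_trans X Y (f g h : dhom X Y) : deq f g -> deq g h -> deq f h
| deq_comp X Y Z (g g' : dhom Y Z) (f f' : dhom X Y) :
    deq g g' -> deq f f' -> deq (dcomp g f) (dcomp g' f')
| deq_1m X Y (f : dhom X Y) : deq (dcomp (dloc (chain_id Y)) f) f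
| deq_m1 X Y (f : dhom X Y) : deq (dcomp f (dloc (chain_id X))) f
| deq_A X Y Z W (h : dhom Z W) (g : dhom Y Z) (f : dhom X Y) :
    deq (dcomp h (dcomp g f)) (dcomp (dcomp h g) f)
| deq_loc_ext X Y (f g : chain_map X Y) :
    (forall n x, f n x = g n x) -> deq (dloc f) (dloc g)
| deq_loc_comp X Y Z (g : chain_map Y Z) (f : chain_map X Y) :
    deq (dloc (chain_comp g f)) (dcomp (dloc g) (dloc f))
| deq_invl X Y (s : chain_map X Y) (qs : quasi_iso s) :
    deq (dcomp (dinv qs) (dloc s)) (dloc (chain_id X))
| deq_invr X Y (s : chain_map X Y) (qs : quasi_iso s) :
    deq (dcomp (dloc s) (dinv qs)) (dloc (chain_id Y)).

End Complexes.

Definition derived_category (R : comPzRingType) : category :=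
  @Category (complex R) (@dhom R) (@deq R) (fun X => dloc (chain_id X))
    (@dcomp R) (@deq_refl R) (@deq_sym R) (@deq_trans R) (@deq_comp R)
    (@deq_1m R) (@deq_m1 R) (@deq_A R).

Notation "'\D' R" := (derived_category R) (at level 8, R at level 8).

Section DerivedStructure.
Variable R : comPzRingType.

(* Action on D(R) of an endofunctor of complexes that preserves
   quasi-isomorphisms. *)
Fixpoint dhom_map (F : complex R -> complex R)
    (Fm : forall X Y, chain_map X Y -> chain_map (F X) (F Y))
    (Fq : forall X Y (s : chain_map X Y), quasi_iso s -> quasi_iso (Fm X Y s))
    (X Y : complex R) (w : dhom X Y) : dhom (F X) (F Y) :=
  match w with
  | dloc X Y f => dloc (Fm X Y f)
  | dinv X Y s qs => dinv (Fq X Y s qs)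
  | dcomp X Y Z g f => dcomp (dhom_map Fq g) (dhom_map Fq f)
  end.

Definition dshift (X Y : complex R) (w : dhom X Y) : dhom (shift X) (shift Y) :=
  dhom_map (@quasi_iso_shift R) w.

Definition dsuml (Z X Y : complex R) (w : dhom X Y) :
    dhom (dsum X Z) (dsum Y Z) :=
  @dhom_map (fun X => dsum X Z) (fun _ _ f => dsum_map f (chain_id Z))
    (fun _ _ _ qs => quasi_iso_dsum qs (quasi_iso_id Z)) X Y w.

Definition dsumr (Z X Y : complex R) (w : dhom X Y) :
    dhom (dsum Z X) (dsum Z Y) :=
  @dhom_map (fun X => dsum Z X) (fun _ _ f => dsum_map (chain_id Z) f)
    (fun _ _ _ qs => quasi_iso_dsum (quasi_iso_id Z) qs) X Y w.

(* The addition of the additive category D(R):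
   f + g is X -> X + X -> X + Y -> Y + Y -> Y. *)
Definition dadd (X Y : ob (\D R)) (f g : hom X Y) : hom X Y :=
  (dloc (codiag_chain Y) : hom (_ : ob (\D R)) Y) \circ
  (dsuml Y f : hom (_ : ob (\D R)) _) \circ
  (dsumr X g : hom (_ : ob (\D R)) _) \circ
  (dloc (diag_chain X) : hom X (_ : ob (\D R))).

Definition dzero (X Y : ob (\D R)) : hom X Y := dloc (zero_chain X Y).

(* Triangles isomorphic in D(R) to X -f-> Y -> Cone(f) -> X[1]. *)
Definition distinguished (X Y Z : ob (\D R))
    (u : hom X Y) (v : hom Y Z) (w : hom Z (shift X : ob (\D R))) : Prop :=
  exists (A B : complex R) (f : chain_map A B)
    (a : @hom (\D R) A X) (b : @hom (\D R) B Y) (c : @hom (\D R) (cone f) Z),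
    [/\ is_iso a, is_iso b, is_iso c &
      [/\ u \circ a =~ b \circ (dloc f : @hom (\D R) A B),
          v \circ b =~ c \circ (dloc (cone_in f) : @hom (\D R) B (cone f)) &
          w \circ c =~ (dshift a : @hom (\D R) (shift A) (shift X)) \circ
                    (dloc (cone_out f) : @hom (\D R) (cone f) (shift A))]].

(* Full triangulated subcategories are taken to be closed under isomorphism;
   the equivalence in the third clause is closure under [1] and [-1]. *)
Definition triangulated_subcategory (P : ob (\D R) -> Prop) : Prop :=
  [/\ P (zero_complex R),
      forall (X Y : ob (\D R)) (f : hom X Y), is_iso f -> P X -> P Y,
      forall X : complex R, P X <-> P (shift X) &
      forall (X Y Z : ob (\D R)) (u : hom X Y) (v : hom Y Z)
        (w : hom Z (shift X : ob (\D R))),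
        distinguished u v w -> P X -> P Y -> P Z].

Definition localising (P : ob (\D R) -> Prop) : Prop :=
  triangulated_subcategory P /\
  forall (I : small_index) (X : I -> ob (\D R)) (Y : ob (\D R))
    (inj : forall i, hom (X i) Y),
    is_coproduct inj -> (forall i, P (X i)) -> P Y.

Definition smashing (P : ob (\D R) -> Prop) : Prop :=
  localising P /\
  exists G : functor (\D R) (full_subcategory P),
    inhabited (adjunction (inclusion P) G) /\ preserves_coproducts G.

(* The image in Hom(C, Y) of the element of the direct sum of the Hom(C, X_i)
   with components g i for i in s and zero elsewhere. *)
Definition sum_injections (C : ob (\D R)) (I : small_index) (X : I -> ob (\D R))
    (Y : ob (\D R)) (inj : forall i, hom (X i) Y)
    (s : seq I) (g : forall i, hom C (X i)) : hom C Y :=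
  foldr (fun i h => dadd (inj i \circ g i) h) (dzero C Y) s.

(* Hom(C, -) preserves coproducts: the canonical map from the direct sum of
   the groups Hom(C, X_i) to Hom(C, Y) is surjective and has trivial kernel. *)
Definition compact_object (C : ob (\D R)) : Prop :=
  forall (I : small_index) (X : I -> ob (\D R)) (Y : ob (\D R))
    (inj : forall i, hom (X i) Y), is_coproduct inj ->
    (forall f : hom C Y, exists (s : seq I) (g : forall i, hom C (X i)),
       List.NoDup s /\ f =~ sum_injections inj s g) /\
    (forall (s : seq I) (g : forall i, hom C (X i)), List.NoDup s ->
       sum_injections inj s g =~ dzero C Y ->
       forall i, List.In i s -> g i =~ dzero C (X i)).

Definition compactly_generated (P : ob (\D R) -> Prop) : Prop :=
  exists K : ob (\D R) -> Prop,
    (forall C, K C -> compact_object C) /\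
    [/\ localising P,
        forall C, K C -> P C &
        forall Q, localising Q -> (forall C, K C -> Q C) ->
          forall X, P X -> Q X].

End DerivedStructure.

Definition telescope_conjecture (R : comPzRingType) : Prop :=
  forall P : ob (\D R) -> Prop, smashing P -> compactly_generated P.

(* Main.v *)
Require Import Defs.
From HB Require Import structures.
From mathcomp Require Import all_boot all_order all_algebra.
From mathcomp Require Import boolp classical_sets topology.
From mathcomp Require Import fsbigop.
From Corelib Require Setoid.
Import Defs.

(** Write R for the absolutely flat ring and P for a smashing subcategory of
D(R), with coreflection [core : D(R) -> P] and counit [counit : core Y -> Y].
The compact objects that generate P are the principal ideals rR, placed in
one degree, that lie in P: an absolutely flat ring has rR = eR with e
idempotent, so rR is projective.  The r with rR in P form an ideal J
([smashing_ideal]), and the theorem splits into two statements.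

A complex whose cohomology is J-torsion, in the sense that each class x
satisfies x = r x for some r in J, lies in every localising subcategory that
contains the rR with r in J ([cellular]).  Such a complex X is the homotopy
colimit of a tower of complexes over X, each stage being the cone of a map from
a direct sum of shifted ideals rR that kills the kernel of cohomology of the
stage before.

Every X in P has J-torsion cohomology ([smashing_torsion]).  If a class x0 of X
violates this, a submodule U of the cochains, maximal among those that contain
the boundaries and the J-torsion and avoid x0, yields a simple quotient R/N
generated by x0, where N is an ideal containing J; so X maps to a shift of
R/N, that is, to the cone of N -> R, and x0 goes to 1.  The complexes Y for
which [core Y] has N-torsion cohomology ([ghost]) are closed under cones,
and, because [core] preserves coproducts, under direct sums; they contain rR
for r in N, since a multiple of r acts on rR as the identity.  By [cellular]
they contain N itself.  Hence for some r in N the element 1 - r is,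
modulo N, the value rho at a class of E of a map E -> R whose source E lies in
P.  This map, composed with multiplication by the idempotent generator of
rho R, retracts E onto rho R, so rho lies in J, hence in N; but rho is
congruent to 1 modulo N.

To run this in the localisation of complexes at quasi-isomorphisms, morphisms
are represented by roofs X <- V -> Y whose left leg is a surjective
quasi-isomorphism ([triv_fib]).  Strict pullbacks then compose roofs, and two
chain maps become equal in D(R) exactly when, after such a refinement, their
difference factors through an acyclic complex ([thru_deq], [dloc_eq_thru]).
This identifies direct sums of complexes with coproducts in D(R)
([dsumI_coproduct]). *)

Set Implicit Arguments.
Unset Strict Implicit.
Unset Printing Implicit Defensive.

Import GRing.Theory.
Local Open Scope ring_scope.

(** * Families indexed by the integers *)

(** Cohomology is computed in degrees j + 1, and n - 1 + 1 = n holds only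
propositionally; the transport along this equality is made here, once. *)
Lemma int_lift (P : int -> Type) (g : forall j : int, P (j + 1)) :
  {G : forall n, P n | forall j, G (j + 1) = g j}.
Proof.
exists (fun n => eq_rect _ P (g (n - 1)) n (subrK 1 n)) => j.
have: j + 1 - 1 = j by rewrite addrK.
move: (subrK 1 (j + 1)); move: (j + 1 - 1) => i e eij.
by move: e; rewrite eij => e; rewrite (eq_axiomK e).
Qed.

Lemma int_succ_ind (P : int -> Prop) : (forall j, P (j + 1)) -> forall n, P n.
Proof. by move=> h n; rewrite -(subrK 1 n). Qed.

Lemma select_exists (I : Type) (V : I -> Type) (d : forall j, V j) (i : I)
    (z : V i) : {f : forall j, V j | f i = z /\ forall j, j <> i -> f j = d j}.
Proof.
exists (fun j => if pselect (i = j) is left e then eq_rect i V z j e else d j).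
split=> [|j nj]; last by case: pselect => // e; case: nj.
by case: pselect => // e; rewrite (Prop_irrelevance e erefl).
Qed.

Definition single (I : Type) (V : I -> nmodType) (i : I) (z : V i) :
  forall j, V j := sval (@select_exists I V (fun=> 0) i z).

Lemma singleE (I : Type) (V : I -> nmodType) (i : I) (z : V i) :
  single z i = z.
Proof. by case: (svalP (@select_exists I V (fun=> 0) i z)). Qed.

Lemma single0 (I : Type) (V : I -> nmodType) (i : I) (z : V i) j :
  j <> i -> single z j = 0.
Proof.
by move=> ji; case: (svalP (@select_exists I V (fun=> 0) i z)) => _; apply.
Qed.

(** * Submodules and subcomplexes *)

Section Submodule.
Variable R : comPzRingType.

Record submodule (V : lmodType R) := Submodule {
  sm_mem :> V -> Prop;
  sm0 : sm_mem 0;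
  smL : forall a u v, sm_mem u -> sm_mem v -> sm_mem (a *: u + v) }.

Section Closure.
Variables (V : lmodType R) (S : submodule V).

Lemma smZ a u : S u -> S (a *: u).
Proof. by move=> Su; rewrite -[_ *: _]addr0; apply: smL => //; apply: sm0. Qed.

Lemma smD u v : S u -> S v -> S (u + v).
Proof. by move=> Su Sv; rewrite -[u]scale1r; apply: smL. Qed.

Lemma smN u : S u -> S (- u).
Proof. by move=> Su; rewrite -scaleN1r; apply: smZ. Qed.

Lemma smB u v : S u -> S v -> S (u - v).
Proof. by move=> Su /smN; apply: smD. Qed.

Record sub_of := SubOf { sub_val : V; sub_memP : S sub_val }.

Lemma sub_ext (u v : sub_of) : sub_val u = sub_val v -> u = v.
Proof.
case: u v => [u Su] [v Sv] /= e; move: Su; rewrite e => Su.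
by rewrite (Prop_irrelevance Su Sv).
Qed.

HB.instance Definition _ := gen_eqMixin sub_of.
HB.instance Definition _ := gen_choiceMixin sub_of.

Definition sub_add u v := SubOf (smD (sub_memP u) (sub_memP v)).
Definition sub_opp u := SubOf (smN (sub_memP u)).
Definition sub_scale a u := SubOf (smZ a (sub_memP u)).

Fact sub_addA : associative sub_add.
Proof. by move=> u v w; apply: sub_ext; rewrite /= addrA. Qed.
Fact sub_addC : commutative sub_add.
Proof. by move=> u v; apply: sub_ext; rewrite /= addrC. Qed.
Fact sub_add0 : left_id (SubOf (sm0 S)) sub_add.
Proof. by move=> u; apply: sub_ext; rewrite /= add0r. Qed.
Fact sub_addN : left_inverse (SubOf (sm0 S)) sub_opp sub_add.
Proof. by move=> u; apply: sub_ext; rewrite /= addNr. Qed.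

HB.instance Definition _ :=
  GRing.isZmodule.Build sub_of sub_addA sub_addC sub_add0 sub_addN.

Fact sub_scaleA a b u : sub_scale a (sub_scale b u) = sub_scale (a * b) u.
Proof. by apply: sub_ext; rewrite /= scalerA. Qed.
Fact sub_scale1 : left_id 1 sub_scale.
Proof. by move=> u; apply: sub_ext; rewrite /= scale1r. Qed.
Fact sub_scaleDr : right_distributive sub_scale +%R.
Proof. by move=> a u v; apply: sub_ext; rewrite /= scalerDr. Qed.
Fact sub_scaleDl u : {morph sub_scale^~ u : a b / a + b}.
Proof. by move=> a b; apply: sub_ext; rewrite /= scalerDl. Qed.

HB.instance Definition _ := GRing.Zmodule_isLmodule.Build R sub_of
  sub_scaleA sub_scale1 sub_scaleDr sub_scaleDl.

Fact sub_val_linear : linear sub_val. Proof. by []. Qed.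
HB.instance Definition _ :=
  GRing.isLinear.Build R sub_of V *:%R sub_val sub_val_linear.

Section Lift.
Variables (U : lmodType R) (f : {linear U -> V}) (fS : forall u, S (f u)).

Definition sub_lift_fun (u : U) : sub_of := SubOf (fS u).
Fact sub_lift_linear : linear sub_lift_fun.
Proof. by move=> a u v; apply: sub_ext; rewrite /= linearP. Qed.
HB.instance Definition _ :=
  GRing.isLinear.Build R U sub_of *:%R sub_lift_fun sub_lift_linear.
Definition sub_lift : {linear U -> sub_of} := sub_lift_fun.
End Lift.

End Closure.

Section Subcomplex.
Variables (X : complex R) (S : forall n, submodule (X n)).
Hypothesis dS : forall n x, S n x -> S (n + 1) (diff X n x).

Definition subcomplex_diff (n : int) :
  {linear sub_of (S n) -> sub_of (S (n + 1))} :=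
  @sub_lift _ (S (n + 1)) (sub_of (S n))
    (diff X n \o @sub_val _ (S n)) (fun u => dS (sub_memP u)).

Fact subcomplex_diffK (n : int) (x : sub_of (S n)) :
  subcomplex_diff (n + 1) (subcomplex_diff n x) = 0.
Proof. by apply: sub_ext; rewrite /= diffK. Qed.

Definition subcomplex : complex R :=
  @Complex R (fun n => sub_of (S n)) subcomplex_diff subcomplex_diffK.

Definition sub_incl : chain_map subcomplex X :=
  @ChainMap R subcomplex X (fun n => @sub_val _ (S n)) (fun n x => erefl).

Section Lift.
Variables (Y : complex R) (f : chain_map Y X).
Hypothesis fS : forall n y, S n (f n y).

Fact subcomplex_lift_diff (n : int) (y : Y n) :
  sub_lift (@fS (n + 1)) (diff Y n y) = subcomplex_diff n (sub_lift (@fS n) y).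
Proof. by apply: sub_ext; rewrite /= cmap_diff. Qed.

Definition subcomplex_lift : chain_map Y subcomplex :=
  @ChainMap R Y subcomplex (fun n => sub_lift (@fS n)) subcomplex_lift_diff.
End Lift.

End Subcomplex.
End Submodule.

(** * Chain maps and strict pullbacks *)

Section ChainMaps.
Variable R : comPzRingType.
Implicit Types X Y Z W : complex R.

Definition boundary X (n : int) (x : X (n + 1)) := exists y, diff X n y = x.

Definition acyclic X :=
  forall (n : int) (x : X (n + 1)), diff X (n + 1) x = 0 -> boundary x.

Lemma boundary_cycle X (n : int) (x : X (n + 1)) :
  boundary x -> diff X (n + 1) x = 0.
Proof. by case=> y <-; apply: diffK. Qed.

Lemma boundary0 X (n : int) : boundary (0 : X (n + 1)).
Proof. by exists 0; rewrite linear0. Qed.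

Lemma boundaryD X (n : int) (x y : X (n + 1)) :
  boundary x -> boundary y -> boundary (x + y).
Proof. by move=> [u <-] [v <-]; exists (u + v); rewrite linearD. Qed.

Lemma boundaryN X (n : int) (x : X (n + 1)) : boundary x -> boundary (- x).
Proof. by move=> [u <-]; exists (- u); rewrite linearN. Qed.

Lemma boundaryB X (n : int) (x y : X (n + 1)) :
  boundary x -> boundary y -> boundary (x - y).
Proof. by move=> hx /boundaryN; apply: boundaryD. Qed.

Lemma boundaryZ X (n : int) a (x : X (n + 1)) :
  boundary x -> boundary (a *: x).
Proof. by move=> [u <-]; exists (a *: u); rewrite linearZ. Qed.

Lemma boundary_map X Y (f : chain_map X Y) (n : int) (x : X (n + 1)) :
  boundary x -> boundary (f (n + 1) x).
Proof. by case=> y <-; exists (f n y); rewrite cmap_diff. Qed.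

Definition ceq X Y (f g : chain_map X Y) := forall n x, f n x = g n x.

Fact chain_add_diff X Y (f g : chain_map X Y) (n : int) (x : X n) :
  (f (n + 1) \+ g (n + 1)) (diff X n x) = diff Y n ((f n \+ g n) x).
Proof. by rewrite /= !cmap_diff linearD. Qed.
Definition chain_add X Y (f g : chain_map X Y) : chain_map X Y :=
  @ChainMap R X Y (fun n => f n \+ g n) (chain_add_diff f g).

Fact chain_scale_diff X Y a (f : chain_map X Y) (n : int) (x : X n) :
  (a \*: f (n + 1)) (diff X n x) = diff Y n ((a \*: f n) x).
Proof. by rewrite /= cmap_diff linearZ. Qed.
Definition chain_scale X Y a (f : chain_map X Y) : chain_map X Y :=
  @ChainMap R X Y (fun n => a \*: f n) (chain_scale_diff a f).

Definition chain_opp X Y (f : chain_map X Y) := chain_scale (-1) f.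

Lemma chain_oppE X Y (f : chain_map X Y) n x : chain_opp f n x = - f n x.
Proof. by rewrite /= scaleN1r. Qed.

Definition dsum_fst X Y : chain_map (dsum X Y) X :=
  @ChainMap R (dsum X Y) X
    (fun n => @fst (X n) (Y n) : {linear (dsum X Y) n -> X n})
    (fun n x => erefl).
Definition dsum_snd X Y : chain_map (dsum X Y) Y :=
  @ChainMap R (dsum X Y) Y
    (fun n => @snd (X n) (Y n) : {linear (dsum X Y) n -> Y n})
    (fun n x => erefl).

Section Pair.
Variables (X Y Z : complex R) (f : chain_map X Y) (g : chain_map X Z).
Definition pair_fun n (x : X n) : dsum Y Z n := (f n x, g n x).
Fact pair_fun_linear n : linear (@pair_fun n).
Proof. by move=> a u v; rewrite /pair_fun !linearP. Qed.
HB.instance Definition _ n := GRing.isLinear.Build R (X n) (dsum Y Z n) *:%R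
  (@pair_fun n) (@pair_fun_linear n).
Fact pair_fun_diff n (x : X n) :
  pair_fun (diff X n x) = diff (dsum Y Z) n (pair_fun x).
Proof. by rewrite /pair_fun !cmap_diff. Qed.
Definition chain_pair : chain_map X (dsum Y Z) :=
  @ChainMap R X (dsum Y Z) (fun n => @pair_fun n : {linear _ -> _})
    pair_fun_diff.
End Pair.

Definition chain_copair X Y Z (f : chain_map X Z) (g : chain_map Y Z) :
    chain_map (dsum X Y) Z :=
  chain_add (chain_comp f (dsum_fst X Y)) (chain_comp g (dsum_snd X Y)).

Definition dsum_inl X Y : chain_map X (dsum X Y) :=
  chain_pair (chain_id X) (zero_chain X Y).

Section Pullback.
Variables (X Y Z : complex R) (f : chain_map X Z) (g : chain_map Y Z).

Program Definition pullback_sub n : submodule (dsum X Y n) :=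
  @Submodule R (dsum X Y n) (fun u => f n u.1 = g n u.2) _ _.
Next Obligation. by move=> n /=; rewrite !linear0. Qed.
Next Obligation. by move=> n a u v /= hu hv; rewrite !linearP hu hv. Qed.

Fact pullback_diff n x :
  pullback_sub n x -> pullback_sub (n + 1) (diff (dsum X Y) n x).
Proof. by rewrite /= !cmap_diff => ->. Qed.

Definition pullback := subcomplex pullback_diff.
Definition pullback_fst : chain_map pullback X :=
  chain_comp (dsum_fst X Y) (sub_incl pullback_diff).
Definition pullback_snd : chain_map pullback Y :=
  chain_comp (dsum_snd X Y) (sub_incl pullback_diff).

Lemma pullbackE n (u : pullback n) :
  f n (pullback_fst n u) = g n (pullback_snd n u).
Proof. by case: u => [[x y] e]; apply: e. Qed.

Definition pullback_elt n (x : X n) (y : Y n) (e : f n x = g n y) :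
  pullback n := @SubOf R _ (pullback_sub n) (x, y) e.

Lemma pullback_ext n (u v : pullback n) :
  pullback_fst n u = pullback_fst n v -> pullback_snd n u = pullback_snd n v ->
  u = v.
Proof.
by case: u v => [[x y] e] [[x' y'] e'] /= ? ?; apply: sub_ext => /=; subst.
Qed.

Definition pullback_lift W (a : chain_map W X) (b : chain_map W Y)
    (e : forall n w, f n (a n w) = g n (b n w)) : chain_map W pullback :=
  @subcomplex_lift R (dsum X Y) pullback_sub pullback_diff W (chain_pair a b) e.

End Pullback.

(** * Trivial fibrations *)

Definition surjective X Y (f : chain_map X Y) :=
  forall n y, exists x, f n x = y.

Definition exact_kernel X Y (f : chain_map X Y) :=
  forall n (x : X (n + 1)), diff X (n + 1) x = 0 -> f (n + 1) x = 0 ->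
  exists2 y, diff X n y = x & f n y = 0.

Definition triv_fib X Y (f : chain_map X Y) := surjective f /\ quasi_iso f.

Lemma triv_fib_kernel X Y (f : chain_map X Y) : triv_fib f -> exact_kernel f.
Proof.
move=> [fs qf] n x dx fx.
have [x' dx'] : exists x' : X n, diff X n x' = x.
  have [inj _] := qf n; apply: inj => //.
  by exists 0; rewrite fx linear0.
elim/int_succ_ind: n x x' dx' dx fx => n x x' dx' dx fx.
have [_ sur] := qf n.
have [|c [z [dc e]]] := sur (f _ x'); first by rewrite -cmap_diff dx'.
have [z' ez'] := fs n z.
exists (x' - c - diff X n z').
  by rewrite !linearB /= dc diffK !subr0.
  by rewrite !linearB /= e cmap_diff ez' [f _ c + _]addrC addrK subrr.
Qed.

Lemma surj_exact_kernel X Y (f : chain_map X Y) :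
  surjective f -> exact_kernel f -> triv_fib f.
Proof.
move=> fs fk; split=> // n; split=> [x dx [y ey]|y dy].
  have [y' ey'] := fs n y.
  have [||z ez _] := fk n (x - diff X n y').
  - by rewrite linearB /= diffK dx subr0.
  - by rewrite linearB /= cmap_diff ey' ey subrr.
  by exists (z + y'); rewrite linearD /= ez subrK.
have [x ex] := fs _ y.
have [||z ez fz] := fk (n + 1) (diff X (n + 1) x).
- exact: diffK.
- by rewrite cmap_diff ex dy.
exists (x - z), 0; rewrite !linearB /= ez subrr fz subr0 linear0 addr0 ex.
by split.
Qed.

Lemma triv_fib_cycle X Y (f : chain_map X Y) n (y : Y (n + 1)) :
  triv_fib f -> diff Y (n + 1) y = 0 ->
  exists2 x, diff X (n + 1) x = 0 & f (n + 1) x = y.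
Proof.
move=> [fs qf] dy; have [_ sur] := qf n.
have [x [y' [dx ->]]] := sur y dy; have [x' <-] := fs n y'.
by exists (x + diff X n x'); rewrite linearD /= ?diffK ?dx ?addr0 ?cmap_diff.
Qed.

Lemma triv_fib_id X : triv_fib (chain_id X).
Proof. by split; [move=> n y; exists y|apply: quasi_iso_id]. Qed.

Lemma quasi_iso_comp X Y Z (g : chain_map Y Z) (f : chain_map X Y) :
  quasi_iso g -> quasi_iso f -> quasi_iso (chain_comp g f).
Proof.
move=> qg qf n; have [gi gs] := qg n; have [fi fs] := qf n; split.
  move=> x dx ez; apply: fi => //; apply: gi => //.
  by rewrite -cmap_diff dx linear0.
move=> z dz; have [y [z' [dy ->]]] := gs z dz.
have [x [y' [dx ->]]] := fs y dy; exists x, (g n y' + z'); split=> //.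
by rewrite /= !linearD /= cmap_diff addrA.
Qed.

Lemma triv_fib_comp X Y Z (g : chain_map Y Z) (f : chain_map X Y) :
  triv_fib g -> triv_fib f -> triv_fib (chain_comp g f).
Proof.
move=> [gs qg] [fs qf]; split; last exact: quasi_iso_comp.
by move=> n z; have [y <-] := gs n z; have [x <-] := fs n y; exists x.
Qed.

(** The kernel of the base change of g is the kernel of g. *)
Lemma pullback_triv_fib X Y Z (f : chain_map X Z) (g : chain_map Y Z) :
  triv_fib g -> triv_fib (pullback_fst f g).
Proof.
move=> tg; have gk := triv_fib_kernel tg; have [gs _] := tg.
apply: surj_exact_kernel => [n x|n u du u0].
  by have [y e] := gs n (f n x); exists (pullback_elt (esym e)).
have du2 : diff Y (n + 1) (pullback_snd f g _ u) = 0.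
  by rewrite -cmap_diff du linear0.
have gu : g (n + 1) (pullback_snd f g _ u) = 0.
  by rewrite -pullbackE u0 linear0.
have [y ey gy] := gk _ _ du2 gu.
have e : f n 0 = g n y by rewrite gy linear0.
exists (pullback_elt e) => //; apply: pullback_ext.
  by rewrite cmap_diff u0 linear0.
by rewrite cmap_diff -ey.
Qed.

Lemma triv_fib_acyclic X Y (f : chain_map X Y) :
  triv_fib f -> acyclic Y -> acyclic X.
Proof.
move=> [_ qf] aY n x dx; have [fi _] := qf n; apply: fi => //.
by have [|y ey] := aY n (f _ x); [rewrite -cmap_diff dx linear0|exists y].
Qed.

Lemma acyclic_dsum X Y : acyclic X -> acyclic Y -> acyclic (dsum X Y).
Proof.
move=> aX aY n [x y] [/= dx dy].
have [x' ex] := aX n x dx; have [y' ey] := aY n y dy.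
by exists (x', y'); rewrite /= /dsum_fun /= ex ey.
Qed.

Lemma acyclic_zero : acyclic (zero_complex R).
Proof. by move=> n x _; exists 0; apply/matrixP => i []. Qed.

Lemma acyclic_cone_id X : acyclic (cone (chain_id X)).
Proof.
move=> n [a b] [/= da db]; exists (b, 0); rewrite /= /cone_fun /=.
have -> : a = - diff X (n + 1) b by apply/eqP; rewrite -addr_eq0; apply/eqP.
by rewrite linear0 addr0.
Qed.

(** * The inverse shift *)

(** The terms are transported along an equality of modules, since
X^(j+1-1) and X^j are not convertible. *)

Section Unshift.
Variable X : complex R.

Definition unshift_term : int -> lmodType R :=
  sval (int_lift (fun j => X j : lmodType R)).
Definition unshift_eq j : unshift_term (j + 1) = X j :=
  svalP (int_lift (fun j => X j : lmodType R)) j.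

Definition lmod_cast (U V : lmodType R) (e : U = V) : {linear U -> V} :=
  match e in _ = V return {linear U -> V} with erefl => idfun end.

Lemma lmod_castK (U V : lmodType R) (e : U = V) :
  cancel (lmod_cast e) (lmod_cast (esym e)).
Proof. by case: V / e. Qed.
Lemma lmod_castVK (U V : lmodType R) (e : U = V) :
  cancel (lmod_cast (esym e)) (lmod_cast e).
Proof. by case: V / e. Qed.

Definition unshift_val j : {linear unshift_term (j + 1) -> X j} :=
  lmod_cast (unshift_eq j).
Definition unshift_inv j : {linear X j -> unshift_term (j + 1)} :=
  lmod_cast (esym (unshift_eq j)).

Lemma unshift_valK j : cancel (unshift_val j) (unshift_inv j).
Proof. exact: lmod_castK. Qed.
Lemma unshift_invK j : cancel (unshift_inv j) (unshift_val j).
Proof. exact: lmod_castVK. Qed.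

(* The sign cancels the one in the differential of the shift. *)
Definition unshift_diff_exists :=
  @int_lift (fun n => {linear unshift_term n -> unshift_term (n + 1)})
    (fun j => unshift_inv (j + 1) \o (\- diff X j) \o unshift_val j).
Definition unshift_diff := sval unshift_diff_exists.

Lemma unshift_diffE j x :
  unshift_diff (j + 1) x = unshift_inv (j + 1) (- diff X j (unshift_val j x)).
Proof. by rewrite /unshift_diff (svalP unshift_diff_exists j). Qed.

Fact unshift_diffK n x : unshift_diff (n + 1) (unshift_diff n x) = 0.
Proof.
elim/int_succ_ind: n x => j x; rewrite !unshift_diffE unshift_invK.
by rewrite !linearN /= diffK !linear0 ?oppr0.
Qed.

Definition unshift : complex R := Complex unshift_diffK.

Fact shift_unshift_diff n (x : shift unshift n) :
  unshift_val (n + 1) (diff (shift unshift) n x) = diff X n (unshift_val n x).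
Proof. by rewrite /= unshift_diffE linearN /= unshift_invK opprK. Qed.

Definition shift_unshift : chain_map (shift unshift) X :=
  @ChainMap R (shift unshift) X unshift_val shift_unshift_diff.

Lemma shift_unshift_triv_fib : triv_fib shift_unshift.
Proof.
apply: surj_exact_kernel => [n x|n x _].
  by exists (unshift_inv n x); rewrite /= unshift_invK.
move=> /= /(congr1 (unshift_inv (n + 1))); rewrite unshift_valK !linear0 => ->.
by exists 0; rewrite /= linear0 ?oppr0.
Qed.

Section Map.
Variables (Y : complex R) (f : chain_map X (shift Y)).

Definition unshift_map_exists :=
  @int_lift (fun n => {linear unshift n -> Y n})
    (fun j => f j \o unshift_val j).
Definition unshift_map_fun := sval unshift_map_exists.

Lemma unshift_mapE j x : unshift_map_fun (j + 1) x = f j (unshift_val j x).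
Proof. by rewrite /unshift_map_fun (svalP unshift_map_exists j). Qed.

Fact unshift_map_diff n (x : unshift n) :
  unshift_map_fun (n + 1) (diff unshift n x) = diff Y n (unshift_map_fun n x).
Proof.
elim/int_succ_ind: n x => j x; rewrite /= unshift_diffE !unshift_mapE.
by rewrite unshift_invK linearN cmap_diff /= opprK.
Qed.
Definition unshift_map : chain_map unshift Y := ChainMap unshift_map_diff.

End Map.
End Unshift.

(** The cone of the identity of Y[-1] is contractible and surjects onto Y. *)
Lemma acyclic_cover Y :
  exists Z (z : chain_map Z Y), acyclic Z /\ surjective z.
Proof.
exists (cone (chain_id (unshift Y))),
  (chain_comp (shift_unshift Y) (cone_out (chain_id (unshift Y)))).
split; first exact: acyclic_cone_id.
move=> n y; exists (unshift_inv Y n y, 0).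
by rewrite /= /cone_out_fun /= unshift_invK.
Qed.

Lemma dsum_inl_quasi_iso X Z : acyclic Z -> quasi_iso (dsum_inl X Z).
Proof.
move=> aZ n; split=> [x dx [[y z] [ey _]]|[x z] [/= dx dz]]; first by exists y.
have [z' <-] := aZ n z dz; exists x, (0, z'); split=> //=.
by rewrite /pair_fun /dsum_fun /= linear0; congr pair; rewrite ?addr0 ?add0r.
Qed.

Lemma dsum_fst_triv_fib X Z : acyclic Z -> triv_fib (dsum_fst X Z).
Proof.
move=> aZ; apply: surj_exact_kernel => [n x|n [x z] [dx dz] /= ->].
  by exists (x, 0).
have [z' <-] := aZ n z dz; exists (0, z') => //.
by rewrite /= /dsum_fun /= linear0.
Qed.

(** A quasi-isomorphism becomes surjective after adding an acyclic complex to
its source.  This reduces the inversion of quasi-isomorphisms to that of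
trivial fibrations, for which strict pullbacks suffice. *)
Lemma quasi_iso_factor X Y (s : chain_map X Y) : quasi_iso s ->
  exists Z (z : chain_map Z Y), acyclic Z /\ triv_fib (chain_copair s z).
Proof.
move=> qs; have [Z [z [aZ sz]]] := acyclic_cover Y; exists Z, z; split=> //.
split=> [n y|n].
  by have [w <-] := sz n y; exists (0, w); rewrite /= linear0 add0r.
have [si ss] := qs n; split=> [[x w] [/= dx dw] [y ey]|y dy].
  have [w' ew] := aZ n w dw; have [|x' ex] := si x dx.
    exists (y - z n w'); apply: (addIr (z (n + 1) w)).
    by rewrite linearB /= -[in LHS]ew -cmap_diff ey subrK.
  by exists (x', w'); rewrite /= /dsum_fun /= ex ew.
have [x [y' [dx ->]]] := ss y dy; exists (x, 0), y'.
by rewrite /= /dsum_fun /= dx !linear0 addr0.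
Qed.

(** * Maps equal up to a map through an acyclic complex *)

(** This relation plays the role of chain homotopy: it is visibly contained in
equality in D(R), and compatible with composition on both sides. *)
Definition thru X Y (f g : chain_map X Y) :=
  exists Z (u : chain_map X Z) (v : chain_map Z Y),
    acyclic Z /\ forall n x, f n x - g n x = v n (u n x).

Lemma thru_ceq X Y (f g : chain_map X Y) : ceq f g -> thru f g.
Proof.
move=> e; exists (zero_complex R), (zero_chain _ _), (zero_chain _ _).
by split; [apply: acyclic_zero|move=> n x; rewrite e subrr].
Qed.

Lemma thru_sym X Y (f g : chain_map X Y) : thru f g -> thru g f.
Proof.
move=> [Z [u [v [aZ e]]]]; exists Z, u, (chain_opp v); split=> // n x.
by rewrite chain_oppE -e opprB.
Qed.

Lemma thru_trans X Y (f g h : chain_map X Y) : thru f g -> thru g h -> thru f h.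
Proof.
move=> [Z [u [v [aZ e]]]] [Z' [u' [v' [aZ' e']]]].
exists (dsum Z Z'), (chain_pair u u'), (chain_copair v v'); split.
  exact: acyclic_dsum.
by move=> n x; rewrite /= -e -e' addrA subrK.
Qed.

Lemma thru_compl X Y Z (f g : chain_map X Y) (h : chain_map Y Z) :
  thru f g -> thru (chain_comp h f) (chain_comp h g).
Proof.
move=> [W [u [v [aW e]]]]; exists W, u, (chain_comp h v); split=> // n x.
by rewrite /= -e linearB.
Qed.

Lemma thru_compr X Y Z (f g : chain_map Y Z) (h : chain_map X Y) :
  thru f g -> thru (chain_comp f h) (chain_comp g h).
Proof.
move=> [W [u [v [aW e]]]]; exists W, (chain_comp u h), v; split=> // n x.
by rewrite /= -e.
Qed.

Lemma thru_boundary X Y (f g : chain_map X Y) n (x : X (n + 1)) :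
  thru f g -> diff X (n + 1) x = 0 -> boundary (f (n + 1) x - g (n + 1) x).
Proof.
move=> [W [u [v [aW e]]]] dx; rewrite e; apply: boundary_map; apply: aW.
by rewrite -cmap_diff dx linear0.
Qed.

(** The base change of an acyclic complex along a trivial fibration is
acyclic. *)
Lemma thru_reflect X Y Z (f g : chain_map X Y) (s : chain_map Y Z) :
  triv_fib s -> thru (chain_comp s f) (chain_comp s g) -> thru f g.
Proof.
move=> ts [W [u [v [aW e]]]].
have e' n x : v n (u n x) = s n (chain_add f (chain_opp g) n x).
  by rewrite -e /= linearD scaleN1r linearN.
exists (pullback v s), (pullback_lift e'), (pullback_snd v s); split.
  exact: triv_fib_acyclic (pullback_triv_fib v ts) aW.
by move=> n x; rewrite /= scaleN1r.
Qed.

(** The Ore condition for quasi-isomorphisms *)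
Lemma quasi_iso_lift X Y Y' (s : chain_map Y Y') (f : chain_map X Y') :
  quasi_iso s -> exists X' (t : chain_map X' X) (g : chain_map X' Y),
    triv_fib t /\ thru (chain_comp f t) (chain_comp s g).
Proof.
move=> qs; have [Z [z [aZ tz]]] := quasi_iso_factor qs.
exists (pullback f (chain_copair s z)), (pullback_fst _ _),
  (chain_comp (dsum_fst Y Z) (pullback_snd _ _)); split.
  exact: pullback_triv_fib.
exists Z, (chain_comp (dsum_snd Y Z) (pullback_snd f (chain_copair s z))), z.
split=> // n x; rewrite /= (pullbackE x) /=.
by rewrite addrAC subrr add0r.
Qed.

End ChainMaps.

(** * Morphisms of the derived category *)

#[global] Instance deq_equivalence (R : comPzRingType) (X Y : complex R) :
  RelationClasses.Equivalence (@deq R X Y).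
Proof.
split.
- exact: (@deq_refl R X Y).
- exact: (@deq_sym R X Y).
- exact: (@deq_trans R X Y).
Qed.

#[global] Instance dcomp_proper (R : comPzRingType) (X Y Z : complex R) :
  Morphisms.Proper (Morphisms.respectful (@deq R Y Z)
    (Morphisms.respectful (@deq R X Y) (@deq R X Z))) (@dcomp R X Y Z).
Proof. move=> g g1 eg f f1 ef; exact: deq_comp. Qed.

#[global] Hint Resolve deq_refl : core.

Section Words.
Variable R : comPzRingType.
Implicit Types X Y Z W : complex R.

Lemma deq_cancel_l X Y Z (s : chain_map Y Z) (f g : dhom X Y) :
  quasi_iso s -> deq (dcomp (dloc s) f) (dcomp (dloc s) g) -> deq f g.
Proof.
move=> qs e.
by rewrite -(deq_1m f) -(deq_1m g) -(deq_invl qs) -!deq_A e.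
Qed.

Lemma deq_cancel_r X Y Z (s : chain_map X Y) (f g : dhom Y Z) :
  quasi_iso s -> deq (dcomp f (dloc s)) (dcomp g (dloc s)) -> deq f g.
Proof.
move=> qs e.
by rewrite -(deq_m1 f) -(deq_m1 g) -(deq_invr qs) !deq_A e.
Qed.

Lemma dloc_ceq X Y (f g : chain_map X Y) : ceq f g -> deq (dloc f) (dloc g).
Proof. exact: deq_loc_ext. Qed.

(** Two sections of the trivial fibration X + Z -> X agree in D(R). *)
Lemma thru_deq X Y (f g : chain_map X Y) : thru f g -> deq (dloc f) (dloc g).
Proof.
move=> [Z [u [v [aZ e]]]].
have tf := dsum_fst_triv_fib X aZ.
have e2 : deq (dloc (chain_pair (chain_id X) u)) (dloc (dsum_inl X Z)).
  apply: (deq_cancel_l tf.2).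
  by rewrite -!deq_loc_comp; apply: dloc_ceq.
have -> : deq (dloc f)
    (dloc (chain_comp (chain_copair g v) (chain_pair (chain_id X) u))).
  by apply: dloc_ceq => n x /=; rewrite -e addrC subrK.
rewrite deq_loc_comp e2 -deq_loc_comp; apply: dloc_ceq => n x /=.
by rewrite linear0 addr0.
Qed.

Lemma zero_compr X Y Z (w : dhom X Y) :
  deq (dcomp (dloc (zero_chain Y Z)) w) (dloc (zero_chain X Z)).
Proof.
elim: w Z => [{}X {}Y f|{}X {}Y s qs|{}X {}Y Z g IHg f IHf] W.
- by rewrite -deq_loc_comp; apply: dloc_ceq.
- by apply: (deq_cancel_r qs); rewrite -deq_A deq_invl deq_m1 -deq_loc_comp;
    apply: dloc_ceq.
- by rewrite deq_A IHg IHf.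
Qed.

Lemma zero_compl X Y Z (w : dhom Y Z) :
  deq (dcomp w (dloc (zero_chain X Y))) (dloc (zero_chain X Z)).
Proof.
elim: w X => [{}Y {}Z f|{}Y {}Z s qs|{}X {}Y {}Z g IHg f IHf] W.
- by rewrite -deq_loc_comp; apply: dloc_ceq => n x /=; rewrite linear0.
- apply: (deq_cancel_l qs); rewrite deq_A deq_invr deq_1m -deq_loc_comp.
  by apply: dloc_ceq => n x /=; rewrite linear0.
- by rewrite -deq_A IHf IHg.
Qed.

(** By induction on words: an inverse becomes a roof by the Ore condition, and
two roofs are composed by a strict pullback. *)
Lemma roofP X Y (w : dhom X Y) :
  exists V (t : chain_map V X) (f : chain_map V Y),
    triv_fib t /\ deq (dcomp w (dloc t)) (dloc f).
Proof.
elim: w => [{}X {}Y f|{}X {}Y s qs|{}X {}Y Z g IHg f IHf].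
- exists X, (chain_id X), f; split; first exact: triv_fib_id.
  by rewrite deq_m1.
- have [V [t [g [tt th]]]] := quasi_iso_lift (chain_id Y) qs.
  exists V, t, g; split=> //; apply: (deq_cancel_l qs).
  rewrite deq_A deq_invr -!deq_loc_comp.
  by rewrite (thru_deq th).
have [V [t [f0 [tt ef]]]] := IHf; have [V' [t' [g0 [tt' eg]]]] := IHg.
exists (pullback f0 t'), (chain_comp t (pullback_fst f0 t')),
  (chain_comp g0 (pullback_snd f0 t')); split.
  by apply: triv_fib_comp => //; apply: pullback_triv_fib.
rewrite !deq_loc_comp -eg -!deq_A; apply: deq_comp; first reflexivity.
rewrite deq_A ef -!deq_loc_comp; apply: dloc_ceq => n x.
exact: pullbackE.
Qed.

(** ** Extending functors from complexes to the derived category *)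

(** A setoid-valued functor on complexes that is bijective on trivial fibrations
inverts all quasi-isomorphisms, hence is defined on morphisms of D(R). *)
Section Extension.
Variables (F : complex R -> Type) (E : forall X, F X -> F X -> Prop).
Variable m : forall X Y, chain_map X Y -> F X -> F Y.
Hypothesis E_refl : forall X (a : F X), E a a.
Hypothesis E_sym : forall X (a b : F X), E a b -> E b a.
Hypothesis E_trans : forall X (a b c : F X), E a b -> E b c -> E a c.
Hypothesis mE : forall X Y (f : chain_map X Y) a b, E a b -> E (m f a) (m f b).
Hypothesis m_ceq :
  forall X Y (f g : chain_map X Y) a, ceq f g -> E (m f a) (m g a).
Hypothesis m_id : forall X (a : F X), E (m (chain_id X) a) a.
Hypothesis m_comp : forall X Y Z (g : chain_map Y Z) (f : chain_map X Y) a,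
  E (m (chain_comp g f) a) (m g (m f a)).
Hypothesis m_inj : forall X Y (s : chain_map X Y) a b,
  triv_fib s -> E (m s a) (m s b) -> E a b.
Hypothesis m_surj : forall X Y (s : chain_map X Y) b,
  triv_fib s -> exists a, E (m s a) b.

Lemma ext_inj X Y (s : chain_map X Y) a b :
  quasi_iso s -> E (m s a) (m s b) -> E a b.
Proof.
move=> qs e; have [Z [z [aZ tz]]] := quasi_iso_factor qs.
have fac : ceq s (chain_comp (chain_copair s z) (dsum_inl X Z)).
  by move=> n x /=; rewrite linear0 addr0.
have h c : E (m s c) (m (chain_copair s z) (m (dsum_inl X Z) c)).
  exact: E_trans (m_ceq _ fac) (m_comp _ _ _).
have := m_inj tz (E_trans (E_sym (h a)) (E_trans e (h b))).
move=> /(mE (dsum_fst X Z)).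
have k c : E (m (dsum_fst X Z) (m (dsum_inl X Z) c)) c.
  apply: E_trans (m_id c); apply: E_trans (E_sym (m_comp _ _ _)) _.
  exact: m_ceq.
by move=> e'; apply: E_trans (E_sym (k a)) (E_trans e' (k b)).
Qed.

Lemma ext_surj X Y (s : chain_map X Y) b :
  quasi_iso s -> exists a, E (m s a) b.
Proof.
move=> qs; have [Z [z [aZ tz]]] := quasi_iso_factor qs.
have fac : ceq s (chain_comp (chain_copair s z) (dsum_inl X Z)).
  by move=> n x /=; rewrite linear0 addr0.
have [w ew] := m_surj b tz; exists (m (dsum_fst X Z) w).
apply: E_trans (m_ceq _ fac) _; apply: E_trans (m_comp _ _ _) _.
apply: E_trans ew; apply: mE.
apply: (m_inj (dsum_fst_triv_fib X aZ)).
apply: E_trans (m_id _); apply: E_trans (E_sym (m_comp _ _ _)) _.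
exact: m_ceq.
Qed.

Fixpoint ext X Y (w : dhom X Y) : F X -> F Y :=
  match w in dhom X Y return F X -> F Y with
  | dloc X Y f => m f
  | dinv X Y s qs => fun b => sval (cid (ext_surj b qs))
  | dcomp X Y Z g f => fun a => ext g (ext f a)
  end.

Lemma ext_dinv X Y (s : chain_map X Y) (qs : quasi_iso s) b :
  E (m s (ext (dinv qs) b)) b.
Proof. exact: (svalP (cid (ext_surj b qs))). Qed.

Lemma extE X Y (w : dhom X Y) a b : E a b -> E (ext w a) (ext w b).
Proof.
elim: w a b => [{}X {}Y f|{}X {}Y s qs|{}X {}Y Z g IHg f IHf] a b e.
- exact: mE.
- apply: (ext_inj qs); apply: E_trans (ext_dinv qs a) _.
  exact: E_trans e (E_sym (ext_dinv qs b)).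
- exact/IHg/IHf.
Qed.

Lemma ext_deq X Y (w w' : dhom X Y) a : deq w w' -> E (ext w a) (ext w' a).
Proof.
move=> e; elim: e a => {X Y w w'} /=.
- by move=> X Y f a; apply: E_refl.
- by move=> X Y f g _ IH a; apply/E_sym/IH.
- by move=> X Y f g h _ IH _ IH' a; apply: E_trans (IH a) (IH' a).
- move=> X Y Z g g' f f' _ IHg _ IHf a.
  by apply: E_trans (IHg _); apply: extE.
- by move=> X Y f a; apply: m_id.
- by move=> X Y f a; apply: extE; apply: m_id.
- by move=> X Y Z W h g f a; apply: E_refl.
- by move=> X Y f g e a; apply: m_ceq.
- by move=> X Y Z g f a; apply: m_comp.
- move=> X Y s qs a; apply: (ext_inj qs).
  apply: E_trans (ext_dinv qs (m s a)) _; apply: mE.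
  exact: E_sym (m_id _).
- by move=> X Y s qs a; apply: E_trans (ext_dinv qs a) (E_sym (m_id _)).
Qed.

End Extension.

(** ** Roofs with a fixed source *)

(** Roofs with source X form a functor of the target to which [ext] applies; its
value on the identity roof recovers a morphism of D(R) up to refinement. *)
Section Roofs.
Variable X : complex R.

Record roof Y := Roof {
  roof_top : complex R;
  roof_left : chain_map roof_top X;
  roof_right : chain_map roof_top Y;
  roof_triv_fib : triv_fib roof_left }.

Definition roof_eq Y (a b : roof Y) :=
  exists V (p : chain_map V (roof_top a)) (q : chain_map V (roof_top b)),
    [/\ triv_fib p, triv_fib q,
        ceq (chain_comp (roof_left a) p) (chain_comp (roof_left b) q) &
        thru (chain_comp (roof_right a) p) (chain_comp (roof_right b) q)].

Definition roof_map Y Z (f : chain_map Y Z) (a : roof Y) : roof Z :=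
  Roof (chain_comp f (roof_right a)) (roof_triv_fib a).

Lemma roof_eq_refl Y (a : roof Y) : roof_eq a a.
Proof.
exists (roof_top a), (chain_id _), (chain_id _); split=> //;
  try exact: triv_fib_id.
exact: thru_ceq.
Qed.

Lemma roof_eq_sym Y (a b : roof Y) : roof_eq a b -> roof_eq b a.
Proof.
move=> [V [p [q [tp tq e th]]]]; exists V, q, p; split=> //.
exact: (thru_sym th).
Qed.

(** By symmetry of the pullback *)
Lemma pullback_snd_triv_fib Y Z W (f : chain_map Y W) (g : chain_map Z W) :
  triv_fib f -> triv_fib (pullback_snd f g).
Proof.
move=> tf.
have e n (u : pullback f g n) :
    g n (pullback_snd f g n u) = f n (pullback_fst f g n u).
  by rewrite pullbackE.
have [gs qg] := pullback_triv_fib g tf.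
pose sw := pullback_lift e; split=> [n z|].
  have [u eu] := gs n z; exists (pullback_elt (esym (pullbackE u))) => //=.
suff qsw : quasi_iso sw.
  exact: (quasi_iso_comp qg qsw).
suff [] : triv_fib sw by [].
apply: surj_exact_kernel => [n u|n u _].
  exists (pullback_elt (esym (pullbackE u))); exact: pullback_ext.
move=> e0; exists 0; rewrite !linear0 //; apply: pullback_ext.
  rewrite linear0; have := congr1 (pullback_snd g f (n + 1)) e0.
  by rewrite linear0 => <-.
rewrite linear0; have := congr1 (pullback_fst g f (n + 1)) e0.
by rewrite linear0 => <-.
Qed.

Lemma roof_eq_trans Y (a b c : roof Y) :
  roof_eq a b -> roof_eq b c -> roof_eq a c.
Proof.
move=> [V [p [q [tp tq e th]]]] [V' [p' [q' [tp' tq' e' th']]]].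
have pbe n x := @pullbackE R _ _ _ q p' n x.
exists (pullback q p'), (chain_comp p (pullback_fst q p')),
  (chain_comp q' (pullback_snd q p')); split.
- by apply: triv_fib_comp => //; apply: pullback_triv_fib.
- by apply: triv_fib_comp => //; apply: pullback_snd_triv_fib.
- move=> n x; rewrite /= -[RHS]e' -[LHS]/(chain_comp (roof_left a) p n _) e.
  by rewrite /= -pbe.
have h1 := thru_compr (pullback_fst q p') th.
have h2 := thru_compr (pullback_snd q p') th'.
apply: thru_trans h1 _; apply: thru_trans h2.
by apply: thru_ceq => n x; rewrite /= -pbe.
Qed.

Lemma roof_map_inj Y Z (s : chain_map Y Z) a b :
  triv_fib s -> roof_eq (roof_map s a) (roof_map s b) -> roof_eq a b.
Proof.
move=> ts [V [p [q [tp tq e th]]]]; exists V, p, q; split=> //.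
exact: (@thru_reflect _ _ _ _ (chain_comp (roof_right a) p)
  (chain_comp (roof_right b) q) s ts th).
Qed.

Lemma roof_map_surj Y Z (s : chain_map Y Z) (b : roof Z) :
  triv_fib s -> exists a, roof_eq (roof_map s a) b.
Proof.
case: b => V t f tt ts.
exists (Roof (pullback_snd f s)
  (triv_fib_comp tt (pullback_triv_fib f ts))).
exists (pullback f s), (chain_id _), (pullback_fst f s); split=> //=.
- exact: triv_fib_id.
- exact: pullback_triv_fib.
by apply: thru_ceq => n x /=; rewrite (pullbackE x).
Qed.

Lemma roof_map_eq Y Z (f : chain_map Y Z) a b :
  roof_eq a b -> roof_eq (roof_map f a) (roof_map f b).
Proof.
move=> [V [p [q [tp tq e th]]]]; exists V, p, q; split=> //.
exact: (thru_compl f th).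
Qed.

Lemma roof_right_ceq Y (a : roof Y) (g : chain_map (roof_top a) Y) :
  ceq (roof_right a) g -> roof_eq a (Roof g (roof_triv_fib a)).
Proof.
move=> e; exists (roof_top a), (chain_id _), (chain_id _).
split=> //; try exact: triv_fib_id.
by apply: thru_ceq => n x /=; apply: e.
Qed.

End Roofs.

(** Applied to the identity roof of X, the extended roof functor turns a
derivation of equality into a common refinement. *)
Lemma dloc_eq_thru X Y (f g : chain_map X Y) : deq (dloc f) (dloc g) ->
  exists V (t : chain_map V X),
    triv_fib t /\ thru (chain_comp f t) (chain_comp g t).
Proof.
pose idr := @Roof X X X (chain_id X) (chain_id X) (triv_fib_id X).
move=> /(@ext_deq _ _ (@roof_map X) (@roof_eq_refl X) (@roof_eq_sym X)
  (@roof_eq_trans X) (@roof_map_eq X)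
  (fun Y Z f g a (e : ceq f g) => @roof_right_ceq X Z (roof_map f a)
     (chain_comp g (roof_right a)) (fun n x => e n (roof_right a n x)))
  (fun Y a => roof_eq_refl (roof_map (chain_id Y) a))
  (fun Y Z W g f a => roof_eq_refl (roof_map (chain_comp g f) a))
  (@roof_map_inj X) (@roof_map_surj X) _ _ _ _ idr).
move=> [V [p [q [tp tq e th]]]]; exists V, p; split=> //.
apply: thru_trans th _; apply: thru_ceq => n x /=.
by rewrite -[q n x]/(chain_comp (chain_id X) q n x) -e.
Qed.

(** ** Cohomology of morphisms *)

Section Cohomology.
Variable n : int.

Definition cycle X := {x : X (n + 1) | diff X (n + 1) x = 0}.
Definition cycle_eq X (a b : cycle X) := boundary (sval a - sval b).

Fact cycle_map_subproof X Y (f : chain_map X Y) (a : cycle X) :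
  diff Y (n + 1) (f (n + 1) (sval a)) = 0.
Proof. by case: a => x /= dx; rewrite -cmap_diff dx linear0. Qed.
Definition cycle_map X Y (f : chain_map X Y) (a : cycle X) : cycle Y :=
  exist _ _ (cycle_map_subproof f a).

Lemma cycle_eq_refl X (a : cycle X) : cycle_eq a a.
Proof. by rewrite /cycle_eq subrr; apply: boundary0. Qed.
Lemma cycle_eq_sym X (a b : cycle X) : cycle_eq a b -> cycle_eq b a.
Proof. by move=> /boundaryN; rewrite opprB. Qed.
Lemma cycle_eq_trans X (a b c : cycle X) :
  cycle_eq a b -> cycle_eq b c -> cycle_eq a c.
Proof.
by move=> h /(boundaryD h); rewrite addrA subrK.
Qed.
Lemma cycle_mapE X Y (f : chain_map X Y) a b :
  cycle_eq a b -> cycle_eq (cycle_map f a) (cycle_map f b).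
Proof. by move=> /(boundary_map f); rewrite linearB. Qed.
Lemma cycle_map_ceq X Y (f g : chain_map X Y) a :
  ceq f g -> cycle_eq (cycle_map f a) (cycle_map g a).
Proof.
by move=> e; rewrite /cycle_eq /= e subrr; apply: boundary0.
Qed.
Lemma cycle_map_inj X Y (s : chain_map X Y) a b :
  triv_fib s -> cycle_eq (cycle_map s a) (cycle_map s b) -> cycle_eq a b.
Proof.
move=> [_ qs]; rewrite /cycle_eq /= -linearB; have [si _] := qs n.
apply: si; case: a b => [x dx] [y dy] /=; rewrite linearB /= dx dy.
by rewrite subrr.
Qed.
Lemma cycle_map_surj X Y (s : chain_map X Y) b :
  triv_fib s -> exists a, cycle_eq (cycle_map s a) b.
Proof.
case: b => y dy ts; have [x dx e] := triv_fib_cycle ts dy.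
by exists (exist _ x dx); rewrite /cycle_eq /= e subrr; apply: boundary0.
Qed.

Definition cycle_ext := @ext cycle cycle_eq cycle_map cycle_eq_sym
  cycle_eq_trans cycle_mapE cycle_map_ceq (fun X a => cycle_eq_refl _)
  (fun X Y Z g f a => cycle_eq_refl _) cycle_map_inj cycle_map_surj.

(** [induces w x y]: H^(n+1)(w) sends the class of x to the class of y. *)
Definition induces X Y (w : dhom X Y) (x : X (n + 1)) (y : Y (n + 1)) :=
  exists (dx : diff X (n + 1) x = 0) (dy : diff Y (n + 1) y = 0),
    cycle_eq (cycle_ext w (exist _ x dx)) (exist _ y dy).

Lemma induces_cyclel X Y (w : dhom X Y) x y :
  induces w x y -> diff X (n + 1) x = 0.
Proof. by case. Qed.

Lemma induces_cycler X Y (w : dhom X Y) x y :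
  induces w x y -> diff Y (n + 1) y = 0.
Proof. by case=> dx []. Qed.

Lemma induces_loc X Y (f : chain_map X Y) x :
  diff X (n + 1) x = 0 -> induces (dloc f) x (f (n + 1) x).
Proof.
move=> dx; exists dx, (cycle_map_subproof f (exist _ x dx)).
exact: cycle_eq_refl.
Qed.

Lemma induces_total X Y (w : dhom X Y) x :
  diff X (n + 1) x = 0 -> exists y, induces w x y.
Proof.
move=> dx; case e : (cycle_ext w (exist _ x dx)) => [y dy].
by exists y, dx, dy; rewrite e; apply: cycle_eq_refl.
Qed.

Lemma induces_uniq X Y (w : dhom X Y) x x' y y' :
  induces w x y -> induces w x' y' -> boundary (x - x') -> boundary (y - y').
Proof.
move=> [dx [dy e]] [dx' [dy' e']] b.
have h : cycle_eq (exist _ x dx) (exist _ x' dx') by [].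
have := cycle_eq_trans (cycle_eq_sym e) (cycle_eq_trans
  (extE cycle_eq_sym cycle_eq_trans cycle_mapE cycle_map_ceq
    (fun X a => cycle_eq_refl _) (fun X Y Z g f a => cycle_eq_refl _)
    cycle_map_inj cycle_map_surj w h) e').
by [].
Qed.

Lemma induces_eqr X Y (w : dhom X Y) x y y' :
  induces w x y -> boundary (y - y') -> induces w x y'.
Proof.
move=> [dx [dy e]] b.
have dy' : diff Y (n + 1) y' = 0.
  by have := boundary_cycle b; rewrite linearB /= dy sub0r => /eqP;
    rewrite oppr_eq0 => /eqP.
by exists dx, dy'; apply: cycle_eq_trans e _.
Qed.

Lemma induces_deq X Y (w w' : dhom X Y) x y :
  deq w w' -> induces w x y -> induces w' x y.
Proof.
move=> e [dx [dy h]]; exists dx, dy; apply: cycle_eq_trans h.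
apply: (ext_deq cycle_eq_refl); exact: deq_sym.
Qed.

Lemma induces_comp X Y Z (g : dhom Y Z) (f : dhom X Y) x y z :
  induces f x y -> induces g y z -> induces (dcomp g f) x z.
Proof.
move=> [dx [dy e]] [dy' [dz e']]; exists dx, dz.
apply: cycle_eq_trans e'.
have e2 : cycle_eq (cycle_ext f (exist _ x dx)) (exist _ y dy') by [].
by have := extE cycle_eq_sym cycle_eq_trans cycle_mapE cycle_map_ceq
  (fun X a => cycle_eq_refl _) (fun X Y Z g f a => cycle_eq_refl _)
  cycle_map_inj cycle_map_surj g e2.
Qed.

Lemma induces_dinv X Y (s : chain_map X Y) (qs : quasi_iso s) x :
  diff X (n + 1) x = 0 -> induces (dinv qs) (s (n + 1) x) x.
Proof.
move=> dx; have dsx : diff Y (n + 1) (s (n + 1) x) = 0.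
  by rewrite -cmap_diff dx linear0.
have [x' h] := induces_total (dinv qs) dsx; apply: (induces_eqr h).
have h2 := induces_deq (deq_invl qs) (induces_comp (induces_loc s dx) h).
have h3 := induces_loc (chain_id X) dx.
by apply: (induces_uniq h2 h3); rewrite subrr; apply: boundary0.
Qed.

Lemma induces_lin X Y (w : dhom X Y) a x x' y y' :
  induces w x y -> induces w x' y' -> induces w (a *: x + x') (a *: y + y').
Proof.
move=> h h'; have [V [t [f [tt e]]]] := roofP w.
have [v dv ev] := triv_fib_cycle tt (induces_cyclel h).
have [v' dv' ev'] := triv_fib_cycle tt (induces_cyclel h').
have key u : diff V (n + 1) u = 0 -> induces w (t (n + 1) u) (f (n + 1) u).
  move=> du.
  have [z hz] := induces_total w (induces_cycler (induces_loc t du)).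
  apply: (induces_eqr hz).
  apply: (induces_uniq (induces_deq e (induces_comp (induces_loc t du) hz))
    (induces_loc f du)).
  by rewrite subrr; apply: boundary0.
have := key (a *: v + v'); rewrite !linearP /= dv dv' scaler0 addr0 ev ev'.
move=> /(_ erefl) /induces_eqr; apply.
rewrite opprD addrACA -scalerBr; apply: boundaryD; first apply: boundaryZ.
  by have := induces_uniq (key v dv) h; apply; rewrite ev subrr;
    apply: boundary0.
by have := induces_uniq (key v' dv') h'; apply; rewrite ev' subrr;
    apply: boundary0.
Qed.

End Cohomology.
End Words.

(** * Direct sums of modules *)

Section DirectSumModule.
Variables (R : comPzRingType) (I : small_index) (V : I -> lmodType R).

Definition dprod : Type := forall i, V i.
HB.instance Definition _ := gen_eqMixin dprod.
HB.instance Definition _ := gen_choiceMixin dprod.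

Lemma dprod_ext (u v : dprod) : (forall i, u i = v i) -> u = v.
Proof. exact: functional_extensionality_dep. Qed.

Definition dprod_zero : dprod := fun i => 0.
Definition dprod_add (u v : dprod) : dprod := fun i => u i + v i.
Definition dprod_opp (u : dprod) : dprod := fun i => - u i.
Definition dprod_scale a (u : dprod) : dprod := fun i => a *: u i.

Fact dprod_addA : associative dprod_add.
Proof. by move=> u v w; apply: dprod_ext => i; apply: addrA. Qed.
Fact dprod_addC : commutative dprod_add.
Proof. by move=> u v; apply: dprod_ext => i; apply: addrC. Qed.
Fact dprod_add0 : left_id dprod_zero dprod_add.
Proof. by move=> u; apply: dprod_ext => i; apply: add0r. Qed.
Fact dprod_addN : left_inverse dprod_zero dprod_opp dprod_add.
Proof. by move=> u; apply: dprod_ext => i; apply: addNr. Qed.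
HB.instance Definition _ :=
  GRing.isZmodule.Build dprod dprod_addA dprod_addC dprod_add0 dprod_addN.

Fact dprod_scaleA a b u :
  dprod_scale a (dprod_scale b u) = dprod_scale (a * b) u.
Proof. by apply: dprod_ext => i; apply: scalerA. Qed.
Fact dprod_scale1 : left_id 1 dprod_scale.
Proof. by move=> u; apply: dprod_ext => i; apply: scale1r. Qed.
Fact dprod_scaleDr : right_distributive dprod_scale +%R.
Proof. by move=> a u v; apply: dprod_ext => i; apply: scalerDr. Qed.
Fact dprod_scaleDl u : {morph dprod_scale^~ u : a b / a + b}.
Proof. by move=> a b; apply: dprod_ext => i; apply: scalerDl. Qed.
HB.instance Definition _ := GRing.Zmodule_isLmodule.Build R dprod
  dprod_scaleA dprod_scale1 dprod_scaleDr dprod_scaleDl.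

Definition supported (r : seq {classic I}) (u : dprod) :=
  forall i : {classic I}, u i <> 0 -> i \in r.

Fact fin_supp0 : exists r, supported r 0.
Proof. by exists [::]. Qed.
Fact fin_suppL a (u v : dprod) :
  (exists r, supported r u) -> (exists r, supported r v) ->
  exists r, supported r (a *: u + v).
Proof.
move=> [r hr] [s hs]; exists (r ++ s) => i ni; rewrite mem_cat.
have [u0|/hr -> //] := pselect (u i = 0).
have [v0|/hs ->] := pselect (v i = 0); last by rewrite orbT.
case: ni; rewrite -[LHS]/(a *: u i + v i).
by rewrite u0 v0 scaler0 addr0.
Qed.
Definition fin_supp : submodule dprod := Submodule fin_supp0 fin_suppL.

Definition dsumI_mod : lmodType R := sub_of fin_supp.

Definition coor (u : dsumI_mod) : forall i, V i := sub_val u.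

Arguments coor : simpl never.

Lemma coor_ext (u v : dsumI_mod) : (forall i, coor u i = coor v i) -> u = v.
Proof. by move=> e; apply/sub_ext/dprod_ext. Qed.

Lemma coorP a (u v : dsumI_mod) i :
  coor (a *: u + v) i = a *: coor u i + coor v i.
Proof. by []. Qed.

Lemma coor0 i : coor 0 i = 0. Proof. by []. Qed.

Lemma coorD (u v : dsumI_mod) i : coor (u + v) i = coor u i + coor v i.
Proof. by []. Qed.

Lemma coorN (u : dsumI_mod) i : coor (- u) i = - coor u i.
Proof. by []. Qed.

Lemma coorZ a (u : dsumI_mod) i : coor (a *: u) i = a *: coor u i.
Proof. by []. Qed.

Lemma coor_supp (u : dsumI_mod) :
  {r : seq {classic I} | uniq r &
    forall i : {classic I}, i \notin r -> coor u i = 0}.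
Proof.
have [r hr] := cid (sub_memP u); exists (undup r); first exact: undup_uniq.
move=> i; rewrite mem_undup => /negP nr; apply: contrapT => /hr; exact: nr.
Qed.

Definition of_supp (u : dprod) (r : seq {classic I})
    (h : forall i : {classic I}, i \notin r -> u i = 0) : dsumI_mod :=
  @SubOf R dprod fin_supp u
    (ex_intro _ r (fun i ni => contra_notT (h i) ni)).

Lemma coor_supp2 (u v : dsumI_mod) :
  {r : seq {classic I} | uniq r &
    forall i : {classic I}, i \notin r -> coor u i = 0 /\ coor v i = 0}.
Proof.
have [r _ hr] := coor_supp u; have [s _ hs] := coor_supp v.
exists (undup (r ++ s)); first exact: undup_uniq.
by move=> i; rewrite mem_undup mem_cat negb_or => /andP[/hr -> /hs ->].
Qed.

Section Inj.
Variable i : I.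

Definition single_fam : V i -> dprod := @single I (fun j => V j : nmodType) i.

Lemma inj_supp (x : V i) (j : {classic I}) :
  j \notin [:: (i : {classic I})] -> single_fam x j = 0.
Proof.
by rewrite inE => /eqP; apply: (@single0 I (fun j => V j : nmodType)).
Qed.

Definition dsumI_inj_fun (x : V i) : dsumI_mod := of_supp (inj_supp x).

Lemma coor_inj_fun x : coor (dsumI_inj_fun x) i = x.
Proof. exact: (@singleE I (fun j => V j : nmodType)). Qed.

Lemma coor_inj_fun0 x j : j <> i -> coor (dsumI_inj_fun x) j = 0.
Proof. exact: (@single0 I (fun j => V j : nmodType)). Qed.

Fact dsumI_inj_linear : linear dsumI_inj_fun.
Proof.
move=> a x y; apply: coor_ext => j; rewrite coorP.
have [->|ji] := pselect (j = i); first by rewrite !coor_inj_fun.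
by rewrite !coor_inj_fun0 // scaler0 addr0.
Qed.
HB.instance Definition _ :=
  GRing.isLinear.Build R (V i) dsumI_mod *:%R dsumI_inj_fun dsumI_inj_linear.
Definition dsumI_inj : {linear V i -> dsumI_mod} := dsumI_inj_fun.

Lemma coor_inj x : coor (dsumI_inj x) i = x.
Proof. exact: coor_inj_fun. Qed.

Lemma coor_inj0 x j : j <> i -> coor (dsumI_inj x) j = 0.
Proof. exact: coor_inj_fun0. Qed.
End Inj.

Lemma dsumI_injE (u : dsumI_mod) (r : seq {classic I}) : uniq r ->
  (forall i : {classic I}, i \notin r -> coor u i = 0) ->
  u = \sum_(i <- r) dsumI_inj i (coor u i).
Proof.
move=> ur hr; apply: coor_ext => j.
have cs (s : seq {classic I}) (f : forall i, dsumI_mod) :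
    coor (\sum_(i <- s) f i) j = \sum_(i <- s) coor (f i) j.
  by apply: (big_morph (fun u : dsumI_mod => coor u j)).
rewrite cs; have [jr|/hr j0] := boolP ((j : {classic I}) \in r).
  rewrite (bigD1_seq (j : {classic I})) // coor_inj big1 /= ?addr0 //.
  by move=> i /eqP ij; apply: coor_inj0 => ji; apply: ij.
rewrite j0 big1_seq // => i /andP[_ ir].
have [ij|ij] := pselect (j = i); last exact: coor_inj0.
by subst i; rewrite coor_inj.
Qed.

Section Desc.
Variables (W : lmodType R) (g : forall i, {linear V i -> W}).

Definition dsumI_desc_fun (u : dsumI_mod) : W :=
  \sum_(i \in [set: {classic I}]) g i (coor u i).

Lemma dsumI_desc_seq (u : dsumI_mod) (r : seq {classic I}) : uniq r ->
  (forall i : {classic I}, i \notin r -> coor u i = 0) ->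
  dsumI_desc_fun u = \sum_(i <- r) g i (coor u i).
Proof.
move=> ur hr; rewrite /dsumI_desc_fun (fsbigE r) //; last first.
  by move=> i _ /hr ->; exact: linear0.
by apply: eq_bigl => i; rewrite in_setT.
Qed.

Fact dsumI_desc_linear : linear dsumI_desc_fun.
Proof.
move=> a u v; have [r ur hr] := coor_supp2 u v.
rewrite !(@dsumI_desc_seq _ r) // => [|i /hr[_ ->] //|i /hr[-> _] //|i /hr h].
  rewrite scaler_sumr -big_split; apply: eq_bigr => i _.
  by rewrite coorP linearP.
by rewrite coorP h.1 h.2 scaler0 addr0.
Qed.
HB.instance Definition _ :=
  GRing.isLinear.Build R dsumI_mod W *:%R dsumI_desc_fun dsumI_desc_linear.
Definition dsumI_desc : {linear dsumI_mod -> W} := dsumI_desc_fun.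

Lemma dsumI_desc_inj i x : dsumI_desc (dsumI_inj i x) = g i x.
Proof.
rewrite /= (@dsumI_desc_seq _ [:: (i : {classic I})]) //; last exact: inj_supp.
by rewrite big_seq1 coor_inj.
Qed.
End Desc.

Lemma dsumI_linear_ext (W : lmodType R) (f g : {linear dsumI_mod -> W}) :
  (forall i x, f (dsumI_inj i x) = g (dsumI_inj i x)) -> f =1 g.
Proof.
move=> e u; have [r ur hr] := coor_supp u.
rewrite (dsumI_injE ur hr) !linear_sum.
by apply: eq_bigr => i _; apply: e.
Qed.

End DirectSumModule.

(** * Direct sums of complexes *)

Section DirectSumComplex.
Variables (R : comPzRingType) (I : small_index).
Implicit Types X Y : I -> complex R.

Section Map.
Variables (U V : I -> lmodType R) (f : forall i, {linear U i -> V i}).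
Lemma dsumI_map_supp (u : dsumI_mod U) (i : {classic I}) :
  i \notin s2val (coor_supp u) -> f i (coor u i) = 0.
Proof.
by case: (coor_supp u) => r ur hr /= /hr ->; rewrite linear0.
Qed.
Definition dsumI_map_fun (u : dsumI_mod U) : dsumI_mod V :=
  of_supp (@dsumI_map_supp u).
Lemma coor_map u i : coor (dsumI_map_fun u) i = f i (coor u i).
Proof. by []. Qed.
Fact dsumI_map_linear : linear dsumI_map_fun.
Proof.
by move=> a u v; apply: coor_ext => i; rewrite coorP !coor_map coorP linearP.
Qed.
HB.instance Definition _ := GRing.isLinear.Build R (dsumI_mod U) (dsumI_mod V)
  *:%R dsumI_map_fun dsumI_map_linear.
Definition dsumI_map_lin : {linear dsumI_mod U -> dsumI_mod V} := dsumI_map_fun.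
End Map.

Definition dsumI_term X (n : int) : lmodType R := dsumI_mod (fun i => X i n).

Fact dsumI_diffK X (n : int) (x : dsumI_term X n) :
  dsumI_map_lin (fun i => diff (X i) (n + 1))
    (dsumI_map_lin (fun i => diff (X i) n) x) = 0 :> dsumI_term X (n + 1 + 1).
Proof. by apply: coor_ext => i; rewrite !coor_map diffK. Qed.

Definition dsumI X : complex R :=
  @Complex R (dsumI_term X) (fun n => dsumI_map_lin (fun i => diff (X i) n))
    (@dsumI_diffK X).

Lemma coor_diff X n (u : dsumI X n) i :
  coor (diff (dsumI X) n u) i = diff (X i) n (coor u i).
Proof. by []. Qed.

Fact dsumI_in_diff X i n (x : X i n) :
  dsumI_inj (fun i => X i (n + 1)) i (diff (X i) n x)
  = diff (dsumI X) n (dsumI_inj (fun i => X i n) i x).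
Proof.
apply: coor_ext => j; rewrite coor_diff.
have [->|ji] := pselect (j = i); first by rewrite !coor_inj.
by rewrite !coor_inj0 // linear0.
Qed.
Definition dsumI_in X i : chain_map (X i) (dsumI X) :=
  @ChainMap R (X i) (dsumI X) (fun n => dsumI_inj (fun i => X i n) i)
    (@dsumI_in_diff X i).

Lemma coor_in X i n (x : X i n) : coor (dsumI_in X i n x) i = x.
Proof. exact: coor_inj. Qed.
Lemma coor_in0 X i n (x : X i n) j : j <> i -> coor (dsumI_in X i n x) j = 0.
Proof. exact: coor_inj0. Qed.

Lemma dsumI_ext X Z (f g : chain_map (dsumI X) Z) :
  (forall i n x, f n (dsumI_in X i n x) = g n (dsumI_in X i n x)) -> ceq f g.
Proof. by move=> e n; apply: dsumI_linear_ext => i x; apply: e. Qed.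

Fact dsumI_out_diff X Z (g : forall i, chain_map (X i) Z) n (u : dsumI X n) :
  dsumI_desc (fun i => g i (n + 1)) (diff (dsumI X) n u)
  = diff Z n (dsumI_desc (fun i => g i n) u).
Proof.
apply: (@dsumI_linear_ext R I (fun i => X i n) _
  (dsumI_desc (fun i => g i (n + 1)) \o diff (dsumI X) n)
  (diff Z n \o dsumI_desc (fun i => g i n))) => i x.
have := dsumI_in_diff x; rewrite [X in _ -> X]/= => <-.
have h1 := dsumI_desc_inj (fun i => g i (n + 1)) (diff (X i) n x).
have h2 := dsumI_desc_inj (fun i => g i n) x.
by rewrite /= in h1 h2; rewrite h1 h2 cmap_diff.
Qed.
Definition dsumI_out X Z (g : forall i, chain_map (X i) Z) :
  chain_map (dsumI X) Z :=
  @ChainMap R (dsumI X) Z (fun n => dsumI_desc (fun i => g i n))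
    (@dsumI_out_diff X Z g).

Lemma dsumI_out_in X Z (g : forall i, chain_map (X i) Z) i n x :
  dsumI_out g n (dsumI_in X i n x) = g i n x.
Proof. exact: (dsumI_desc_inj (fun i => g i n)). Qed.

Fact dsumI_map_diff X Y (f : forall i, chain_map (X i) (Y i)) n
    (u : dsumI X n) :
  dsumI_map_lin (fun i => f i (n + 1)) (diff (dsumI X) n u)
  = diff (dsumI Y) n (dsumI_map_lin (fun i => f i n) u).
Proof. by apply: coor_ext => i; rewrite !coor_map cmap_diff. Qed.
Definition dsumI_map X Y (f : forall i, chain_map (X i) (Y i)) :
  chain_map (dsumI X) (dsumI Y) :=
  @ChainMap R (dsumI X) (dsumI Y) (fun n => dsumI_map_lin (fun i => f i n))
    (@dsumI_map_diff X Y f).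

Lemma coor_mapE X Y (f : forall i, chain_map (X i) (Y i)) n (u : dsumI X n) i :
  coor (dsumI_map f n u) i = f i n (coor u i).
Proof. by []. Qed.

Lemma dsumI_map_in X Y (f : forall i, chain_map (X i) (Y i)) i n x :
  dsumI_map f n (dsumI_in X i n x) = dsumI_in Y i n (f i n x).
Proof.
apply: coor_ext => j; rewrite coor_mapE.
have [->|ji] := pselect (j = i); first by rewrite !coor_in.
by rewrite !coor_in0 // linear0.
Qed.

(** The choice is 0 outside the support of u; so H(-) of a direct sum is the
direct sum of the H(-). *)
Lemma coor_choice (U V : I -> lmodType R) (P : forall i, U i -> V i -> Prop)
    (u : dsumI_mod U) :
  (forall i, P i 0 0) -> (forall i, exists v, P i (coor u i) v) ->
  exists v : dsumI_mod V, forall i, P i (coor u i) (coor v i).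
Proof.
move=> P0 hP; have [r _ hr] := coor_supp u.
have /(_ _)/cid hv : forall i : {classic I},
    exists v, P i (coor u i) v /\ (i \notin r -> v = 0).
  move=> i; have [ir|nr] := boolP (i \in r).
    by have [v hv] := hP i; exists v; split.
  by exists 0; rewrite hr //.
have h0 (i : {classic I}) : i \notin r -> sval (hv i) = 0 := (svalP (hv i)).2.
exists (@of_supp R I V (fun i => sval (hv i)) r h0) => i.
exact: (svalP (hv i)).1.
Qed.

Lemma dsumI_boundary X n (u : dsumI X (n + 1)) :
  (forall i, boundary (coor u i : X i (n + 1))) -> boundary u.
Proof.
move=> hb; have [|i|v hv] := @coor_choice (fun i => X i (n + 1))
    (fun i => X i n) (fun i x y => diff (X i) n y = x) u.
- by move=> i; apply: linear0.
- by have [y] := hb i; exists y.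
by exists v; apply: coor_ext => i; rewrite coor_diff hv.
Qed.

Lemma dsumI_acyclic X : (forall i, acyclic (X i)) -> acyclic (dsumI X).
Proof.
move=> aX n u du; apply: dsumI_boundary => i; apply: aX.
by rewrite -coor_diff du coor0.
Qed.

Lemma dsumI_quasi_iso X Y (f : forall i, chain_map (X i) (Y i)) :
  (forall i, quasi_iso (f i)) -> quasi_iso (dsumI_map f).
Proof.
move=> qf n; split=> [x dx [y ey]|y dy].
  apply: dsumI_boundary => i; have [fi _] := qf i n; apply: fi.
    by rewrite -coor_diff dx coor0.
  by exists (coor y i); rewrite -coor_diff ey coor_mapE.
have [i|i|u hu] := @coor_choice (fun i => Y i (n + 1))
    (fun i => (X i (n + 1)%R * Y i n)%type : lmodType R)
    (fun i y xz => diff (X i) (n + 1) xz.1 = 0 /\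
       y = f i (n + 1) xz.1 + diff (Y i) n xz.2) y.
- by rewrite /= !linear0 addr0.
- have [_ fs] := qf i n; have [|x [z [dx e]]] := fs (coor y i).
    by rewrite -coor_diff dy coor0.
  by exists (x, z).
pose p1 i := @fst (X i (n + 1)) (Y i n) : {linear _ -> _}.
pose p2 i := @snd (X i (n + 1)) (Y i n) : {linear _ -> _}.
exists (dsumI_map_lin p1 u), (dsumI_map_lin p2 u); split.
  by apply: coor_ext => i; rewrite coor_diff coor_map coor0; case: (hu i).
apply: coor_ext => i; rewrite coorD coor_mapE coor_diff !coor_map.
by case: (hu i).
Qed.

(** * Direct sums are coproducts in the derived category *)

(** Both maps become chain maps on a single trivial fibration W over the direct
sum, which is pulled back along each injection.  On each piece the two chain
maps agree up to an acyclic complex after a further refinement, and direct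
sums preserve quasi-isomorphisms and acyclicity. *)
Lemma dsumI_hom_ext X Z (h h' : dhom (dsumI X) Z) :
  (forall i, deq (dcomp h (dloc (dsumI_in X i)))
                 (dcomp h' (dloc (dsumI_in X i)))) -> deq h h'.
Proof.
move=> e.
have [V [t [f [tt et]]]] := roofP h; have [V' [t' [f' [tt' et']]]] := roofP h'.
pose W := pullback t t'.
pose tau := chain_comp t (pullback_fst t t').
have ttau : triv_fib tau.
  by apply: triv_fib_comp => //; apply: pullback_triv_fib.
pose g := chain_comp f (pullback_fst t t').
pose g' := chain_comp f' (pullback_snd t t').
have eg : deq (dcomp h (dloc tau)) (dloc g).
  by rewrite !deq_loc_comp deq_A et.
have eg' : deq (dcomp h' (dloc tau)) (dloc g').
  rewrite !deq_loc_comp -et' -deq_A; apply: deq_comp => //.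
  by rewrite -!deq_loc_comp; apply: dloc_ceq => n x; apply: pullbackE.
pose b i := pullback_snd (dsumI_in X i) tau.
pose tb i := pullback_fst (dsumI_in X i) tau.
have ttb i : triv_fib (tb i) by apply: pullback_triv_fib.
have /(_ _)/cid hV : forall i, exists v : {V : complex R &
    {a : chain_map V (pullback (dsumI_in X i) tau) | triv_fib a}},
    thru (chain_comp (chain_comp g (b i)) (sval (projT2 v)))
         (chain_comp (chain_comp g' (b i)) (sval (projT2 v))).
  move=> i.
  have sq : deq (dcomp (dloc tau) (dloc (b i)))
                (dcomp (dloc (dsumI_in X i)) (dloc (tb i))).
    rewrite -!deq_loc_comp; apply: dloc_ceq => n x.
    by rewrite /= -[LHS]/(tau n (b i n x)) -pullbackE.
  have : deq (dloc (chain_comp g (b i))) (dloc (chain_comp g' (b i))).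
    by rewrite !(deq_loc_comp _ (b i)) -eg -eg' -!deq_A sq !deq_A e.
  move=> /dloc_eq_thru[U [a [ta th]]].
  by exists (existT _ U (exist _ a ta)).
pose U i := projT1 (sval (hV i)).
pose a i : chain_map (U i) _ := sval (projT2 (sval (hV i))).
have ta i : triv_fib (a i) := svalP (projT2 (sval (hV i))).
pose c := dsumI_out (fun i => chain_comp (b i) (a i)).
have qtc : quasi_iso (chain_comp tau c).
  have qm : quasi_iso (dsumI_map (fun i => chain_comp (tb i) (a i))).
    by apply: dsumI_quasi_iso => i; apply: quasi_iso_comp;
      [case: (ttb i)|case: (ta i)].
  have ec :
      ceq (dsumI_map (fun i => chain_comp (tb i) (a i))) (chain_comp tau c).
    apply: dsumI_ext => i n x; rewrite dsumI_map_in.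
    have := dsumI_out_in (fun i => chain_comp (b i) (a i)) x.
    rewrite -/c => ecx.
    rewrite [RHS]/= ecx /= -[RHS]/(tau n (b i n (a i n x))) -pullbackE //.
  move=> n; have [mi ms] := qm n; split=> [x dx [y ey]|y dy].
    by apply: mi => //; exists y; rewrite ec.
  by have [x [y' [dx ->]]] := ms y dy; exists x, y'; rewrite -ec.
have thc : thru (chain_comp g c) (chain_comp g' c).
  have /(_ _)/cid hZ : forall i, exists z : {Z0 : complex R &
      (chain_map (U i) Z0 * chain_map Z0 Z)%type},
      acyclic (projT1 z) /\ forall n x,
      g n (b i n (a i n x)) - g' n (b i n (a i n x))
      = (projT2 z).2 n ((projT2 z).1 n x).
    move=> i; have [Z0 [u [v [aZ0 ez]]]] := svalP (hV i).
    by exists (existT _ Z0 (u, v)).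
  pose Z0 i := projT1 (sval (hZ i)).
  pose u i : chain_map (U i) (Z0 i) := (projT2 (sval (hZ i))).1.
  pose v i : chain_map (Z0 i) Z := (projT2 (sval (hZ i))).2.
  exists (dsumI Z0), (dsumI_map u), (dsumI_out v); split.
    by apply: dsumI_acyclic => i; case: (svalP (hZ i)).
  have := @dsumI_ext U Z (chain_add (chain_comp g c)
    (chain_opp (chain_comp g' c))) (chain_comp (dsumI_out v) (dsumI_map u)).
  move=> hext n x; have {hext} := hext _ n x.
  rewrite [X in X = _]/= scaleN1r; apply=> i {}n {}x.
  rewrite /= scaleN1r.
  have ecx := dsumI_out_in (fun i => chain_comp (b i) (a i)) x.
  have emx := dsumI_map_in u x.
  have eox := dsumI_out_in v (u i n x).
  rewrite -/c /= in ecx emx eox *; rewrite ecx emx eox.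
  exact: (svalP (hZ i)).2.
have epi : deq (dcomp (dloc c) (dcomp (dinv qtc) (dloc tau)))
               (dloc (chain_id W)).
  have [_ qtau] := ttau; apply: (deq_cancel_l qtau).
  by rewrite !deq_A -deq_loc_comp deq_invr deq_1m deq_m1.
have egg' : deq (dloc g) (dloc g').
  rewrite -(deq_m1 (dloc g)) -(deq_m1 (dloc g')) -epi.
  by rewrite !(deq_A _ (dloc c)) -!(deq_loc_comp _ c) (thru_deq thc).
by have [_ qtau] := ttau; apply: (deq_cancel_r qtau); rewrite eg eg' egg'.
Qed.

(** A family of roofs has as direct sum a roof, since direct sums preserve
quasi-isomorphisms. *)
Theorem dsumI_coproduct X :
  @is_coproduct (\D R) I X (dsumI X) (fun i => dloc (dsumI_in X i)).
Proof.
move=> Z w.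
have /(_ _)/cid hr : forall i, exists r : roof (X i) Z,
    deq (dcomp (w i) (dloc (roof_left r))) (dloc (roof_right r)).
  by move=> i; have [V [t [f [tt e]]]] := roofP (w i); exists (Roof f tt).
pose V i := roof_top (sval (hr i)).
pose t i := roof_left (sval (hr i)); pose f i := roof_right (sval (hr i)).
have qt : quasi_iso (dsumI_map t).
  by apply: dsumI_quasi_iso => i; have [] := roof_triv_fib (sval (hr i)).
pose h := dcomp (dloc (dsumI_out f)) (dinv qt).
have eh i : deq (dcomp h (dloc (dsumI_in X i))) (w i).
  have [_ qti] := roof_triv_fib (sval (hr i)).
  apply: (deq_cancel_r qti); rewrite (svalP (hr i)).
  have e : deq (dcomp (dinv qt) (dcomp (dloc (dsumI_in X i)) (dloc (t i))))
               (dloc (dsumI_in V i)).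
    apply: (deq_cancel_l qt); rewrite deq_A deq_invr deq_1m -!deq_loc_comp.
    apply: dloc_ceq => n x.
    exact: (esym (dsumI_map_in t x)).
  rewrite /h -!deq_A e -deq_loc_comp; apply: dloc_ceq => n x.
  exact: dsumI_out_in.
exists h; split=> // h' eh'; apply: dsumI_hom_ext => i.
exact: (deq_trans (eh' i) (deq_sym (eh i))).
Qed.

End DirectSumComplex.

(** * Maps out of a cone *)

Lemma cone_diffE (R : comPzRingType) (X Y : complex R) (f : chain_map X Y) n
    (a : X (n + 1)) (b : Y n) :
  diff (cone f) n (a, b) = (- diff X (n + 1) a, f (n + 1) a + diff Y n b).
Proof. by []. Qed.

Lemma cone_cycle (R : comPzRingType) (X Y : complex R) (f : chain_map X Y) n
    (a : X (n + 1)) (b : Y n) : diff (cone f) n (a, b) = 0 ->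
  diff X (n + 1) a = 0 /\ f (n + 1) a + diff Y n b = 0.
Proof.
move=> e; split; last exact: (congr1 snd e).
by apply: oppr_inj; rewrite oppr0; apply: (congr1 fst e).
Qed.

Section ConeDesc.
Variables (R : comPzRingType) (X Y Z : complex R) (f : chain_map X Y).
Variables (p : chain_map Y Z) (h : forall n, {linear X (n + 1) -> Z n}).
Hypothesis hp : forall n x,
  p (n + 1) (f (n + 1) x) = diff Z n (h n x) + h (n + 1) (diff X (n + 1) x).

Definition cone_desc_fun n (u : cone f n) : Z n := h n u.1 + p n u.2.
Fact cone_desc_linear n : linear (@cone_desc_fun n).
Proof.
by move=> a u v; rewrite /cone_desc_fun !linearP scalerDr addrACA.
Qed.
HB.instance Definition _ n := GRing.isLinear.Build R (cone f n) (Z n) *:%R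
  (@cone_desc_fun n) (@cone_desc_linear n).
Fact cone_desc_diff n (u : cone f n) :
  cone_desc_fun (diff (cone f) n u) = diff Z n (cone_desc_fun u).
Proof.
rewrite /cone_desc_fun /= linearN !linearD /= hp cmap_diff.
by rewrite addrA [- _ + _]addrC addrK.
Qed.
Definition cone_desc : chain_map (cone f) Z :=
  @ChainMap R (cone f) Z (fun n => @cone_desc_fun n : {linear _ -> _})
    cone_desc_diff.

End ConeDesc.

(** * Classes closed under direct sums, cones and quasi-isomorphisms *)

(** What localising subcategories and the complexes [ghost] have in common.
Telescopes, retracts and cellular constructions stay in such a class. *)
Record closed_class (R : comPzRingType) (Q : complex R -> Prop) : Prop :=
  ClosedClass {
  closed_dsumI : forall (I : small_index) (X : I -> complex R),
    (forall i, Q (X i)) -> Q (dsumI X);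
  closed_cone : forall X Y (f : chain_map X Y), Q X -> Q Y -> Q (cone f);
  closed_quasi_iso : forall X Y (f : chain_map X Y),
    quasi_iso f -> Q X -> Q Y }.

Lemma closed_acyclic (R : comPzRingType) (Q : complex R -> Prop) X :
  closed_class Q -> acyclic X -> Q X.
Proof.
move=> cQ aX.
pose E := dsumI (fun e : Empty_set => match e return complex R with end).
have QE : Q E by apply: (closed_dsumI cQ) => -[].
apply: (closed_quasi_iso cQ _ QE (f := zero_chain E X)) => n; split.
  by move=> x _ _; exists 0; apply: coor_ext => -[].
move=> y /aX[y' <-]; exists 0, y'.
by rewrite linear0 add0r; split=> //; apply: coor_ext => -[].
Qed.

Section Telescope.
Variables (R : comPzRingType) (F : nat -> complex R).
Variable j : forall i, chain_map (F i) (F i.+1).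

Definition tele_shift : chain_map (dsumI F) (dsumI F) :=
  dsumI_out (fun i => chain_comp (dsumI_in F i.+1) (j i)).

Lemma tele_shift_in i n x :
  tele_shift n (dsumI_in F i n x) = dsumI_in F i.+1 n (j i n x).
Proof. exact: dsumI_out_in. Qed.

Definition coor_at n i (u : dsumI F n) : F i n := coor u i.
Fact coor_at_linear n i : linear (@coor_at n i).
Proof. by []. Qed.
HB.instance Definition _ n i := GRing.isLinear.Build R (dsumI F n) (F i n) *:%R
  (@coor_at n i) (@coor_at_linear n i).

Lemma coor_tele0 n u : coor (tele_shift n u) 0%N = 0.
Proof.
apply: (@dsumI_linear_ext R nat (fun i => F i n) _
  (@coor_at n 0%N \o tele_shift n) \0) => i x.
change (coor (tele_shift n (dsumI_in F i n x)) 0%N = 0).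
by rewrite tele_shift_in coor_in0.
Qed.

Lemma coor_teleS n u i : coor (tele_shift n u) i.+1 = j i n (coor u i).
Proof.
apply: (@dsumI_linear_ext R nat (fun i => F i n) _
  (@coor_at n i.+1 \o tele_shift n) (j i n \o @coor_at n i)) => k x.
change (coor (tele_shift n (dsumI_in F k n x)) i.+1
  = j i n (coor (dsumI_in F k n x) i)); rewrite tele_shift_in.
have [<-|ki] := pselect (k = i); first by rewrite !coor_in.
rewrite !coor_in0 ?linear0 //; first by move=> ik; apply: ki.
by case=> ik; apply: ki.
Qed.

Definition tele : chain_map (dsumI F) (dsumI F) :=
  chain_add (chain_id _) (chain_opp tele_shift).

Lemma coor_tele n u i : coor (tele n u) i = coor u i - coor (tele_shift n u) i.
Proof.
change (coor (tele n u) i) with (coor (u + chain_opp tele_shift n u) i).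
by rewrite chain_oppE coorD coorN.
Qed.

Lemma teleE n u : tele n u = u - tele_shift n u.
Proof. by rewrite -chain_oppE. Qed.

End Telescope.

Lemma classic_nat_bound (r : seq {classic nat}) :
  exists M : nat, forall i : nat, (i : {classic nat}) \in r -> (i < M)%N.
Proof.
elim: r => [|k r [M hM]]; first by exists 0%N.
exists (maxn k.+1 M) => i; rewrite inE leq_max => /orP[/eqP ->|/hM ->].
  by rewrite leqnn.
by rewrite orbT.
Qed.

Lemma classic_nat_range (M : nat) :
  exists r : seq {classic nat},
    forall i : nat, (i <= M)%N -> (i : {classic nat}) \in r.
Proof.
elim: M => [|M [r hr]].
  exists [:: (0%N : {classic nat})] => i; rewrite leqn0 => /eqP ->.
  by rewrite inE eqxx.
exists ((M.+1 : {classic nat}) :: r) => i; rewrite inE leq_eqVlt.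
by case/orP => [/eqP ->|/hr ->]; rewrite ?eqxx ?orbT.
Qed.

(** X is the homotopy colimit of the F_i, that is, the cone of 1 - s on their
direct sum, where s is the shift along the maps j_i. *)
Section TelescopeLemma.
Variables (R : comPzRingType) (X : complex R) (F : nat -> complex R).
Variables (j : forall i, chain_map (F i) (F i.+1)).
Variables (p : forall i, chain_map (F i) X).
Hypothesis pj : forall i n x, p i.+1 n (j i n x) = p i n x.
Hypothesis p_surj : forall n (x : X (n + 1)), diff X (n + 1) x = 0 ->
  exists2 c, diff (F 0%N) (n + 1) c = 0 & boundary (x - p 0%N (n + 1) c).
Hypothesis j_kill : forall i n (y : F i (n + 1)), diff (F i) (n + 1) y = 0 ->
  boundary (p i (n + 1) y) -> boundary (j i (n + 1) y).

Lemma out_tele n u : dsumI_out p n (tele j n u) = 0.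
Proof.
have := @dsumI_ext R nat F X (chain_comp (dsumI_out p) (tele j))
  (zero_chain _ _) _ n u; apply=> i k x.
change (dsumI_out p k (tele j k (dsumI_in F i k x)) = 0).
by rewrite teleE linearB tele_shift_in !dsumI_out_in pj subrr.
Qed.

Fact tele_desc_hyp n u : dsumI_out p (n + 1) (tele j (n + 1) u) =
  diff X n (zero_linear (dsumI F (n + 1)) (X n) u) +
  zero_linear (dsumI F (n + 1 + 1)) (X (n + 1)) (diff (dsumI F) (n + 1) u).
Proof. by rewrite out_tele /= linear0 addr0. Qed.
Definition tele_desc : chain_map (cone (tele j)) X :=
  cone_desc tele_desc_hyp.

Lemma tele_descE n (a : dsumI F (n + 1)) (b : dsumI F n) :
  tele_desc n (a, b) = dsumI_out p n b.
Proof. by rewrite /= /cone_desc_fun /= add0r. Qed.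

(** A cycle (a, b) of the cone has (1 - s) a = - db.  Solving for a recursively
gives cochains alpha_i with d(alpha_i) = a_i, which beyond the supports of a
and b are cycles that die in X, so one step later are boundaries; cutting
alpha off there exhibits (a, b) as a boundary. *)
Lemma tele_quasi_iso : quasi_iso tele_desc.
Proof.
move=> n; split=> [[a b] dab [x ex]|x dx]; last first.
  have [c dc [x' ex']] := p_surj dx.
  exists (0, dsumI_in F 0%N (n + 1) c), x'; split.
    by rewrite cone_diffE -cmap_diff dc !linear0 ?oppr0 ?addr0.
  by rewrite tele_descE dsumI_out_in ex' [RHS]addrC subrK.
rewrite tele_descE in ex.
have [e1 e2'] := cone_cycle dab.
have e2 i : coor (tele j (n + 1 + 1) a) i = - diff (F i) (n + 1) (coor b i).
  apply/eqP; rewrite -addr_eq0; apply/eqP.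
  exact: (congr1 (fun u => coor u i) e2').
pose alpha := fix alpha i : F i (n + 1) :=
  match i with
  | 0%N => - coor b 0%N
  | i'.+1 => j i' (n + 1) (alpha i') - coor b i'.+1
  end.
have dalpha i : diff (F i) (n + 1) (alpha i) = coor a i.
  elim: i => [|i IH] /=.
    by rewrite linearN -e2 coor_tele coor_tele0 subr0.
  by rewrite linearB /= -cmap_diff IH -e2 coor_tele coor_teleS [LHS]addrC subrK.
have [M hM] : exists M : nat, forall i, (M <= i)%N ->
    coor a i = 0 /\ coor b i = 0.
  have [r _ hr] := coor_supp a; have [s _ hs] := coor_supp b.
  have [M1 h1] := classic_nat_bound r; have [M2 h2] := classic_nat_bound s.
  exists (maxn M1 M2) => i; rewrite geq_max => /andP[i1 i2]; split.
    by apply: hr; apply/negP => /h1; rewrite ltnNge i1.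
  by apply: hs; apply/negP => /h2; rewrite ltnNge i2.
have [r hr] := classic_nat_range M.
have he (i : {classic nat}) :
    i \notin r -> (if (i <= M)%N then alpha i else 0) = 0.
  by case: leqP => // /hr ->.
pose e : dsumI F (n + 1) := @of_supp R nat (fun i => F i (n + 1))
  (fun i => if (i <= M)%N then alpha i else 0) r he.
have coe i : coor e i = if (i <= M)%N then alpha i else 0 by [].
have te : tele j (n + 1) e
    = - b - dsumI_in F M.+1 (n + 1) (j M (n + 1) (alpha M)).
  apply: coor_ext => i; rewrite coor_tele coorD !coorN.
  have [->|iM] := pselect (i = M.+1).
    by rewrite coor_teleS coor_in !coe leqnn ltnn (hM M.+1 _).2 ?oppr0 //.
  rewrite (coor_in0 _ iM) subr0; case: i iM => [|i] iM.
    by rewrite coor_tele0 coe subr0.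
  rewrite coor_teleS !coe; case: (ltngtP i M) => [iM'|iM'|iM'].
  - by rewrite addrAC subrr add0r.
  - by rewrite linear0 subr0 (hM i.+1 _).2 ?oppr0 // leqW // ltnW.
  - by case: iM; rewrite iM'.
have da : diff (dsumI F) (n + 1) e = a.
  apply: coor_ext => i; rewrite coor_diff coe; case: leqP => [_|Mi].
    exact: dalpha.
  by rewrite linear0 (hM i _).1 // ltnW.
have dM : diff (F M) (n + 1) (alpha M) = 0 by rewrite dalpha (hM M _).1.
have [|beta hbeta] := j_kill dM.
  have /eqP := out_tele e; rewrite te linearB linearN dsumI_out_in.
  rewrite pj -opprD oppr_eq0 (addrC (dsumI_out _ _ _)) addr_eq0 => /eqP ->.
  by apply: boundaryN; exists x; rewrite ex.
exists (- e, - dsumI_in F M.+1 n beta).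
rewrite cone_diffE !linearN -cmap_diff hbeta te da opprK; congr pair.
by rewrite opprD !opprK addrK.
Qed.

Lemma telescope (Q : complex R -> Prop) :
  closed_class Q -> (forall i, Q (F i)) -> Q X.
Proof.
move=> cQ QF; apply: (closed_quasi_iso cQ tele_quasi_iso).
by apply: (closed_cone cQ); apply: (closed_dsumI cQ).
Qed.

End TelescopeLemma.

(** A retract of A is the homotopy colimit of A -> A -> ... along its
idempotent. *)
Lemma closed_retract (R : comPzRingType) (Q : complex R -> Prop)
    (A E : complex R) (i : chain_map E A) (r : chain_map A E) :
  closed_class Q -> (forall n x, r n (i n x) = x) -> Q A -> Q E.
Proof.
move=> cQ ri QA.
apply: (@telescope R E (fun=> A) (fun=> chain_comp i r) (fun=> r) _ _ _ Q cQ).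
- by move=> _ n x; apply: ri.
- move=> n x dx; exists (i (n + 1) x); first by rewrite -cmap_diff dx linear0.
  by rewrite ri subrr; apply: boundary0.
- move=> _ n y _ h; exact: (boundary_map i h).
- by [].
Qed.

(** * Ideals placed in one degree *)

Section Stalk.
Variable R : comPzRingType.
Implicit Types X Y : complex R.

Definition ideal := submodule (R^o : lmodType R).

Lemma idealM (N : ideal) a s : N s -> N (a * s).
Proof. exact: (@smZ R R^o N). Qed.

Lemma idealB (N : ideal) s t : N s -> N t -> N (s - t).
Proof. exact: (@smB R R^o N). Qed.

Lemma idealD (N : ideal) s t : N s -> N t -> N (s + t).
Proof. exact: (@smD R R^o N). Qed.

Fact principal0 (r : R) : exists t, 0 = r * t :> R.
Proof. by exists 0; rewrite mulr0. Qed.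
Fact principalL (r a : R) (u v : R^o) :
  (exists t, u = r * t :> R) -> (exists t, v = r * t :> R) ->
  exists t, a *: u + v = r * t :> R.
Proof.
by move=> [t ->] [t' ->]; exists (a * t + t'); rewrite mulrDr mulrCA.
Qed.
Definition principal (r : R) : ideal :=
  @Submodule R R^o (fun s => exists t, s = r * t :> R) (principal0 r)
    (@principalL r).

Definition unit_ideal : ideal :=
  @Submodule R R^o (fun=> True) I (fun _ _ _ _ _ => I).

Lemma principalP (r : R) : principal r r.
Proof. by exists 1; rewrite mulr1. Qed.

Definition const_complex : complex R :=
  @Complex R (fun=> (R^o : lmodType R)) (fun=> zero_linear _ _)
    (fun n x => erefl).

Section OneStalk.
Variables (N : ideal) (m : int).

Fact stalk0 (j : int) : N 0 /\ (j <> m + 1 -> 0 = 0 :> R).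
Proof. by split=> //; apply: sm0. Qed.
Fact stalkL (j : int) (a : R) (u v : const_complex j) :
  (N u /\ (j <> m + 1 -> u = 0)) -> (N v /\ (j <> m + 1 -> v = 0)) ->
  (N (a *: u + v) /\ (j <> m + 1 -> a *: u + v = 0)).
Proof.
move=> [Nu u0] [Nv v0]; split; first exact: smL.
by move=> jm; rewrite u0 // v0 // scaler0 addr0.
Qed.
Definition stalk_sub (j : int) : submodule (const_complex j) :=
  @Submodule R (const_complex j) (fun s => N s /\ (j <> m + 1 -> s = 0))
    (stalk0 j) (@stalkL j).
Fact stalk_sub_diff (j : int) (x : const_complex j) :
  stalk_sub j x -> stalk_sub (j + 1) (diff const_complex j x).
Proof. by move=> _; apply: sm0. Qed.

(** The ideal N in degree m + 1.  As a subcomplex of the constant complex R it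
has elements of R in every degree, which avoids case distinctions on the
degree in the types. *)
Definition stalk : complex R := subcomplex stalk_sub_diff.

Definition stalk_val (j : int) (u : stalk j) : R := sub_val u.
Definition stalk_in (s : R) (Ns : N s) : stalk (m + 1) :=
  @SubOf R (const_complex (m + 1)) (stalk_sub (m + 1)) s
    (conj Ns (fun h => False_ind _ (h erefl))).

Lemma stalk_valL j a (u v : stalk j) :
  stalk_val (a *: u + v) = a * stalk_val u + stalk_val v.
Proof. by []. Qed.
Lemma stalk_valB j (u v : stalk j) :
  stalk_val (u - v) = stalk_val u - stalk_val v.
Proof. by []. Qed.
Lemma stalk_valZ j a (u : stalk j) : stalk_val (a *: u) = a * stalk_val u.
Proof. by []. Qed.
Lemma stalk_inE s (Ns : N s) : stalk_val (stalk_in Ns) = s.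
Proof. by []. Qed.
Lemma stalk_ext j (u v : stalk j) : stalk_val u = stalk_val v -> u = v.
Proof. exact: (@sub_ext R (const_complex j) (stalk_sub j)). Qed.
Lemma stalk_mem j (u : stalk j) : N (stalk_val u).
Proof. by case: (sub_memP u). Qed.
Lemma stalk_out j (u : stalk j) : j <> m + 1 -> stalk_val u = 0.
Proof. by case: (sub_memP u). Qed.

Lemma stalk_diff j (u : stalk j) : diff stalk j u = 0.
Proof. exact: stalk_ext. Qed.

End OneStalk.

Arguments stalk_val : simpl never.

Section Mul.
Variables (N N' : ideal) (m : int) (a : R).
Hypothesis aN : forall s, N s -> N' (a * s).
Fact stalk_mul_mem j (u : stalk N m j) : stalk_sub N' m j (a * stalk_val u).
Proof.
split; first exact: aN (stalk_mem u).
by move=> /(stalk_out u) ->; rewrite mulr0.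
Qed.
Definition stalk_mul_fun j (u : stalk N m j) : stalk N' m j :=
  SubOf (stalk_mul_mem u).
Fact stalk_mul_linear j : linear (@stalk_mul_fun j).
Proof.
move=> b u v; apply: stalk_ext; rewrite stalk_valL.
by rewrite -[LHS]/(a * stalk_val _) stalk_valL mulrDr mulrCA.
Qed.
HB.instance Definition _ j := GRing.isLinear.Build R (stalk N m j)
  (stalk N' m j) *:%R (@stalk_mul_fun j) (@stalk_mul_linear j).
Fact stalk_mul_diff j (u : stalk N m j) :
  stalk_mul_fun (diff _ j u) = diff (stalk N' m) j (stalk_mul_fun u).
Proof.
by rewrite !stalk_diff; apply: stalk_ext; rewrite -[LHS]/(a * 0) mulr0.
Qed.
Definition stalk_mul : chain_map (stalk N m) (stalk N' m) :=
  @ChainMap R _ _ (fun j => @stalk_mul_fun j : {linear _ -> _}) stalk_mul_diff.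
Lemma stalk_mulE j u : stalk_val (stalk_mul j u) = a * stalk_val u.
Proof. by []. Qed.
End Mul.

Definition csingle (X : complex R) (n : int) (z : X n) (j : int) : X j :=
  @single int (fun j => X j : nmodType) n z j.

Lemma csingleE X n (z : X n) : csingle z n = z.
Proof. exact: (@singleE int (fun j => X j : nmodType)). Qed.
Lemma csingle0 X n (z : X n) j : j <> n -> csingle z j = 0.
Proof. exact: (@single0 int (fun j => X j : nmodType)). Qed.

Lemma csingle_diff X n (z : X n) j :
  diff X n z = 0 -> diff X j (csingle z j) = 0.
Proof.
move=> dz; have [->|jn] := pselect (j = n); first by rewrite csingleE.
by rewrite csingle0 // linear0.
Qed.

Section StalkMap.
Variables (N : ideal) (m : int) (X : complex R).

Section Scale.
Variables (j i : int) (x : X i).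
Definition stalk_scale_fun (u : stalk N m j) : X i := stalk_val u *: x.
Fact stalk_scale_linear : linear stalk_scale_fun.
Proof.
by move=> a u v; rewrite /stalk_scale_fun stalk_valL scalerDl scalerA.
Qed.
HB.instance Definition _ := GRing.isLinear.Build R (stalk N m j) (X i) *:%R
  stalk_scale_fun stalk_scale_linear.
Definition stalk_scale : {linear stalk N m j -> X i} := stalk_scale_fun.
Lemma stalk_scaleE u : stalk_scale u = stalk_val u *: x. Proof. by []. Qed.
End Scale.

Variables (z : X (m + 1)) (dz : diff X (m + 1) z = 0).
Fact stalk_map_diff j (u : stalk N m j) :
  stalk_scale (j + 1) (csingle z (j + 1)) (diff (stalk N m) j u)
  = diff X j (stalk_scale j (csingle z j) u).
Proof.
by rewrite stalk_diff linear0 stalk_scaleE linearZ /= csingle_diff // scaler0.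
Qed.
Definition stalk_map : chain_map (stalk N m) X :=
  @ChainMap R (stalk N m) X (fun j => stalk_scale j (csingle z j))
    stalk_map_diff.

Lemma stalk_mapE (u : stalk N m (m + 1)) :
  stalk_map (m + 1) u = stalk_val u *: z.
Proof. by rewrite /= /stalk_scale_fun csingleE. Qed.
Lemma stalk_mapE' j (u : stalk N m j) :
  stalk_map j u = stalk_val u *: csingle z j.
Proof. by []. Qed.
End StalkMap.

(** * Torsion cohomology *)

(** For absolutely flat R this says H(X) = N H(X); it is stated with r instead
of an idempotent so that factors 1 - r can be multiplied. *)
Definition torsion (N : ideal) (X : complex R) :=
  forall n (x : X (n + 1)), diff X (n + 1) x = 0 ->
  exists2 r : R, N r & boundary (x - r *: x).

Lemma torsion_combine (V : lmodType R) (x : V) r r' :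
  x - r *: x - r' *: (x - r *: x) = x - (r + r' - r' * r) *: x.
Proof.
rewrite scalerBr scalerA scalerBl scalerDl !opprB opprD -!addrA.
by congr (_ + _); rewrite addrCA.
Qed.

Lemma torsion_translate (V : lmodType R) (u d : V) r :
  u - r *: u = (u + d) - r *: (u + d) - (d - r *: d).
Proof. by rewrite scalerDr (opprD (r *: u)) addrACA addrK. Qed.

Lemma torsion_twice (N : ideal) X n (x : X (n + 1)) r r' :
  N r -> N r' -> boundary (x - r *: x - r' *: (x - r *: x)) ->
  exists2 r : R, N r & boundary (x - r *: x).
Proof.
move=> Nr Nr' b; exists (r + r' - r' * r).
  by apply: idealB; [apply: idealD|apply: idealM].
by rewrite -torsion_combine.
Qed.

Lemma torsion_cone (N : ideal) X Y (f : chain_map X Y) :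
  torsion N X -> torsion N Y -> torsion N (cone f).
Proof.
move=> tX tY n [a b] dab; have [da _] := cone_cycle dab.
have [r Nr [a' ea']] := tX _ a da.
pose u : cone f (n + 1) := (a, b) - r *: ((a, b) : cone f (n + 1)).
pose w : cone f (n + 1) := u + diff (cone f) n (a', 0).
have w1 : w.1 = 0 by rewrite /w /u /= ea' subrr.
have dw : diff (cone f) (n + 1) w = 0.
  by rewrite /w linearD diffK /u linearB linearZZ dab scaler0 subr0 addr0.
have ew : w = (0, w.2) by rewrite -w1; case: (w).
have [_] : diff X (n + 1 + 1) 0 = 0 /\
    f (n + 1 + 1) 0 + diff Y (n + 1) w.2 = 0.
  by apply: cone_cycle; rewrite -ew.
rewrite linear0 add0r => dw2; have [r' Nr' [y ey]] := tY _ _ dw2.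
apply: (torsion_twice Nr Nr'); rewrite -/u.
rewrite (@torsion_translate (cone f (n + 1)) u (diff (cone f) n (a', 0))).
rewrite -/w.
apply: boundaryB; last first.
  by apply: boundaryB; [|apply: boundaryZ]; exists (a', 0).
exists (0, y); rewrite cone_diffE linear0 oppr0 linear0 add0r ey ew.
by congr pair; rewrite /= scaler0 subr0.
Qed.

Lemma torsion_dsumI (N : ideal) (I : small_index) (X : I -> complex R) :
  (forall i, torsion N (X i)) -> torsion N (dsumI X).
Proof.
move=> tX n x dx; have [s _ hs] := coor_supp x.
have dxi i : diff (X i) (n + 1) (coor x i) = 0 by rewrite -coor_diff dx coor0.
have [r Nr hr] : exists2 r : R, N r & forall i : {classic I}, i \in s ->
    boundary ((coor x i : X i (n + 1)) - r *: coor x i).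
  elim: (s) => [|i s' [r Nr hr]]; first by exists 0 => //; apply: sm0.
  have [r' Nr' hr'] := tX i n _ (dxi i).
  exists (r + r' - r' * r).
    by apply: idealB; [apply: idealD|apply: idealM].
  move=> k; rewrite inE => /orP[/eqP ->|/hr hk].
    have := boundaryB hr' (boundaryZ r hr').
    by rewrite torsion_combine (addrC r') (mulrC r).
  by have := boundaryB hk (boundaryZ r' hk); rewrite torsion_combine.
exists r => //; apply: dsumI_boundary => i; rewrite coorD coorN coorZ.
have [/hr //|ni] := boolP ((i : {classic I}) \in s).
by rewrite hs // scaler0 subrr; apply: boundary0.
Qed.

(** If s = s^2 x then x s acts as the identity on s. *)
Lemma torsion_stalk (N M : ideal) m :
  absolutely_flat R -> (forall s, M s -> N s) -> torsion N (stalk M m).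
Proof.
move=> af MN n u du; have [x ex] := af (stalk_val u).
exists (x * stalk_val u); first by apply: idealM; apply/MN/stalk_mem.
suff -> : u - (x * stalk_val u) *: u = 0 by apply: boundary0.
apply: stalk_ext; rewrite stalk_valB stalk_valZ.
by rewrite -mulrA -expr2 mulrC -ex subrr.
Qed.

End Stalk.

(** * Cellular approximation *)

Section Cells.
Variables (R : comPzRingType) (Q : complex R -> Prop) (N : ideal R).
Hypotheses (af : absolutely_flat R) (cQ : closed_class Q).
Hypothesis QN : forall (r : R) m, N r -> Q (stalk (principal r) m).
Variables (X : complex R) (tX : torsion N X).

Section Step.
Variables (F : complex R) (p : chain_map F X).

(** A cell kills r z, where z is a cycle of F that bounds x in X.  Cells with
z = 0 add the class of r x to the image in H(X). *)
Record cell_data (m : int) := CellData {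
  cell_z : F (m + 1); cell_x : X m; cell_r : R;
  cell_N : N cell_r;
  cell_dz : diff F (m + 1) cell_z = 0;
  cell_dx : p (m + 1) cell_z = diff X m cell_x }.
Definition cell := {m : int & cell_data m}.

Definition cell_stalk (c : cell) : complex R :=
  stalk (principal (cell_r (projT2 c))) (projT1 c).
Definition cells : complex R := dsumI cell_stalk.

Definition attach : chain_map cells F :=
  dsumI_out (fun c => stalk_map (principal (cell_r (projT2 c)))
    (cell_dz (projT2 c))).

Definition null_homotopy (n : int) : {linear cells (n + 1) -> X n} :=
  dsumI_desc (fun c : cell => stalk_scale (principal (cell_r (projT2 c)))
    (projT1 c) (n + 1) (csingle (cell_x (projT2 c)) n)).

Lemma cells_diff n (u : cells n) : diff cells n u = 0.
Proof.
by apply: coor_ext => c; rewrite coor_diff coor0 stalk_diff.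
Qed.

Fact attach_null n (u : cells (n + 1)) :
  p (n + 1) (attach (n + 1) u)
  = diff X n (null_homotopy n u) + null_homotopy (n + 1) (diff cells (n + 1) u).
Proof.
rewrite cells_diff linear0 addr0.
apply: (@dsumI_linear_ext R cell (fun c => cell_stalk c (n + 1)) _
  (p (n + 1) \o attach (n + 1)) (diff X n \o null_homotopy n)) => c s.
change (p (n + 1) (attach (n + 1) (dsumI_in cell_stalk c (n + 1) s))
  = diff X n (null_homotopy n (dsumI_inj (fun c => cell_stalk c (n + 1)) c s))).
rewrite /attach dsumI_out_in /null_homotopy dsumI_desc_inj.
case: c s => m [z x r Nr dz dx] s; rewrite (stalk_mapE' dz) /= /stalk_scale_fun.
rewrite !linearZ /=.
have [nm|nm] := pselect (n = m); last first.
  by rewrite !csingle0 ?linear0 // => /addIr.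
by subst n; rewrite !csingleE dx.
Qed.

Definition next := cone attach.
Definition next_map : chain_map next X := cone_desc attach_null.
Definition next_in : chain_map F next := cone_in attach.

Lemma next_map_in n y : next_map n (next_in n y) = p n y.
Proof. by rewrite /= /cone_desc_fun /= linear0 add0r. Qed.

Lemma next_Q : Q F -> Q next.
Proof.
move=> QF; apply: (closed_cone cQ) => //; apply: (closed_dsumI cQ) => c.
exact: QN (cell_N _).
Qed.

Lemma next_torsion : torsion N F -> torsion N next.
Proof.
move=> tF; apply: torsion_cone => //; apply: torsion_dsumI => c.
apply: torsion_stalk => // s [t ->]; rewrite mulrC.
exact/idealM/(cell_N (projT2 c)).
Qed.

Lemma next_surj n (x : X (n + 1)) : diff X (n + 1) x = 0 ->
  exists2 c, diff next (n + 1) c = 0 & boundary (x - next_map (n + 1) c).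
Proof.
move=> dx; have [r Nr hr] := tX dx.
have e1 : diff F (n + 1 + 1) 0 = 0 by rewrite linear0.
have e2 : p (n + 1 + 1) 0 = diff X (n + 1) x by rewrite linear0 dx.
pose c : cell := existT _ (n + 1) (CellData Nr e1 e2).
pose d : cells (n + 1 + 1) :=
  dsumI_in cell_stalk c (n + 1 + 1) (stalk_in (n + 1) (principalP r)).
exists (d, 0).
  rewrite cone_diffE cells_diff !linear0 ?oppr0 addr0 /d /attach dsumI_out_in.
  by rewrite stalk_mapE scaler0.
rewrite /= /cone_desc_fun /= linear0 addr0.
have := dsumI_desc_inj (fun c : cell => stalk_scale
   (principal (cell_r (projT2 c))) (projT1 c) (n + 1 + 1)
   (csingle (cell_x (projT2 c)) (n + 1)))
   (stalk_in (n + 1) (principalP r) : cell_stalk c (n + 1 + 1)).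
by rewrite /= => ->; rewrite /stalk_scale_fun csingleE.
Qed.

Lemma next_kill n (y : F (n + 1)) : torsion N F -> diff F (n + 1) y = 0 ->
  boundary (p (n + 1) y) -> boundary (next_in (n + 1) y).
Proof.
move=> tF dy [x ex]; have [r Nr [b eb]] := tF _ _ dy.
pose c : cell := existT _ n (CellData Nr dy (esym ex)).
pose d : cells (n + 1) :=
  dsumI_in cell_stalk c (n + 1) (stalk_in n (principalP r)).
exists (d, b).
rewrite cone_diffE cells_diff oppr0 /d /attach dsumI_out_in stalk_mapE.
rewrite stalk_inE eb; apply: (congr1 (pair 0)).
by rewrite [LHS]addrC; apply: subrK.
Qed.

End Step.

Record stage := Stage {
  stage_obj : complex R; stage_map : chain_map stage_obj X;
  stage_Q : Q stage_obj; stage_torsion : torsion N stage_obj }.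

Definition next_stage (F : stage) : stage :=
  Stage (next_map (stage_map F)) (next_Q (stage_map F) (stage_Q F))
    (@next_torsion _ (stage_map F) (@stage_torsion F)).

Lemma zero_torsion : torsion N (zero_complex R).
Proof.
by move=> n x /acyclic_zero h; exists 0; [apply: sm0|apply: acyclic_zero].
Qed.

Definition first_stage : stage :=
  Stage (zero_chain (zero_complex R) X) (closed_acyclic cQ (@acyclic_zero R))
    zero_torsion.

(** X is the homotopy colimit of the stages: each of them surjects on H(X), and
kills the kernel of the stage before because N-torsion lets each class be
replaced by a multiple by an element of N. *)
Theorem cellular : Q X.
Proof.
pose F i := iter i next_stage (next_stage first_stage).
apply: (@telescope R X (fun i => stage_obj (F i))
  (fun i => next_in (stage_map (F i))) (fun i => stage_map (F i)) _ _ _ Q cQ).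
- by move=> i n x; apply: next_map_in.
- by move=> n x dx; apply: next_surj.
- move=> i n y dy; apply: next_kill => //; exact: stage_torsion.
- by move=> i; apply: stage_Q.
Qed.

End Cells.

(** * More on morphisms of the derived category *)

Section MoreWords.
Variable R : comPzRingType.
Implicit Types X Y Z : complex R.

Lemma quasi_iso_is_iso X Y (f : chain_map X Y) :
  quasi_iso f -> is_iso (dloc f : @hom (\D R) X Y).
Proof.
move=> qf; exists (dinv qf : @hom (\D R) Y X).
by split; [apply: deq_invl|apply: deq_invr].
Qed.

Lemma quasi_iso_inv_is_iso X Y (f : chain_map X Y) (qf : quasi_iso f) :
  is_iso (dinv qf : @hom (\D R) Y X).
Proof.
exists (dloc f : @hom (\D R) X Y).
by split; [apply: deq_invr|apply: deq_invl].
Qed.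

Lemma induces0 n X Y (w : dhom X Y) : induces w (0 : X (n + 1)) (0 : Y (n + 1)).
Proof.
have [y h] := induces_total w (linear0 (diff X (n + 1))).
have := induces_lin (-1) h h.
by rewrite !scaleN1r oppr0 add0r addNr.
Qed.

Lemma induces_boundary n X Y (w : dhom X Y) (x : X (n + 1)) y :
  induces w x y -> boundary x -> boundary y.
Proof.
move=> h bx; rewrite -[y]subr0.
by apply: (induces_uniq h (induces0 n w)); rewrite subr0.
Qed.

Lemma induces_torsion n X Y (w : dhom X Y) (x : X (n + 1)) y r :
  induces w x y -> induces w (x - r *: x) (y - r *: y).
Proof.
move=> h; have := induces_lin (- r) h h.
by rewrite !scaleNr [- _ + x]addrC [- _ + y]addrC.
Qed.

Lemma zero_induces n X Y (x : X (n + 1)) y :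
  induces (dloc (zero_chain X Y)) x y -> boundary y.
Proof.
move=> h; have h0 := induces_loc (zero_chain X Y) (induces_cyclel h).
have := induces_uniq h h0; rewrite subrr subr0; apply; exact: boundary0.
Qed.

Lemma zero_thru_boundary n X Y (f : chain_map X Y) (x : X (n + 1)) :
  deq (dloc f) (dloc (zero_chain X Y)) -> diff X (n + 1) x = 0 ->
  boundary (f (n + 1) x).
Proof.
by move=> e dx; apply: (zero_induces (induces_deq e (induces_loc f dx))).
Qed.

Lemma scale_natural a X Y (w : dhom X Y) :
  deq (dcomp w (dloc (chain_scale a (chain_id X))))
      (dcomp (dloc (chain_scale a (chain_id Y))) w).
Proof.
elim: w => [{}X {}Y f|{}X {}Y s qs|{}X {}Y Z g IHg f IHf].
- by rewrite -!deq_loc_comp; apply: dloc_ceq => n x /=; rewrite linearZ.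
- apply: (deq_cancel_l qs); apply: (deq_cancel_r qs).
  rewrite !deq_A deq_invr deq_1m -!deq_A deq_invl deq_m1 -!deq_loc_comp.
  by apply: dloc_ceq => n x /=; rewrite linearZ.
- by rewrite -deq_A IHf !deq_A IHg.
Qed.

(** Exactness of Hom(X, -) at a cone.  Pulling the projection of the cone back to
the acyclic complex Z gives an extension of Z by Y2, in which X and Y2 can be
compared by the Ore condition. *)
Lemma cone_lift X Y1 Y2 (u : chain_map Y1 Y2) (f : chain_map X (cone u)) :
  thru (chain_comp (cone_out u) f) (zero_chain X (shift Y1)) ->
  exists V (t : chain_map V X) (w : chain_map V Y2),
    triv_fib t /\ thru (chain_comp f t) (chain_comp (cone_in u) w).
Proof.
move=> [Z [a [b [aZ eab]]]].
(* Cycles of E' are corrected by elements over Z until they come from Y2. *)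
pose E' := pullback b (cone_out u).
have hk k (y : Y2 k) : b k (zero_chain Y2 Z k y) = cone_out u k (cone_in u k y).
  by rewrite /= linear0.
pose kap := pullback_lift hk.
have qk : quasi_iso kap.
  have lift1 k (z' : Z k) : b k z' = cone_out u k ((b k z', 0) : cone u k).
    by [].
  move=> k; split=> [y dy [w ew]|w dw].
    have ew1 : diff Z k (pullback_fst b (cone_out u) k w) = 0.
      by rewrite -cmap_diff ew.
    have ew2 : diff (cone u) k (pullback_snd b (cone_out u) k w) = (0, y).
      by rewrite -cmap_diff ew.
    elim/int_succ_ind: k y dy w ew ew1 ew2 => k y dy w ew ew1 ew2.
    have [z' ez'] := aZ k _ ew1.
    pose c := pullback_snd b (cone_out u) (k + 1) w
      - diff (cone u) k ((b k z', 0) : cone u k).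
    have c1 : c.1 = 0.
      have -> : c.1 = cone_out u (k + 1) c by [].
      by rewrite /c linearB -pullbackE -ez' !cmap_diff; apply: subrr.
    exists c.2.
    have dc : diff (cone u) (k + 1) c = (0, y).
      by rewrite /c linearB diffK subr0 ew2.
    have ec : c = (0, c.2) by rewrite -c1; case: (c).
    rewrite ec cone_diffE !linear0 add0r in dc.
    by have := congr1 snd dc.
  have dw1 : diff Z (k + 1) (pullback_fst b (cone_out u) (k + 1) w) = 0.
    by rewrite -cmap_diff dw linear0.
  have dw2 : diff (cone u) (k + 1) (pullback_snd b (cone_out u) (k + 1) w) = 0.
    by rewrite -cmap_diff dw linear0.
  have [z' ez'] := aZ k _ dw1.
  pose w' : pullback b (cone_out u) k := pullback_elt (lift1 k z').
  pose c := pullback_snd b (cone_out u) (k + 1) w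
      - diff (cone u) k ((b k z', 0) : cone u k).
  have c1 : c.1 = 0.
    have -> : c.1 = cone_out u (k + 1) c by [].
    by rewrite /c linearB -pullbackE -ez' !cmap_diff; apply: subrr.
  have ec : c = (0, c.2) by rewrite -c1; case: (c).
  have dc : diff (cone u) (k + 1) c = 0 by rewrite /c linearB diffK subr0.
  exists c.2, w'; split.
    rewrite ec cone_diffE !linear0 add0r in dc.
    by have := congr1 snd dc.
  apply: pullback_ext.
    by rewrite -ez' linearD cmap_diff [RHS]add0r.
  rewrite linearD cmap_diff.
  have -> : pullback_snd b (cone_out u) (k + 1) (kap (k + 1) c.2) = c.
    by rewrite [in RHS]ec.
  by rewrite /c /= subrK.
have hl k (y : X k) : b k (a k y) = cone_out u k (f k y).
  by rewrite -eab subr0.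
pose l : chain_map X E' := pullback_lift hl.
have [V [t [w [tt th]]]] := quasi_iso_lift l qk.
exists V, t, w; split=> //.
apply: thru_trans (thru_compl (pullback_snd b (cone_out u)) th) _.
exact: thru_ceq.
Qed.


(** The kernel of a surjection is its homotopy fibre; so a localising
subcategory that contains source and target contains the kernel. *)
Section KernelCone.
Variables (A B K : complex R) (q : chain_map A B) (i : chain_map K A).
Hypothesis qs : surjective q.
Hypothesis qi : forall n k, q n (i n k) = 0.
Hypothesis i_inj : forall n, injective (i n).
Hypothesis i_ker : forall n a, q n a = 0 -> exists k, i n k = a.

Definition ker_cone_fun n (k : shift K n) : cone q n := (i (n + 1) k, 0).
Fact ker_cone_linear n : linear (@ker_cone_fun n).
Proof.
move=> a u v; rewrite /ker_cone_fun linearP.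
by congr pair; rewrite /= scaler0 addr0.
Qed.
HB.instance Definition _ n := GRing.isLinear.Build R (shift K n) (cone q n) *:%R
  (@ker_cone_fun n) (@ker_cone_linear n).
Fact ker_cone_diff n (k : shift K n) :
  ker_cone_fun (diff (shift K) n k) = diff (cone q) n (ker_cone_fun k).
Proof.
by rewrite /ker_cone_fun cone_diffE qi linear0 addr0 /= linearN /= cmap_diff.
Qed.
Definition ker_cone : chain_map (shift K) (cone q) :=
  @ChainMap R _ _ (fun n => @ker_cone_fun n : {linear _ -> _}) ker_cone_diff.

Lemma ker_cone_quasi_iso : quasi_iso ker_cone.
Proof.
move=> n; split=> [k dk [[a b]]|[a b] /cone_cycle[da dab]].
  rewrite cone_diffE => -[ea eb].
  have [b' eb'] := qs b.
  have [|k' ek'] := @i_ker _ (a + diff A n b').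
    by rewrite linearD cmap_diff eb'.
  exists k'; apply: i_inj; rewrite /= linearN /= cmap_diff ek' linearD diffK.
  by rewrite addr0.
have [b' eb'] := qs b.
have [|k ek] := @i_ker _ (a + diff A (n + 1) b').
  by rewrite linearD cmap_diff eb'.
exists k, (b', 0); split.
  apply: i_inj; rewrite /= linearN /= cmap_diff ek linearD diffK da addr0.
  by rewrite oppr0 linear0.
rewrite cone_diffE linear0 addr0 eb' /= /ker_cone_fun ek.
congr pair; last by rewrite /= add0r.
by rewrite /= addrK.
Qed.
End KernelCone.

Lemma torsion_sub (V : lmodType R) (u v : V) r :
  u - v - r *: (u - v) = u - r *: u - (v - r *: v).
Proof. by rewrite scalerBr !opprD !opprK addrACA. Qed.

(** ** Localising subcategories *)

Section Localising.
Variable P : ob (\D R) -> Prop.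
Hypothesis locP : localising P.

Lemma loc_quasi_iso X Y (f : chain_map X Y) : quasi_iso f -> P X -> P Y.
Proof.
move=> qf; have [[_ iso _ _] _] := locP.
exact: (iso X Y (dloc f) (quasi_iso_is_iso qf)).
Qed.

Lemma loc_quasi_iso_inv X Y (f : chain_map X Y) : quasi_iso f -> P Y -> P X.
Proof.
move=> qf; have [[_ iso _ _] _] := locP.
exact: (iso Y X (dinv qf) (quasi_iso_inv_is_iso qf)).
Qed.

Lemma loc_shift X : P X <-> P (shift X).
Proof. by have [[_ _ sh _] _] := locP; apply: sh. Qed.

Lemma id_is_iso X : is_iso (dloc (chain_id X) : @hom (\D R) X X).
Proof. exact: quasi_iso_is_iso (quasi_iso_id X). Qed.

Lemma loc_cone X Y (f : chain_map X Y) : P X -> P Y -> P (cone f).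
Proof.
have [[_ _ _ tri] _] := locP.
apply: (tri X Y (cone f) (dloc f) (dloc (cone_in f)) (dloc (cone_out f))).
exists X, Y, f, (dloc (chain_id X)), (dloc (chain_id Y)), (dloc (chain_id _)).
split; try exact: id_is_iso.
by split; apply: (deq_trans (deq_m1 _)); apply: deq_sym;
  apply: (deq_trans (deq_sym (deq_loc_comp _ _))); apply: dloc_ceq.
Qed.

Lemma loc_dsumI (I : small_index) (X : I -> complex R) :
  (forall i, P (X i)) -> P (dsumI X).
Proof.
by have [_ cop] := locP; apply: cop (@dsumI_coproduct R I X).
Qed.

Lemma loc_closed : closed_class P.
Proof.
split; [exact: loc_dsumI|exact: loc_cone|exact: loc_quasi_iso].
Qed.

Lemma loc_fiber X Z W (g : chain_map X Z) (z : chain_map W Z) :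
  acyclic W -> surjective z -> P X -> P Z -> P (pullback g z).
Proof.
move=> aW sz PX PZ; pose q := chain_copair g (chain_opp z).
have PD : P (dsum X W) by apply: loc_quasi_iso PX; apply: dsum_inl_quasi_iso.
have qi k (u : pullback g z k) :
    q k (sub_incl (@pullback_diff _ _ _ _ g z) k u) = 0.
  case: u => [[x w] e]; rewrite /= scaleN1r; apply/eqP.
  by rewrite subr_eq0; apply/eqP.
have qk : quasi_iso (ker_cone qi).
  apply: ker_cone_quasi_iso.
  - move=> n y; have [w ew] := sz n (- y); exists (0, w).
    by rewrite /= linear0 add0r ew scaleN1r opprK.
  - move=> n u v; exact: sub_ext.
  - move=> n [x w] /eqP; rewrite /= scaleN1r subr_eq0 => /eqP e.
    by exists (pullback_elt e).
by apply/loc_shift; apply: loc_quasi_iso_inv qk (loc_cone _ PD PZ).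
Qed.

(** The object that receives the lift is the homotopy fibre of g, here a
pullback along an acyclic cover of Z. *)
Lemma loc_lift_kernel n X Z (g : dhom X Z) (x : X (n + 1)) z :
  P X -> P Z -> induces g x z -> boundary z ->
  exists E (f : chain_map E X) e,
    [/\ P E, diff E (n + 1) e = 0, f (n + 1) e = x &
        deq (dcomp g (dloc f)) (dloc (zero_chain E Z))].
Proof.
move=> PX PZ hxz bz; have [V [t [g0 [tt eg]]]] := roofP g.
have [v dv ev] := triv_fib_cycle tt (induces_cyclel hxz).
have [W [c [aW sc]]] := acyclic_cover Z.
have [z' ez'] : boundary (g0 (n + 1) v).
  have h1 := induces_loc t dv; rewrite ev in h1.
  have := induces_deq eg (induces_comp h1 hxz).
  move=> /(induces_uniq (induces_loc g0 dv)) h2.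
  rewrite -[g0 _ _](subrK z); apply: boundaryD => //; apply: h2.
  by rewrite subrr; apply: boundary0.
have [w ew] := sc n z'.
have e : g0 (n + 1) v = c (n + 1) (diff W n w) by rewrite cmap_diff ew.
exists (pullback g0 c), (chain_comp t (pullback_fst g0 c)), (pullback_elt e).
split.
- by apply: loc_fiber => //; apply: loc_quasi_iso_inv tt.2 PX.
- apply: pullback_ext; rewrite cmap_diff linear0 //= ?dv //.
  exact: diffK.
- by rewrite /= ev.
rewrite deq_loc_comp deq_A eg -deq_loc_comp; apply: thru_deq.
exists W, (pullback_snd g0 c), c; split=> // k u.
by rewrite subr0; apply: pullbackE.
Qed.

End Localising.
End MoreWords.

(** * Smashing subcategories *)

Section Smashing.
Variables (R : comPzRingType) (P : ob (\D R) -> Prop).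
Hypothesis locP : localising P.
Variable G : functor (\D R) (full_subcategory P).
Variable adjG : adjunction (inclusion P) G.
Hypothesis presG : preserves_coproducts G.
Implicit Types X Y Z : complex R.

Definition core (Y : complex R) : complex R := proj1_sig (G Y).

Lemma coreP Y : P (core Y).
Proof. exact: proj2_sig (G Y). Qed.

Definition counit (Y : complex R) : dhom (core Y) Y := adj_inv adjG (idm (G Y)).

Lemma counit_lift X Y (f : dhom X Y) : P X ->
  exists g : dhom X (core Y), deq (dcomp (counit Y) g) f.
Proof.
move=> pX; pose X' : ob (full_subcategory P) := exist P X pX.
pose g := adj adjG (f : hom (inclusion P X') Y).
exists (g : dhom X (core Y)).
have h := @adj_natl _ _ _ _ adjG X' (G Y) Y (counit Y) g.
have h1 : (adj adjG (counit Y) \circ g : hom X' (G Y)) =~ g.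
  apply: eqh_trans (cmp1m g); apply: eqh_cmp; last exact: eqh_refl.
  exact: (adj_invK adjG).
have h2 := adj_inv_eqh adjG (eqh_trans h h1).
have h3 := adjK adjG (f : hom (inclusion P X') Y).
exact: (deq_trans (deq_sym (adjK adjG _)) (deq_trans h2 h3)).
Qed.

Lemma counit_inj X Y (g g' : dhom X (core Y)) : P X ->
  deq (dcomp (counit Y) g) (dcomp (counit Y) g') -> deq g g'.
Proof.
move=> pX e; pose X' : ob (full_subcategory P) := exist P X pX.
have key (k : @hom (full_subcategory P) X' (G Y)) :
    adj adjG ((counit Y : hom (inclusion P (G Y)) Y) \circ
      fmap (inclusion P) k) =~ k.
  apply: eqh_trans (adj_natl adjG _ _) _.
  apply: eqh_trans (cmp1m k); apply: eqh_cmp; last exact: eqh_refl.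
  exact: (adj_invK adjG).
have h := @adj_eqh _ _ _ _ adjG X' Y
  (dcomp (counit Y) g) (dcomp (counit Y) g') e.
exact: (deq_trans (deq_sym (key g)) (deq_trans h (key g'))).
Qed.

Section Torsion.
Variable N : ideal R.

(** Equivalent to N-torsion cohomology of [core Y], see [torsion_ghost] and
[ghost_torsion].  In this form closure under cones follows from [cone_lift]
alone, without exactness of [core]. *)
Definition ghost (Y : complex R) :=
  forall X, P X -> forall (f : chain_map X Y) n (x : X (n + 1)),
  diff X (n + 1) x = 0 ->
  exists (r : R) (E : complex R) (g : chain_map E X) (e : E (n + 1)),
    [/\ N r, P E, diff E (n + 1) e = 0,
        boundary (g (n + 1) e - (x - r *: x)) &
        thru (chain_comp f g) (zero_chain E Y)].

(** A map from an object of P factors through [core Y], where x dies up to a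
multiple by r; [loc_lift_kernel] realises this by an object of P. *)
Lemma torsion_ghost Y : torsion N (core Y) -> ghost Y.
Proof.
move=> tY X PX f n x dx; have [g eg] := counit_lift (dloc f) PX.
have [y hy] := induces_total g dx.
have [r Nr br] := tY _ _ (induces_cycler hy).
have [E [h [e [PE de ee eh]]]] :=
  loc_lift_kernel locP PX (coreP Y) (induces_torsion r hy) br.
have : deq (dloc (chain_comp f h)) (dloc (zero_chain E Y)).
  by rewrite deq_loc_comp -eg -deq_A eh zero_compl.
move=> /dloc_eq_thru[V [t [tt th]]].
have [v dv ev] := triv_fib_cycle tt de.
exists r, V, (chain_comp h t), v; split=> //.
- exact: (loc_quasi_iso_inv locP tt.2 PE).
- by rewrite /= ev ee subrr; apply: boundary0.
Qed.

(** Apply the definition to the counit, which detects zero maps from P. *)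
Lemma ghost_torsion Y : ghost Y -> torsion N (core Y).
Proof.
move=> gY n a da; have [A [t [p [tt ep]]]] := roofP (counit Y).
have PA : P A := loc_quasi_iso_inv locP tt.2 (coreP Y).
have [a' da' ea'] := triv_fib_cycle tt da.
have [r [E [g [e [Nr PE de be th]]]]] := gY A PA p n a' da'.
exists r => //.
have tg0 : deq (dloc (chain_comp t g)) (dloc (zero_chain E (core Y))).
  apply: counit_inj => //.
  rewrite deq_loc_comp deq_A ep -deq_loc_comp zero_compl; exact: thru_deq.
have b1 := zero_thru_boundary tg0 de.
have b2 := boundary_map t be.
have := boundaryB b1 b2; rewrite [X in boundary (X - _)]/= linearB subKr.
by rewrite linearB linearZ /= ea'.
Qed.

Lemma ghost_quasi_iso Y Y' (s : chain_map Y Y') :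
  quasi_iso s -> ghost Y -> ghost Y'.
Proof.
move=> qs gY X PX f n x dx.
have [V [t [g [tt th]]]] := quasi_iso_lift f qs.
have PV : P V := loc_quasi_iso_inv locP tt.2 PX.
have [v dv ev] := triv_fib_cycle tt dx.
have [r [E [h [e [Nr PE de be th']]]]] := gY V PV g n v dv.
exists r, E, (chain_comp t h), e; split=> //.
  by have := boundary_map t be; rewrite !linearB linearZ /= ev.
apply: thru_trans (thru_compr h th) _.
apply: thru_trans (thru_compl s th') _.
by apply: thru_ceq => k u /=; rewrite linear0.
Qed.

Lemma ghost_shift Y : ghost Y -> ghost (shift Y).
Proof.
move=> gY X PX f n x dx.
have PU : P (unshift X).
  apply/(loc_shift locP); apply: (loc_quasi_iso_inv locP) PX.
  exact: (shift_unshift_triv_fib X).2.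
pose x' := unshift_inv X (n + 1) x.
have dx' : diff (unshift X) (n + 1 + 1) x' = 0.
  by rewrite /= unshift_diffE /x' unshift_invK dx oppr0 linear0.
have [r [E [g [e [Nr PE de be [Z [u [v [aZ euv]]]]]]]]] :=
  gY _ PU (unshift_map f) _ _ dx'.
exists r, (shift E), (chain_comp (shift_unshift X) (shift_chain g)), e.
split=> //.
- by have [h _] := loc_shift locP E; apply: h.
- by rewrite /= de oppr0.
- have [y ey] := be; exists (- unshift_val X n y).
  have h : diff (unshift X) (n + 1) y
      = unshift_inv X (n + 1) (- diff X n (unshift_val X n y)).
    exact: unshift_diffE.
  have := congr1 (unshift_val X (n + 1)) ey.
  rewrite h unshift_invK linearN => ->.
  by rewrite !linearB linearZ /= /x' unshift_invK.
exists (shift Z), (shift_chain u), (shift_chain v); split.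
  move=> k z /= dz; have [|y ey] := aZ _ z.
    by apply: oppr_inj; rewrite oppr0.
  by exists (- y); rewrite /= linearN opprK.
by move=> k y; rewrite /= -euv /= unshift_mapE.
Qed.

(** First kill the component in Y1[1]; what remains lifts to Y2 and is killed
there.  The two multipliers combine as in (1 - r2) (1 - r1). *)
Lemma ghost_cone Y1 Y2 (u : chain_map Y1 Y2) :
  ghost Y1 -> ghost Y2 -> ghost (cone u).
Proof.
move=> /ghost_shift g1 g2 X PX f n x dx.
have [r1 [E1 [h1 [e1 [Nr1 PE1 de1 be1 th1]]]]] :=
  g1 X PX (chain_comp (cone_out u) f) n x dx.
have [V [t [w [tt th]]]] := @cone_lift _ _ _ _ u (chain_comp f h1) th1.
have PV : P V := loc_quasi_iso_inv locP tt.2 PE1.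
have [v dv ev] := triv_fib_cycle tt de1.
have [r2 [E2 [h2 [e2 [Nr2 PE2 de2 be2 th2]]]]] := g2 V PV w n v dv.
exists (r1 + r2 - r2 * r1), E2, (chain_comp h1 (chain_comp t h2)), e2.
split=> //.
- by apply: idealB; [apply: idealD|apply: idealM].
- rewrite -torsion_combine.
  have b2 := boundary_map h1 (boundary_map t be2).
  have b1 := boundaryB be1 (boundaryZ r2 be1).
  have eb2 : h1 (n + 1) (t (n + 1) (h2 (n + 1) e2 - (v - r2 *: v)))
      = h1 (n + 1) (t (n + 1) (h2 (n + 1) e2))
        - (h1 (n + 1) e1 - r2 *: h1 (n + 1) e1).
    by rewrite !linearB !linearZZ ev.
  have := boundaryD b2 b1.
  by rewrite eb2 (torsion_sub (h1 _ _)) subrKA.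
apply: thru_trans (thru_compr h2 th) _.
apply: thru_trans (thru_compl (cone_in u) th2) _.
by apply: thru_ceq => k y /=; rewrite linear0.
Qed.

(** Both complexes are coproducts in P of the coreflections of the summands,
the left one because the coreflection preserves coproducts. *)
Lemma core_dsumI (I : small_index) (Y : I -> complex R) :
  exists (l : dhom (core (dsumI Y)) (dsumI (fun i => core (Y i))))
         (k : dhom (dsumI (fun i => core (Y i))) (core (dsumI Y))),
    deq (dcomp k l) (dloc (chain_id _)).
Proof.
have PB : P (dsumI (fun i => core (Y i))).
  by apply: loc_dsumI => // i; apply: coreP.
have cop := presG (@dsumI_coproduct R I Y).
pose inG i : dhom (core (Y i)) (core (dsumI Y)) :=
  fmap G (dloc (dsumI_in Y i) : @hom (\D R) (Y i) (dsumI Y)).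
have [l [hl _]] := cop (exist P _ PB)
  (fun i => dloc (dsumI_in (fun i => core (Y i)) i)).
have [k [hk _]] := @dsumI_coproduct R I (fun i => core (Y i))
  (core (dsumI Y)) inG.
exists l, k.
have [h [_ uh]] := cop (G (dsumI Y)) inG.
have e1 := uh (idm _) (fun i => cmp1m _).
apply: deq_trans (deq_sym e1).
apply: (uh (k \circ l : @hom (full_subcategory P) _ _)) => i.
apply: (deq_trans (deq_sym (deq_A _ _ _))).
apply: (deq_trans _ (hk i)); apply: deq_comp => //; exact: (hl i).
Qed.

Lemma ghost_dsumI (I : small_index) (Y : I -> complex R) :
  (forall i, ghost (Y i)) -> ghost (dsumI Y).
Proof.
move=> gY; apply: torsion_ghost.
have tB : torsion N (dsumI (fun i => core (Y i))).
  by apply: torsion_dsumI => i; apply: ghost_torsion.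
have [l [k kl]] := core_dsumI Y => n y dy.
have [b hb] := induces_total l dy; have [r Nr br] := tB _ _ (induces_cycler hb).
have [y' hy'] := induces_total k (induces_cycler hb).
exists r => //; have h1 := induces_deq kl (induces_comp hb hy').
have h2 : induces (dcomp k l) (y - r *: y) (y' - r *: y').
  exact: induces_torsion (induces_comp hb hy').
have b3 := induces_boundary (induces_torsion r hy') br.
have b4 := induces_uniq (induces_deq kl h2)
  (induces_loc (chain_id _) (induces_cyclel h2)).
have := b4; rewrite subrr => /(_ (boundary0 _ _)) /= b5.
have := boundaryB b3 b5; by rewrite subKr.
Qed.

(** A multiple r' of r acts as the identity on rR, so 1 - r' kills the counit at
rR, hence kills [core] of it by uniqueness of factorisations. *)
Lemma ghost_stalk (r : R) m : absolutely_flat R -> N r ->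
  ghost (stalk (principal r) m).
Proof.
move=> af Nr; apply: torsion_ghost => n a da; have [x ex] := af r.
set M := stalk _ _; pose r' := x * r.
exists r'; first exact: idealM.
suff e : deq (dloc (chain_scale (1 - r') (chain_id (core M))))
             (dloc (zero_chain (core M) (core M))).
  by have := zero_thru_boundary e da; rewrite /= scalerBl scale1r.
apply: counit_inj; first exact: coreP.
rewrite scale_natural zero_compl.
rewrite -(zero_compr M (counit M)); apply: deq_comp => //.
apply: dloc_ceq => k u /=; apply: stalk_ext.
have [t et] := stalk_mem u.
rewrite stalk_valZ et mulrBl mul1r /r' -mulrA (mulrA r r) -expr2 mulrCA.
by rewrite mulrA -ex subrr.
Qed.

Lemma ghost_closed : closed_class ghost.
Proof.
split; [exact: ghost_dsumI|exact: ghost_cone|exact: ghost_quasi_iso].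
Qed.

Lemma ghost_stalk_ideal m : absolutely_flat R -> ghost (stalk N m).
Proof.
move=> af; apply: (cellular af ghost_closed (N := N)).
  by move=> r k Nr; apply: ghost_stalk.
exact: torsion_stalk.
Qed.

End Torsion.
End Smashing.

(** * The ideal of a closed class *)

Section StalkIdeal.
Variable R : comPzRingType.
Hypothesis af : absolutely_flat R.

(** If r = r^2 x then e = r x. *)
Lemma idempotent_generator (r : R) :
  exists2 e : R, principal r e & forall s, principal r s -> e * s = s.
Proof.
have [x ex] := af r; exists (r * x); first by exists x.
by move=> _ [t ->]; rewrite mulrCA mulrA -mulrA mulrCA [X in _ = X * _]ex
  expr2 !mulrA; congr (_ * _); rewrite mulrAC.
Qed.

Lemma closed_stalk_principal (Q : complex R -> Prop) (A : complex R) (c : R) m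
    (i : chain_map (stalk (principal c) m) A)
    (p : chain_map A (stalk (principal c) m)) :
  closed_class Q ->
  (forall u : stalk (principal c) m (m + 1),
    stalk_val (p (m + 1) (i (m + 1) u)) = stalk_val u) ->
  Q A -> Q (stalk (principal c) m).
Proof.
move=> cQ pi; apply: (closed_retract cQ (i := i) (r := p)) => n u.
apply: stalk_ext; have [nm|nm] := pselect (n = m + 1); first by subst n.
by rewrite !stalk_out.
Qed.

Section Closed.
Variables (Q : complex R -> Prop).
Hypothesis cQ : closed_class Q.

Definition stalk_in_class (r : R) := forall m, Q (stalk (principal r) m).

Lemma stalk_in_class_mul (r t : R) :
  stalk_in_class r -> stalk_in_class (t * r).
Proof.
move=> Jr m; have [e [x ex] he] := idempotent_generator (t * r).
have h1 s : principal (t * r) s -> principal r (1 * s).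
  by move=> [y ->]; exists (t * y); rewrite mul1r -mulrA mulrCA.
have h2 s : principal r s -> principal (t * r) (e * s).
  by move=> _; exists (x * s); rewrite mulrA ex.
apply: (closed_stalk_principal (i := stalk_mul m h1) (p := stalk_mul m h2) cQ).
  by move=> u; rewrite !stalk_mulE mul1r he //; apply: stalk_mem.
exact: Jr.
Qed.

(** With idempotents e and e' for r and r', and g for r + r', the element
s = g s of (r + r')R goes to the pair of e s in rR and e' (1 - e) s in r'R, and
comes back as g times the sum of the two. *)
Lemma stalk_in_class_add (r r' : R) :
  stalk_in_class r -> stalk_in_class r' -> stalk_in_class (r + r').
Proof.
move=> Jr Jr' m; have [g [x ex] hg] := idempotent_generator (r + r').
have [e [y ey] he] := idempotent_generator r.
have [e' [y' ey'] he'] := idempotent_generator r'.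
pose X (b : bool) := stalk (principal (if b then r else r')) m.
have h1 s : principal (r + r') s -> principal r (e * s).
  by move=> _; exists (y * s); rewrite ey mulrA.
have h2 s : principal (r + r') s -> principal r' (e' * (1 - e) * s).
  by move=> _; exists (y' * (1 - e) * s); rewrite ey' !mulrA.
have h3 b s : principal (if b then r else r') s -> principal (r + r') (g * s).
  by move=> _; exists (x * s); rewrite ex mulrA.
pose i : chain_map (stalk (principal (r + r')) m) (dsumI X) :=
  chain_add (chain_comp (dsumI_in X true) (stalk_mul m h1))
            (chain_comp (dsumI_in X false) (stalk_mul m h2)).
pose p : chain_map (dsumI X) (stalk (principal (r + r')) m) :=
  dsumI_out (fun b => stalk_mul m (h3 b)).
apply: (closed_stalk_principal (i := i) (p := p) cQ); last first.
  by apply: (closed_dsumI cQ) => -[]; [apply: Jr|apply: Jr'].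
move=> u; rewrite /i /p.
change (stalk_val (p (m + 1) (dsumI_in X true (m + 1) (stalk_mul m h1 (m + 1) u)
  + dsumI_in X false (m + 1) (stalk_mul m h2 (m + 1) u))) = stalk_val u).
rewrite linearD /p !dsumI_out_in.
have -> : forall v w : stalk (principal (r + r')) m (m + 1),
  stalk_val (v + w) = stalk_val v + stalk_val w by [].
rewrite !stalk_mulE; have [t ->] := stalk_mem u.
rewrite -mulrDr.
have -> : e * ((r + r') * t) + e' * (1 - e) * ((r + r') * t) = (r + r') * t.
  rewrite !(mulrA _ (r + r')) -mulrDl; congr (_ * t).
  have er : e * r = r by apply: he; apply: principalP.
  have er' : e' * r' = r' by apply: he'; apply: principalP.
  have z1 : e' * (1 - e) * r = 0.
    by rewrite -mulrA mulrBl mul1r er subrr mulr0.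
  have z2 : e' * (1 - e) * r' = r' - e * r'.
    by rewrite mulrAC er' mulrBr mulr1 mulrC.
  rewrite (mulrDr e) (mulrDr (e' * (1 - e))) er z1 z2 add0r -addrA.
  congr (_ + _).
  by rewrite addrCA subrr addr0.
by rewrite hg //; exists t.
Qed.

Lemma stalk_in_class0 : stalk_in_class 0.
Proof.
move=> m; apply: (closed_acyclic cQ) => n u _; exists 0; rewrite linear0.
by apply: stalk_ext; have [t ->] := stalk_mem u; rewrite mul0r.
Qed.

Definition class_ideal : ideal R :=
  @Submodule R R^o stalk_in_class stalk_in_class0
    (fun a u v hu hv => stalk_in_class_add (@stalk_in_class_mul u a hu) hv).

End Closed.

Section ShiftStalk.
Variables (N : ideal R) (m : int).
Fact stalk_shift_mem j (u : stalk N m j) :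
  stalk_sub N (m + 1) (j + 1) (stalk_val u).
Proof.
split; first exact: stalk_mem.
by move=> jm; apply: (@stalk_out _ _ _ _ u) => e; apply: jm; rewrite e.
Qed.
Definition stalk_shift_fun j (u : stalk N m j) : shift (stalk N (m + 1)) j :=
  SubOf (stalk_shift_mem u).
Fact stalk_shift_linear j : linear (@stalk_shift_fun j).
Proof. by move=> a u v; apply: stalk_ext. Qed.
HB.instance Definition _ j := GRing.isLinear.Build R (stalk N m j)
  (shift (stalk N (m + 1)) j) *:%R (@stalk_shift_fun j) (@stalk_shift_linear j).
Fact stalk_shift_diff j (u : stalk N m j) :
  stalk_shift_fun (diff _ j u)
  = diff (shift (stalk N (m + 1))) j (stalk_shift_fun u).
Proof.
rewrite stalk_diff; apply: stalk_ext.
change (0 = stalk_val (- diff (stalk N (m + 1)) (j + 1) (stalk_shift_fun u))).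
by rewrite stalk_diff; apply/esym/oppr0.
Qed.
Definition stalk_shift : chain_map (stalk N m) (shift (stalk N (m + 1))) :=
  @ChainMap R _ _ (fun j => @stalk_shift_fun j : {linear _ -> _})
    stalk_shift_diff.

Lemma stalk_shift_quasi_iso : quasi_iso stalk_shift.
Proof.
suff [] : triv_fib stalk_shift by [].
apply: surj_exact_kernel => [j u|j u _ u0]; last first.
  exists 0; rewrite linear0 //; apply: stalk_ext.
  exact: (esym (congr1 (@stalk_val R N (m + 1) _) u0)).
have h : stalk_sub N m j (stalk_val u).
  split; first exact: stalk_mem.
  by move=> jm; apply: (@stalk_out _ _ _ _ u) => /addIr.
by exists (SubOf h); apply: stalk_ext.
Qed.
End ShiftStalk.

Lemma int_invariant (T : int -> Prop) :
  (forall m, T m <-> T (m + 1)) -> forall m k, T m -> T k.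
Proof.
move=> h; have hn (n : nat) m : T m <-> T (m + n%:Z).
  elim: n => [|n IH]; first by rewrite addr0.
  by rewrite IH h -addrA -addn1 PoszD.
move=> m k; move: (subrKC m k); move: (k - m) => d <-.
case: d => n Tm; first by have [h1 _] := hn n m; apply: h1.
by have [_] := hn n.+1 (m + Negz n); rewrite NegzE subrK; apply.
Qed.

Lemma loc_stalk_degree (P : ob (\D R) -> Prop) (N : ideal R) m k :
  localising P -> P (stalk N m) -> P (stalk N k).
Proof.
move=> locP; apply: (@int_invariant (fun m => P (stalk N m))) => {}m.
have qs := stalk_shift_quasi_iso N m.
have [h1 h2] := loc_shift locP (stalk N (m + 1)); split=> h.
  by apply: h2; apply: loc_quasi_iso qs h.
by apply: loc_quasi_iso_inv qs _ => //; apply: h1.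
Qed.

(** * Simple quotients of a cycle module *)

(** U is maximal among the submodules that contain U0 and avoid x0, so for y
outside U there are r and u in U with x0 = r y + u.  Let e = t r be the
idempotent generator of rR.  Then e y = t x0 modulo U, and (1 - e) y is in U,
since otherwise x0 would be a multiple of it modulo U, and then both e x0
and (1 - e) x0 = (1 - e) u would lie in U. *)
Lemma maximal_submodule (V : lmodType R) (U0 : submodule V) (x0 : V) :
  ~ U0 x0 -> exists U : submodule V,
    [/\ forall u, U0 u -> U u, ~ U x0 & forall y, exists r, U (y - r *: x0)].
Proof.
move=> nx0.
pose good (A : set V) := [/\ forall a u v, A u -> A v -> A (a *: u + v),
  forall u, U0 u -> A u & ~ A x0].
(* Zorn's lemma is applied to a property that also holds for the empty chain. *)
pose T (A : set V) := (forall u, ~ A u) \/ good A.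
have [A [TA maxA]] : exists A, T A /\ forall B, (A `<` B)%classic -> ~ T B.
  apply: Zorn_bigcup => F FT tot.
  have [[A0 [FA0 [u0 Au0]]]|no] := pselect (exists A, F A /\ exists u, A u).
    have gA A u : F A -> A u -> good A.
      by move=> /FT[] // nA /nA.
    right; split.
    - move=> a u v [A FA Au] [B FB Bv].
      have [AB|BA] := tot A B FA FB.
        have [lB _ _] := gA B v FB Bv.
        by exists B => //; apply: lB => //; apply: AB.
      have [lA _ _] := gA A u FA Au.
      by exists A => //; apply: lA => //; apply: BA.
    - move=> u U0u; have [_ h _] := gA _ _ FA0 Au0.
      by exists A0 => //; apply: h.
    - by move=> [A FA Ax]; have [_ _] := gA _ _ FA Ax.
  by left=> u [A FA Au]; apply: no; exists A; split=> //; exists u.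
have goodU0 : good U0.
  by split=> // a u v; apply: smL.
have gA : good A.
  case: TA => // nA; case: (maxA U0) => //; last by right.
  by split=> [u /nA //|/(_ 0 (sm0 U0)) /nA].
have [lA U0A nA] := gA.
pose U := Submodule (U0A 0 (sm0 U0)) lA.
exists U; split=> // y.
have grow z : ~ U z -> exists r u, U u /\ x0 = r *: z + u.
  move=> nz; apply: contrapT => hno.
  pose B : set V := fun w => exists r u, U u /\ w = r *: z + u.
  case: (maxA B).
    split=> [u Au|]; first by exists 0, u; rewrite scale0r add0r.
    by move=> /(_ z) h; apply: nz; apply: h; exists 1, 0;
      rewrite scale1r addr0; split=> //; apply: (sm0 U).
  right; split=> //.
  - move=> a u v [r [u' [Uu' ->]]] [s [v' [Uv' ->]]].
    exists (a * r + s), (a *: u' + v'); split; first exact: (smL (s := U)).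
    by rewrite scalerDr scalerA scalerDl addrACA.
  - move=> u U0u; exists 0, u; rewrite scale0r add0r.
    by split=> //; exact: (U0A u).
have [Uy|/grow[r [u [Uu ex]]]] := pselect (U y).
  by exists 0; rewrite scale0r subr0.
have [e [t et] he] := idempotent_generator r.
have Ue1 : U (x0 - e *: x0).
  rewrite ex scalerDr scalerA he; last exact: principalP.
  rewrite opprD addrACA subrr add0r.
  by apply: (smB (S := U)) => //; apply: (smZ (S := U)).
have Uy1 : U (y - e *: y).
  apply: contrapT => /grow[s [v [Uv ex']]]; apply: nA.
  rewrite -[x0](subrK (e *: x0)); apply: (smD (S := U)) => //.
  rewrite [in X in U X]ex' scalerDr scalerA mulrC -scalerA scalerBr scalerA.
  have ee : e * e = e by apply: he; exists t.
  by rewrite ee subrr scaler0 add0r; apply: (smZ (S := U)).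
exists t; rewrite -[y](subrK (e *: y)) -addrA; apply: (smD (S := U)) => //.
rewrite et mulrC -scalerA -scalerBr.
have -> : r *: y - x0 = - u by rewrite ex opprD addNKr.
by apply: (smZ (S := U)); apply: (smN (S := U)).
Qed.

End StalkIdeal.

Lemma torsion_linear (R : comPzRingType) (V : lmodType R) a (u v : V) r :
  a *: u + v - r *: (a *: u + v) = a *: (u - r *: u) + (v - r *: v).
Proof.
by rewrite (scalerDr r) opprD addrACA (scalerBr a) !scalerA (mulrC a).
Qed.

(** * Objects of a smashing subcategory have torsion cohomology *)

Section Key.
Variables (R : comPzRingType) (P : ob (\D R) -> Prop).
Hypothesis af : absolutely_flat R.
Hypothesis locP : localising P.
Variable G : functor (\D R) (full_subcategory P).
Variable adjG : adjunction (inclusion P) G.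
Hypothesis presG : preserves_coproducts G.

Definition smashing_ideal : ideal R := class_ideal af (loc_closed locP).

(** Let N be the conductor of x0 into U, so that X maps to R/N in degree n + 1,
x0 to 1, with kernel U.  Instead of R/N, [residue] is the cone of N -> R, and
[resolved] is the fibre product of X and [residue] over R/N, written as a
congruence modulo U in degree n + 1. *)
Section Resolution.
Variables (X : complex R) (n : int) (x0 : X (n + 1)).
Hypothesis dx0 : diff X (n + 1) x0 = 0.
Variable U : submodule (X (n + 1)).
Hypothesis U_bnd : forall x : X (n + 1), boundary x -> U x.
Hypothesis U_gen : forall y, exists r, U (y - r *: x0).

Definition conductor_mem (r : R^o) := U (r *: x0).
Fact conductor0 : conductor_mem 0.
Proof. by rewrite /conductor_mem scale0r; apply: sm0. Qed.
Fact conductorL (a : R) (u v : R^o) :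
  conductor_mem u -> conductor_mem v -> conductor_mem (a *: u + v).
Proof.
move=> hu hv; rewrite /conductor_mem scalerDl -[a *: u]/(a * u) -scalerA.
exact: smL.
Qed.
Definition conductor : ideal R := Submodule conductor0 conductorL.

Fact conductor_unit s : conductor s -> unit_ideal R (1 * s). Proof. by []. Qed.
Definition residue : complex R := cone (stalk_mul n conductor_unit).

Definition res_sub_mem j (w : dsum X residue j) :=
  forall e : j = n + 1, U (eq_rect j (fun i => X i : Type)
    (w.1 - stalk_val w.2.2 *: csingle x0 j) (n + 1) e).

Fact res_sub0 j : res_sub_mem (0 : dsum X residue j).
Proof.
move=> e; subst j.
change (U (0 - (0 : R) *: csingle x0 (n + 1))).
by rewrite scale0r subr0; apply: sm0.
Qed.
Fact res_subL j a (u v : dsum X residue j) :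
  res_sub_mem u -> res_sub_mem v -> res_sub_mem (a *: u + v).
Proof.
move=> hu hv e; subst j; move: (hu erefl) (hv erefl) => {}hu {}hv.
have := smL a hu hv; congr (U _).
by rewrite stalk_valL scalerDl scalerBr scalerA opprD addrACA.
Qed.
Definition res_sub j : submodule (dsum X residue j) :=
  Submodule (@res_sub0 j) (@res_subL j).

Lemma res_subE (w : dsum X residue (n + 1)) :
  res_sub (n + 1) w <-> U (w.1 - stalk_val w.2.2 *: x0).
Proof.
split=> [/(_ erefl) /=|h e]; first by rewrite csingleE.
by rewrite (eq_axiomK e) /= csingleE.
Qed.

Fact res_sub_diff j (w : dsum X residue j) :
  res_sub j w -> res_sub (j + 1) (diff (dsum X residue) j w).
Proof.
move=> _; have [jn|jn] := pselect (j = n); last first.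
  by move=> e; case: jn; apply: addIr e.
subst j; apply/res_subE; case: w => x [c1 c2].
change (U (diff X n x - stalk_val (stalk_mul n conductor_unit (n + 1) c1
  + diff (stalk (unit_ideal R) n) n c2) *: x0)).
rewrite stalk_diff addr0 stalk_mulE mul1r; apply: smB.
  by apply: U_bnd; exists x.
exact: (stalk_mem c1).
Qed.

Definition resolved : complex R := subcomplex res_sub_diff.
Definition resolved_fst : chain_map resolved X :=
  chain_comp (dsum_fst X residue) (sub_incl res_sub_diff).
Definition resolved_snd : chain_map resolved residue :=
  chain_comp (dsum_snd X residue) (sub_incl res_sub_diff).

Lemma resolved_triv_fib : triv_fib resolved_fst.
Proof.
apply: surj_exact_kernel => [j x|j].
  have [jn|jn] := pselect (j = n + 1).
    subst j; have [r hr] := U_gen x.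
    have h : res_sub (n + 1) (x, (0, r *: stalk_in n (I : unit_ideal R 1))).
      apply/res_subE; change (U (x - (r * 1) *: x0)).
      by rewrite mulr1.
    by exists (SubOf h).
  have h : res_sub j (x, 0) by move=> e; case: jn.
  by exists (SubOf h).
move=> [[x [c1 c2]] h] dw; rewrite [LHS]/= => x_0.
have {}dw : diff residue (j + 1) (c1, c2) = 0.
  exact: (congr1 (fun w : resolved (j + 1 + 1) => resolved_snd _ w) dw).
have [_] := cone_cycle dw; rewrite stalk_diff addr0 => c10.
have c1_0 : c1 = 0.
  apply: stalk_ext; have := congr1 (@stalk_val R _ n _) c10.
  by rewrite stalk_mulE mul1r.
have [jn|jn] := pselect (j = n); last first.
  have c2_0 : c2 = 0.
    by apply: stalk_ext; rewrite stalk_out // => /addIr.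
  exists 0; rewrite linear0 //; apply: sub_ext.
  by rewrite /= x_0 c1_0 c2_0.
subst j x c1; have := h; move=> /res_subE /=.
rewrite sub0r => /smN; rewrite opprK => hc.
pose m1 : stalk conductor n (n + 1) :=
  stalk_in n (hc : conductor (stalk_val c2)).
have h1 : res_sub n (0, (m1, 0)).
  move=> e; have := congr1 (fun k => k - n) e.
  by rewrite subrr addrAC subrr add0r.
exists (SubOf h1) => //; apply: sub_ext.
rewrite [LHS]/= /dsum_fun linear0; congr pair.
rewrite [LHS]cone_diffE stalk_diff oppr0 stalk_diff addr0; congr pair.
by apply: stalk_ext; rewrite stalk_mulE mul1r.
Qed.

Fact resolved_cycle_mem :
  res_sub (n + 1) (x0, (0, stalk_in n (I : unit_ideal R 1))).
Proof.
apply/res_subE; change (U (x0 - (1 : R) *: x0)).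
by rewrite scale1r subrr; apply: sm0.
Qed.
Definition resolved_cycle : resolved (n + 1) := SubOf resolved_cycle_mem.

Lemma diff_resolved_cycle : diff resolved (n + 1) resolved_cycle = 0.
Proof.
apply: sub_ext; rewrite [LHS]/= /dsum_fun dx0; congr pair.
by rewrite [LHS]cone_diffE !stalk_diff oppr0 linear0 addr0.
Qed.

End Resolution.

(** For a class x0 that is not J-torsion, the cocycle (x0, (0, 1)) of [resolved]
lifts x0 and maps to 1 in the residue complex.  As N is a ghost, it yields rho
congruent to 1 modulo N and in the image of an object of P, against J
being contained in N. *)
Theorem smashing_torsion X : P X -> torsion smashing_ideal X.
Proof.
move=> PX n x0 dx0; apply: contrapT => hno.
pose U0_mem (y : X (n + 1)) :=
  exists2 r : R, smashing_ideal r & boundary (y - r *: y).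
have U00 : U0_mem 0.
  by exists 0; [apply: sm0|rewrite scaler0 subrr; apply: boundary0].
have U0L a u v : U0_mem u -> U0_mem v -> U0_mem (a *: u + v).
  move=> [r Jr bu] [s Js bv]; exists (r + s - s * r).
    by apply: idealB; [apply: idealD|apply: idealM].
  rewrite -torsion_combine.
  set w := a *: u + v.
  have -> : w - r *: w = a *: (u - r *: u) + (v - r *: v).
    exact: torsion_linear.
  have bvr : boundary (v - r *: v - s *: (v - r *: v)).
    have := boundaryB bv (boundaryZ r bv).
    by rewrite !torsion_combine (addrC s) (mulrC s).
  set u1 := u - r *: u in bu *; set v1 := v - r *: v in bvr *.
  have -> : a *: u1 + v1 - s *: (a *: u1 + v1)
      = a *: (u1 - s *: u1) + (v1 - s *: v1).
    exact: torsion_linear.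
  apply: boundaryD => //; apply: boundaryZ; apply: boundaryB => //.
  exact: boundaryZ.
pose U0 := Submodule U00 U0L.
have [U [U0U nx0 Ugen]] := maximal_submodule af (U0 := U0) hno.
have Ubnd (x : X (n + 1)) : boundary x -> U x.
  move=> bx; apply: U0U; exists 0; first exact: sm0.
  by rewrite scale0r subr0.
pose N := conductor x0 U.
have JN r : smashing_ideal r -> N r.
  move=> Jr; apply: U0U; have [e [t et] he] := idempotent_generator af r.
  exists e; first by rewrite et mulrC; apply: idealM.
  rewrite scalerA he; last exact: principalP.
  by rewrite subrr; apply: boundary0.
have tX' := resolved_triv_fib Ubnd Ugen.
have PX' := loc_quasi_iso_inv locP tX'.2 PX.
have gh : ghost P N (shift (stalk N n)).
  by apply: ghost_shift => //; exact: (ghost_stalk_ideal locP adjG presG).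
pose phi := resolved_snd x0 Ubnd.
have dx' := diff_resolved_cycle dx0 Ubnd.
have [r [E [g [e [Nr PE de be th]]]]] :=
  gh _ PX' (chain_comp (cone_out _) phi) n _ dx'.
have [V [t [w [tt th2]]]] := @cone_lift _ _ _ _ _ (chain_comp phi g) th.
have PV := loc_quasi_iso_inv locP tt.2 PE.
have [v dv ev] := triv_fib_cycle tt de.
pose rho : R := stalk_val (w (n + 1) v).
have Nrho : N (1 - r - rho).
  have b1 := thru_boundary th2 dv; have b2 := boundary_map phi be.
  have e1 : chain_comp (chain_comp phi g) t (n + 1) v
      = phi (n + 1) (g (n + 1) e).
    by rewrite -ev.
  rewrite e1 in b1; rewrite linearB in b2.
  have := boundaryB b1 b2; rewrite opprB addrC subrKA => -[[m1 m2] em].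
  have : stalk_val (stalk_mul n (@conductor_unit X n x0 U) (n + 1) m1
      + diff (stalk (unit_ideal R) n) n m2) = 1 - r * 1 - rho.
    exact: (congr1 (fun z : residue x0 U (n + 1) => stalk_val z.2) em).
  rewrite mulr1 stalk_diff addr0 stalk_mulE mul1r => <-.
  exact: stalk_mem.
(* rho R is a retract of V: s goes to s y v, where rho = rho^2 y, and w
   followed by rho y brings it back. *)
have Jrho : smashing_ideal rho.
  have [y ey] := af rho.
  move=> m; apply: (loc_stalk_degree m locP (m := n)).
  have h s : unit_ideal R s -> principal rho (rho * y * s).
    by move=> _; exists (y * s); rewrite mulrA.
  have dyv : diff V (n + 1) (y *: v) = 0 by rewrite linearZZ dv scaler0.
  apply: (closed_stalk_principal (i := stalk_map (principal rho) dyv)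
    (p := chain_comp (stalk_mul n h) w) (loc_closed locP)) => // u.
  change (stalk_val (stalk_mul n h (n + 1) (w (n + 1)
    (stalk_map (principal rho) dyv (n + 1) u))) = stalk_val u).
  rewrite stalk_mapE stalk_mulE.
  have -> : w (n + 1) (stalk_val u *: (y *: v))
      = stalk_val u *: (y *: w (n + 1) v) by rewrite linearZ /= linearZ.
  rewrite !stalk_valZ -/rho; have [s ->] := stalk_mem u.
  have e3 : rho * y * rho = rho by rewrite [RHS]ey expr2 mulrAC.
  by rewrite (mulrACA rho s) !(mulrCA (rho * y) s) !e3 mulrC.
apply: nx0; have N1 : N 1.
  have := idealD (idealD Nrho (JN _ Jrho)) Nr.
  by rewrite subrK subrK.
by have := N1; rewrite /N /= /conductor_mem scale1r.
Qed.

End Key.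

(** * Compactness *)

Section Additive.
Variables (R : comPzRingType) (n : int).
Implicit Types X Y Z : complex R.

Lemma induces_eql X Y (w : dhom X Y) (x x' : X (n + 1)) (y : Y (n + 1)) :
  induces w x y -> boundary (x - x') -> induces w x' y.
Proof.
move=> h b; have dx' : diff X (n + 1) x' = 0.
  have := boundary_cycle b; rewrite linearB /= (induces_cyclel h) sub0r.
  by move=> /eqP; rewrite oppr_eq0 => /eqP.
have [y' h'] := induces_total w dx'; apply: (induces_eqr h').
by have := boundaryN (induces_uniq h h' b); rewrite opprB.
Qed.

Lemma induces_D X Y (w : dhom X Y) (x x' : X (n + 1)) (y y' : Y (n + 1)) :
  induces w x y -> induces w x' y' -> induces w (x + x') (y + y').
Proof. by move=> h h'; have := induces_lin 1 h h'; rewrite !scale1r. Qed.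

Lemma quasi_iso_class X Y (s : chain_map X Y) (y : Y (n + 1)) :
  quasi_iso s -> diff Y (n + 1) y = 0 ->
  exists2 x, diff X (n + 1) x = 0 & boundary (s (n + 1) x - y).
Proof.
move=> qs dy; have [_ ss] := qs n; have [x [y' [dx ->]]] := ss y dy.
exists x => //; rewrite opprD addrA subrr add0r.
by apply: boundaryN; exists y'.
Qed.

Lemma boundary_pair X Y (x : X (n + 1)) (y : Y (n + 1)) :
  boundary x -> boundary y -> boundary ((x, y) : dsum X Y (n + 1)).
Proof. by move=> [x' <-] [y' <-]; exists (x', y'). Qed.

Lemma dsuml_induces Z X Y (w : dhom X Y) (z : Z (n + 1)) x y :
  diff Z (n + 1) z = 0 -> induces w x y ->
  induces (dsuml Z w) ((x, z) : dsum X Z (n + 1)) ((y, z) : dsum Y Z (n + 1)).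
Proof.
move=> dz h.
have [y' h1 h2] : exists2 y', induces w x y' & induces (dsuml Z w)
    ((x, z) : dsum X Z (n + 1)) ((y', z) : dsum Y Z (n + 1)).
  have := induces_cyclel h.
  elim: w x {y h} =>
    [{}X {}Y f|{}X {}Y s qs|{}X {}Y W g IHg f IHf] x dx.
  - exists (f (n + 1) x); first exact: induces_loc.
    apply: (induces_loc (dsum_map f (chain_id Z)) (x := (x, z))).
    by rewrite /= /dsum_fun /= dx dz.
  - have [x' dx' b] := quasi_iso_class qs dx; exists x'.
      exact: induces_eql (induces_dinv qs dx') b.
    have dp : diff (dsum X Z) (n + 1) (x', z) = 0.
      by rewrite /= /dsum_fun /= dx' dz.
    have h := induces_dinv (quasi_iso_dsum qs (quasi_iso_id Z)) dp.
    apply: (induces_eql h); apply: boundary_pair => //=.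
    by rewrite subrr; apply: boundary0.
  - have [y h1 h2] := IHf x dx; have [v h3 h4] := IHg y (induces_cycler h1).
    by exists v; [apply: induces_comp h1 h3|apply: induces_comp h2 h4].
apply: (induces_eqr h2); apply: boundary_pair.
  by apply: (induces_uniq h1 h); rewrite subrr; apply: boundary0.
by rewrite subrr; apply: boundary0.
Qed.

Lemma dsumr_induces Z X Y (w : dhom X Y) (z : Z (n + 1)) x y :
  diff Z (n + 1) z = 0 -> induces w x y ->
  induces (dsumr Z w) ((z, x) : dsum Z X (n + 1)) ((z, y) : dsum Z Y (n + 1)).
Proof.
move=> dz h.
have [y' h1 h2] : exists2 y', induces w x y' & induces (dsumr Z w)
    ((z, x) : dsum Z X (n + 1)) ((z, y') : dsum Z Y (n + 1)).
  have := induces_cyclel h.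
  elim: w x {y h} =>
    [{}X {}Y f|{}X {}Y s qs|{}X {}Y W g IHg f IHf] x dx.
  - exists (f (n + 1) x); first exact: induces_loc.
    apply: (induces_loc (dsum_map (chain_id Z) f) (x := (z, x))).
    by rewrite /= /dsum_fun /= dx dz.
  - have [x' dx' b] := quasi_iso_class qs dx; exists x'.
      exact: induces_eql (induces_dinv qs dx') b.
    have dp : diff (dsum Z X) (n + 1) (z, x') = 0.
      by rewrite /= /dsum_fun /= dx' dz.
    have h := induces_dinv (quasi_iso_dsum (quasi_iso_id Z) qs) dp.
    apply: (induces_eql h); apply: boundary_pair => //=.
    by rewrite subrr; apply: boundary0.
  - have [y h1 h2] := IHf x dx; have [v h3 h4] := IHg y (induces_cycler h1).
    by exists v; [apply: induces_comp h1 h3|apply: induces_comp h2 h4].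
apply: (induces_eqr h2); apply: boundary_pair.
  by rewrite subrr; apply: boundary0.
by apply: (induces_uniq h1 h); rewrite subrr; apply: boundary0.
Qed.

Lemma dadd_induces X Y (f g : dhom X Y) (x : X (n + 1)) y z :
  induces f x y -> induces g x z ->
  induces (@dadd R X Y f g : dhom X Y) x (y + z).
Proof.
move=> hf hg; have dx := induces_cyclel hf; have dz := induces_cycler hg.
have h1 := induces_loc (diag_chain X) dx.
have h2 := dsumr_induces dx hg.
have h3 := dsuml_induces dz hf.
have h4 : induces (dloc (codiag_chain Y)) ((y, z) : dsum Y Y (n + 1)) (y + z).
  apply: (induces_loc (codiag_chain Y) (x := (y, z))).
  exact: (induces_cycler h3).
exact: (induces_comp h1 (induces_comp h2 (induces_comp h3 h4))).
Qed.

Lemma sum_injections_induces C (I : small_index) (X : I -> complex R) Y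
    (inj : forall i, dhom (X i) Y) (s : seq I) (g : forall i, dhom C (X i))
    (c : C (n + 1)) (z : I -> Y (n + 1)) : diff C (n + 1) c = 0 ->
  (forall i, induces (dcomp (inj i) (g i)) c (z i)) ->
  induces (@sum_injections R C I X Y inj s g : dhom C Y) c (\sum_(i <- s) z i).
Proof.
move=> dc hz; elim: s => [|i s IH].
  by rewrite big_nil; apply: (induces_loc (zero_chain C Y)).
by rewrite big_cons; exact: (dadd_induces (hz i) IH).
Qed.

End Additive.

Lemma classic_In (I : Type) (i : I) (s : seq I) :
  List.In i s <-> (i : {classic I}) \in (s : seq {classic I}).
Proof.
elim: s => [|k s IH] //=; rewrite inE; split.
  by case=> [->|/IH ->]; rewrite ?eqxx ?orbT.
by move=> /orP[/eqP ->|/IH]; [left|right].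
Qed.

Lemma classic_NoDup (I : Type) (s : seq I) :
  uniq (s : seq {classic I}) -> List.NoDup s.
Proof.
elim: s => [|k s IH] /=; first by constructor.
move=> /andP[nk us]; constructor; last exact: IH.
by move=> /classic_In; apply/negP.
Qed.

(** By [stalk_hom] and [stalk_hom_eq], maps from rR = eR in degree m + 1 to Y
are the classes of H^(m+1)(Y) fixed by e. *)
Section Compact.
Variables (R : comPzRingType) (r : R) (m : int).
Hypothesis af : absolutely_flat R.

Let C := stalk (principal r) m.

Lemma stalk_generator : exists e : C (m + 1),
  [/\ stalk_val e *: e = e, diff C (m + 1) e = 0 &
      forall u : C (m + 1), stalk_val u *: e = u].
Proof.
have [e pe he] := idempotent_generator af r.
have h (u : C (m + 1)) : stalk_val u *: stalk_in m pe = u.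
  apply: stalk_ext; rewrite stalk_valZ stalk_inE mulrC he //.
  exact: stalk_mem.
by exists (stalk_in m pe); split; [apply: h|apply: stalk_diff|apply: h].
Qed.

Definition stalk_gen : C (m + 1) := sval (cid stalk_generator).
Lemma stalk_gen_idem : stalk_val stalk_gen *: stalk_gen = stalk_gen.
Proof. by have [] := svalP (cid stalk_generator). Qed.
Lemma diff_stalk_gen : diff C (m + 1) stalk_gen = 0.
Proof. exact: stalk_diff. Qed.
Lemma stalk_genP (u : C (m + 1)) : stalk_val u *: stalk_gen = u.
Proof. by have [_ _] := svalP (cid stalk_generator). Qed.

(** rR is projective, so trivial fibrations onto it split. *)
Lemma stalk_hom Y (w : dhom C Y) : exists h : chain_map C Y, deq w (dloc h).
Proof.
have [V [t [f [tt e]]]] := roofP w.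
have [v dv ev] := triv_fib_cycle tt diff_stalk_gen.
pose s := stalk_map (principal r) dv.
exists (chain_comp f s).
have ts : ceq (chain_comp t s) (chain_id C).
  move=> j u; have [jm|jm] := pselect (j = m + 1).
    subst j; change (t (m + 1) (s (m + 1) u) = u).
    by rewrite /s stalk_mapE linearZZ ev stalk_genP.
  by apply: stalk_ext; rewrite !stalk_out.
rewrite deq_loc_comp -e -deq_A -deq_loc_comp.
rewrite (dloc_ceq ts); exact: (deq_sym (deq_m1 w)).
Qed.

(** A cochain c that bounds the difference of the two images of the generator
extends that difference over the cone of the identity. *)
Lemma stalk_hom_eq Y (w w' : dhom C Y) y y' :
  induces w stalk_gen y -> induces w' stalk_gen y' -> boundary (y - y') ->
  deq w w'.
Proof.
move=> hy hy' b; have [h e] := stalk_hom w; have [h' e'] := stalk_hom w'.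
have [c ec] : boundary (h (m + 1) stalk_gen - h' (m + 1) stalk_gen).
  have u1 := induces_uniq (induces_deq e hy) (induces_loc h diff_stalk_gen).
  have u2 := induces_uniq (induces_deq e' hy') (induces_loc h' diff_stalk_gen).
  rewrite subrr in u1; rewrite subrr in u2.
  have := boundaryB (boundaryD (u2 (boundary0 _ _)) (boundaryN b))
                    (u1 (boundary0 _ _)).
  rewrite opprB !opprB => hb.
  have -> : h (m + 1) stalk_gen - h' (m + 1) stalk_gen
    = - (y - h (m + 1) stalk_gen) + (y - y') + (y' - h' (m + 1) stalk_gen).
    by rewrite opprB subrKA subrKA.
  apply: boundaryD; last exact: u2 (boundary0 _ _).
  by apply: boundaryD => //; apply: boundaryN; apply: u1 (boundary0 _ _).
rewrite e e'; apply: thru_deq.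
pose p := chain_add h (chain_opp h').
pose k j : {linear C (j + 1) -> Y j} :=
  stalk_scale (principal r) m (j + 1) (csingle c j).
have hp j (u : C (j + 1)) : p (j + 1) (chain_id C (j + 1) u)
    = diff Y j (k j u) + k (j + 1) (diff C (j + 1) u).
  rewrite stalk_diff linear0 addr0 /k stalk_scaleE.
  change (h (j + 1) u + chain_opp h' (j + 1) u
    = diff Y j (stalk_val u *: csingle c j)).
  rewrite chain_oppE; have [jm|jm] := pselect (j = m); last first.
    have -> : u = 0 by apply: stalk_ext; rewrite stalk_out // => /addIr.
    by rewrite !linear0 ?oppr0 addr0 csingle0 // scaler0 linear0.
  by subst j; rewrite csingleE linearZZ ec scalerBr -!linearZZ !stalk_genP.
exists (cone (chain_id C)), (cone_in (chain_id C)), (cone_desc hp).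
split; first exact: acyclic_cone_id.
move=> j u; rewrite /= /cone_desc_fun /= linear0 add0r.
by rewrite scaleN1r.
Qed.

(** Surjectivity: an arbitrary coproduct Y is isomorphic to the direct sum,
where the image of the generator has finitely many components.  Injectivity:
the universal property gives projections of Y onto the summands. *)
Theorem stalk_compact : @compact_object R C.
Proof.
move=> I X Y inj cop; split=> [f|s g nds s0 i0 si0].
  have [l [hl _]] := cop (dsumI X) (fun i => dloc (dsumI_in X i)).
  have [k [hk _]] := @dsumI_coproduct R I X Y inj.
  have kl : deq (dcomp k l) (dloc (chain_id Y)).
    have [h [_ uh]] := cop Y inj.
    have uid := uh (idm _) (fun i => cmp1m _).
    apply: deq_trans (uh (k \circ l) _) (deq_sym uid) => i.
    apply: (deq_trans (deq_sym (deq_A _ _ _))).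
    apply: (deq_trans _ (hk i)); apply: deq_comp => //; exact: (hl i).
  have [u hu] := induces_total (dcomp l f) diff_stalk_gen.
  pose a := stalk_val stalk_gen; pose u' := a *: u.
  have hu' : induces (dcomp l f) stalk_gen u'.
    have h0 := induces0 m (dcomp l f).
    have := induces_lin a hu h0; rewrite !addr0.
    by rewrite /a stalk_gen_idem.
  have du' := induces_cycler hu'.
  have au' : a *: u' = u'.
    rewrite /u' scalerA; congr (_ *: _).
    by have := congr1 (@stalk_val _ _ _ _) stalk_gen_idem; rewrite stalk_valZ.
  have dui i : diff (X i) (m + 1) (coor u' i) = 0.
    by rewrite -coor_diff du' coor0.
  have [s us hs] := coor_supp u'.
  pose g i : dhom C (X i) := dloc (stalk_map (principal r) (dui i)).
  exists (s : seq I), g; split; first exact: classic_NoDup.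
  have hg i : induces (g i) stalk_gen (coor u' i).
    have := induces_loc (stalk_map (principal r) (dui i)) diff_stalk_gen.
    rewrite stalk_mapE -/a => h; move: h.
    have e : a *: coor u' i = coor u' i.
      exact: (congr1 (fun w : dsumI X (m + 1) => coor w i) au').
    by rewrite e.
  have /(_ _)/cid hz : forall i, exists z,
      induces k (dsumI_in X i (m + 1) (coor u' i)) z.
    by move=> i; apply: induces_total; rewrite -cmap_diff dui linear0.
  pose z i := sval (hz i).
  have hsum :=
    @sum_injections_induces R m C I X Y inj s g stalk_gen z diff_stalk_gen.
  have {}hsum : induces (sum_injections inj s g : dhom C Y) stalk_gen
      (\sum_(i <- s) z i).
    apply: hsum => i; apply: induces_comp (hg i) _.
    apply: (induces_deq (hk i)); apply: induces_comp (svalP (hz i)).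
    exact: induces_loc.
  have hku : induces k u' (\sum_(i <- s) z i).
    have hu'E := dsumI_injE us hs.
    rewrite [X in induces k X _]hu'E => {hu'E hs hsum us}.
    elim: (s) => [|i s' IH]; first by rewrite !big_nil; apply: induces0.
    by rewrite !big_cons; apply: induces_D => //; apply: (svalP (hz i)).
  apply: (stalk_hom_eq _ hsum (y := \sum_(i <- s) z i)); last first.
    by rewrite subrr; apply: boundary0.
  have := induces_comp hu' hku; apply: induces_deq.
  by rewrite deq_A kl; apply: deq_1m.
have [d [d1 d0]] := @select_exists I (fun j => dhom (X j) (X i0))
  (fun j => dloc (zero_chain _ _)) i0 (dloc (chain_id _)).
have [p [hp _]] := cop (X i0) d.
have /(_ _)/cid hy : forall i, exists y, induces (g i) stalk_gen y.
  by move=> i; apply: induces_total diff_stalk_gen.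
pose y i := sval (hy i).
have /(_ _)/cid hz : forall i, exists z, induces (inj i) (y i) z.
  by move=> i; apply: induces_total (induces_cycler (svalP (hy i))).
pose z i := sval (hz i).
have /(_ _)/cid hq : forall i, exists q, induces p (z i) q.
  by move=> i; apply: induces_total (induces_cycler (svalP (hz i))).
pose q i := sval (hq i).
have hdq i : induces (d i) (y i) (q i).
  apply: (induces_deq (hp i)).
  exact: induces_comp (svalP (hz i)) (svalP (hq i)).
have hsum : induces (sum_injections inj s g : dhom C Y) stalk_gen
    (\sum_(i <- s) z i).
  apply: sum_injections_induces; first exact: diff_stalk_gen.
  by move=> i; apply: induces_comp (svalP (hy i)) (svalP (hz i)).
have bz := zero_induces (induces_deq s0 hsum).
have hpq : induces p (\sum_(i <- s) z i) (\sum_(i <- s) q i).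
  elim: (s) => [|i s' IH]; first by rewrite !big_nil; apply: induces0.
  by rewrite !big_cons; apply: induces_D => //; apply: (svalP (hq i)).
have bq := induces_boundary hpq bz.
have q0 i : i <> i0 -> boundary (q i).
  by move=> ii; have := hdq i; rewrite d0 // => /zero_induces.
have q1 : boundary (q i0 - y i0).
  have := hdq i0; rewrite d1 => h.
  apply: (induces_uniq h (induces_loc (chain_id _) (induces_cyclel h))).
  by rewrite subrr; apply: boundary0.
have key t : List.NoDup t ->
    (~ List.In i0 t -> boundary (\sum_(i <- t) q i)) /\
    (List.In i0 t -> boundary (\sum_(i <- t) q i - y i0)).
  elim: t => [|i t IH] nd.
    by split=> //= _; rewrite big_nil; apply: boundary0.
  have [ni ndt] := proj1 (List.NoDup_cons_iff i t) nd.
  have [IH1 IH2] := IH ndt; rewrite big_cons; split=> [n0|[e|it]].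
  - apply: boundaryD; first by apply: q0 => e; apply: n0; left.
    by apply: IH1 => h; apply: n0; right.
  - subst i; rewrite addrAC; apply: boundaryD => //; exact: IH1.
  - rewrite -addrA; apply: boundaryD; last exact: IH2.
    by apply: q0 => e; apply: ni; rewrite e.
have by0 : boundary (y i0).
  have [_ /(_ si0) h] := key s nds.
  by have := boundaryB bq h; rewrite opprB addrC subrK.
apply: (stalk_hom_eq (svalP (hy i0))
  (induces_loc (zero_chain C (X i0)) diff_stalk_gen)).
by rewrite subr0.
Qed.

End Compact.

Theorem absolutely_flat_telescope (R : comPzRingType) :
  absolutely_flat R -> telescope_conjecture R.
Proof.
move=> af P [locP [G [[adjG] presG]]].
exists (fun C => P C /\ exists r m, C = stalk (principal r) m); split.
  by move=> _ [_ [r [m ->]]]; apply: stalk_compact.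
split=> //; first by move=> C [].
move=> Q locQ KQ X PX.
apply: (cellular af (loc_closed locQ) (N := smashing_ideal af locP)).
  by move=> r m Jr; apply: KQ; split; [apply: Jr|exists r, m].
exact: (smashing_torsion af locP adjG presG PX).
Qed.

Theorem theorem4p21 (S R : comPzRingType) (phi : {rmorphism S -> R}) :
  noetherian_space (Spec S) ->
  is_abs_flat_approx phi ->
  telescope_conjecture R.
Proof. by move=> _ [af _]; apply: absolutely_flat_telescope. Qed.
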